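(* Let $\Lambda$ be a basic Artin algebra with Jacobson radical $J$, with a fixed complete set of (orthogonal) primitive idempotents $\{e_1,\dots,e_r,e_{r+1},\dots,e_n\}$, ordered in such a way that $\operatorname{pdim}(\Lambda e_i/Je_i)\le1$ for $i>r$. For $e=\sum_{i=1}^re_i$, the following assertions are equivalent: (1) $\mathcal{P}^{<\infty}(\Lambda\text{-mod})$ is contravariantly finite in $\Lambda\text{-mod}$ (resp., $\Lambda\text{-mod}$ allows for unlimited iteration of strong tilting); (2) $\mathcal{P}^{<\infty}(e\Lambda e\text{-mod})$ is contravariantly finite in $e\Lambda e\text{-mod}$ (resp., $e\Lambda e\text{-mod}$ allows for unlimited iteration of strong tilting).
   Context: For an Artin algebra $A$, $A\text{-mod}$ (resp. $\text{mod-}A$) is the category of finitely generated left (resp. right) $A$-modules, and $\mathcal{P}^{<\infty}(A\text{-mod})$ (resp. $\mathcal{P}^{<\infty}(\text{mod-}A)$) its full subcategory of modules of finite projective dimension. $A$ is basic if $A/J(A)$ is a product of division rings; a module is basic if it has no indecomposable direct summand of multiplicity $>1$. $\mathcal{P}^{<\infty}(A\text{-mod})$ is contravariantly finite in $A\text{-mod}$ if for each $M\in A\text{-mod}$ there is a map $\phi:X\to M$ with $X\in\mathcal{P}^{<\infty}(A\text{-mod})$ through which every homomorphism from an object of $\mathcal{P}^{<\infty}(A\text{-mod})$ to $M$ factors. A module $T\in A\text{-mod}$ is a tilting module if (1) $T\in\mathcal{P}^{<\infty}(A\text{-mod})$, (2) $\operatorname{Ext}^i_A(T,T)=0$ for $i\ge1$,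 (3) there is an exact sequence $0\to A\to T_0\to\cdots\to T_s\to0$ with all $T_j\in\operatorname{add}(T)$. It is strong if, in addition, $\operatorname{Ext}^i_A(M,T)=0$ for all $M\in\mathcal{P}^{<\infty}(A\text{-mod})$ and $i\ge1$. Similarly for right modules. If $A\text{-mod}$ has a strong tilting module, the basic one is unique up to isomorphism. For basic Artin algebras $A,B$: $\text{mod-}B$ results from $A\text{-mod}$ via strong tilting if $A\text{-mod}$ has a basic strong tilting module $T$ and $B\cong\operatorname{End}_A(T)^{\mathrm{op}}$; $B\text{-mod}$ results from $\text{mod-}A$ via strong tilting if $\text{mod-}A$ has a basic strong tilting module $T$ and $B\cong\operatorname{End}_A(T)$. The category $A\text{-mod}$ allows for unlimited iteration of strong tilting if there is an infinite sequence of basic algebras $(A_i)_{i\ge0}$ with $A_0=A$ such that $\text{mod-}A_{i+1}$ results from $A_i\text{-mod}$ via strong tilting for $i$ even, and $A_{i+1}\text{-mod}$ results from $\text{mod-}A_i$ via strong tilting for $i$ odd. *)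

(* Defs.v *)
From HB Require Import structures.
From mathcomp Require Import all_boot all_algebra.
From mathcomp Require Import generic_quotient ring_quotient boolp.

Set Implicit Arguments.
Unset Strict Implicit.
Unset Printing Implicit Defensive.

Import GRing.Theory.
Local Open Scope ring_scope.

(* Rings are pzRingTypes (the zero ring is allowed, e.g. as a corner e R e with
   e = 0).  Left R-modules are lmodType R, right R-modules are lmodType R^c.
   Submodules and left ideals are boolean predicates; classically (boolp) these
   are all the subsets. *)

Section Modules.
Variable R : pzRingType.
Implicit Types L M N P T X Y : lmodType R.

Definition surjective M N (f : {linear M -> N}) := forall y, exists x, f x = y.

Definition exact L M N (f : {linear L -> M}) (g : {linear M -> N}) :=
  forall y, g y = 0 <-> exists x, f x = y.

Definition zero_module M := forall x : M, x = 0.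

Definition finitely_generated M :=
  exists n (g : 'I_n -> M), forall x, exists c : 'I_n -> R,
    x = \sum_i c i *: g i.

Definition projective P :=
  forall M N (f : {linear M -> N}) (g : {linear P -> N}), surjective f ->
    exists h : {linear P -> M}, forall x, f (h x) = g x.

Record proj_resolution M := ProjResolution {
  res_obj :> nat -> lmodType R;
  res_diff : forall i, {linear res_obj i.+1 -> res_obj i};
  res_aug : {linear res_obj 0 -> M};
  res_projective : forall i, projective (res_obj i);
  res_aug_surjective : surjective res_aug;
  res_exact_aug : exact (res_diff 0) res_aug;
  res_exact_diff : forall i, exact (res_diff i.+1) (res_diff i)
}.

Definition pdim_le M n :=
  exists P : proj_resolution M, forall i, (n < i)%N -> zero_module (P i).

(* The objects of P^{<oo}(R-mod). *)
Definition fin_pdim M := finitely_generated M /\ exists n, pdim_le M n.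

(* Ext^{i+1}_R(M, N) = 0: the cohomology of Hom_R(P, N) at P_{i+1} vanishes for
   every (equivalently, by the comparison theorem, for one) projective
   resolution P of M. *)
Definition ext_succ_eq0 M N i :=
  forall (P : proj_resolution M) (f : {linear P i.+1 -> N}),
    (forall x, f (res_diff P i.+1 x) = 0) ->
    exists g : {linear P i -> N}, forall x, f x = g (res_diff P i x).

Definition direct_summand X M :=
  exists (s : {linear X -> M}) (p : {linear M -> X}), cancel s p.

Definition isomorphic M N := exists f : {linear M -> N}, bijective f.

Definition indecomposable M :=
  ~ zero_module M /\
  forall X Y, isomorphic M (X * Y)%type -> zero_module X \/ zero_module Y.

(* An indecomposable X occurs in T with multiplicity > 1 when X + X is a direct
   summand of T. *)
Definition basic_module T :=
  forall X, indecomposable X -> ~ direct_summand (X * X)%type T.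

(* add(T) : direct summands of finite direct sums of copies of T. *)
Definition add_of T X := exists n, direct_summand X {ffun 'I_n -> T}.

(* An exact sequence 0 -> R -> C_0 -> ... -> C_s -> 0 with all C_j in add(T),
   extended by zero modules. *)
Definition add_coresolution T :=
  exists (s : nat) (C : nat -> lmodType R) (eta : {linear R^o -> C 0})
         (d : forall i, {linear C i -> C i.+1}),
    [/\ injective eta, exact eta (d 0), forall i, exact (d i) (d i.+1),
        forall j, (j <= s)%N -> add_of T (C j)
      & forall j, (s < j)%N -> zero_module (C j)].

Definition tilting T :=
  [/\ fin_pdim T, forall i, ext_succ_eq0 T T i & add_coresolution T].

Definition strong_tilting T :=
  tilting T /\ forall M, fin_pdim M -> forall i, ext_succ_eq0 M T i.

End Modules.

Definition fin_pdim_contravariantly_finite (R : pzRingType) :=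
  forall M : lmodType R, finitely_generated M ->
    exists (X : lmodType R) (phi : {linear X -> M}), fin_pdim X /\
      forall (Y : lmodType R) (f : {linear Y -> M}), fin_pdim Y ->
        exists g : {linear Y -> X}, forall y, f y = phi (g y).

Section Rings.
Variable R : pzRingType.

Definition maximal_left_ideal (I : {pred R^o}) :=
  [/\ GRing.submod_closed I, 1 \notin I &
      forall K : {pred R^o}, GRing.submod_closed K -> 1 \notin K ->
        {subset I <= K} -> {subset K <= I}].

Definition jacobson (x : R) :=
  forall I : {pred R^o}, maximal_left_ideal I -> x \in I.

(* R/J(R) is a finite product of division rings D_i, i.e. there is a surjective
   ring morphism from R to the product of the D_i with kernel J(R). *)
Definition basic_ring :=
  exists (n : nat) (D : 'I_n -> unitRingType)
         (phi : forall i, {rmorphism R -> D i}),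
    [/\ forall i (x : D i), x != 0 -> x \is a GRing.unit,
        forall y : (forall i, D i), exists x, forall i, phi i x = y i
      & forall x, jacobson x <-> forall i, phi i x = 0].

Definition idempotent (x : R) := x * x = x.

Definition primitive_idempotent (x : R) :=
  [/\ idempotent x, x <> 0 &
      forall y z, idempotent y -> idempotent z -> y * z = 0 -> z * y = 0 ->
        x = y + z -> y = 0 \/ z = 0].

Definition complete_primitive_idempotents n (eps : 'I_n -> R) :=
  [/\ forall i, primitive_idempotent (eps i),
      forall i j, i != j -> eps i * eps j = 0 & \sum_i eps i = 1].

End Rings.

Definition artinian (k : comPzRingType) :=
  forall I : nat -> {pred k^o}, (forall n, GRing.submod_closed (I n)) ->
    (forall n, {subset I n.+1 <= I n}) ->
    exists N, forall n, (N <= n)%N -> I n =i I N.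

Definition artin_algebra (A : pzRingType) :=
  exists (k : comPzRingType) (phi : {rmorphism k -> A}),
    [/\ artinian k, forall c a, phi c * a = a * phi c
      & exists n (g : 'I_n -> A), forall a, exists c : 'I_n -> k,
          a = \sum_i phi (c i) * g i].

Definition basic_artin_algebra (A : pzRingType) :=
  artin_algebra A /\ basic_ring A.

(* B ~ End_A(T), where endomorphisms are multiplied by composition. *)
Definition ring_iso_End (B A : pzRingType) (T : lmodType A) :=
  exists f : B -> {linear T -> T},
    [/\ forall x y t, f (x + y) t = f x t + f y t,
        forall x y t, f (x * y) t = f x (f y t),
        forall t, f 1 t = t,
        forall x y, f x =1 f y -> x = y
      & forall g : {linear T -> T}, exists x, f x =1 g].

(* mod-B results from A-mod via strong tilting; B ~ End_A(T)^op is expressed as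
   B^c ~ End_A(T). *)
Definition right_from_left (A B : pzRingType) :=
  exists T : lmodType A,
    [/\ strong_tilting T, basic_module T & ring_iso_End B^c T].

(* B-mod results from mod-A via strong tilting. *)
Definition left_from_right (A B : pzRingType) :=
  exists T : lmodType A^c,
    [/\ strong_tilting T, basic_module T & ring_iso_End B T].

Definition unlimited_strong_tilting (A : pzRingType) :=
  exists A_ : nat -> pzRingType,
    [/\ A_ 0 = A, forall i, basic_artin_algebra (A_ i),
        forall i, ~~ odd i -> right_from_left (A_ i) (A_ i.+1)
      & forall i, odd i -> left_from_right (A_ i) (A_ i.+1)].

Section QuotientModule.
Variables (R : pzRingType) (V : lmodType R) (W : {pred V}).
Hypothesis W_closed : GRing.submod_closed W.

Definition submod_zmodClosed : zmodClosed V :=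
  HB.pack (W : V -> bool)
    (GRing.isZmodClosed.Build V W (GRing.submod_closedB W_closed)).

Definition quot_module := Quotient.quot submod_zmodClosed.
HB.instance Definition _ := GRing.Zmodule.on quot_module.
Local Notation pi := (\pi_(Quotient.quot submod_zmodClosed))%qT.

Definition quot_scale (a : R) (x : quot_module) : quot_module :=
  pi (a *: repr x).

Lemma quot_scale_pi a v : quot_scale a (pi v) = pi (a *: v).
Proof.
apply/eqP; rewrite /quot_scale -Quotient.idealrBE -scalerBr.
apply: (GRing.subsemimod_closedZ (GRing.submod_closed_semi W_closed)).
by have := reprK (pi v) => /eqP; rewrite -Quotient.idealrBE.
Qed.

Fact quot_scaleA a b x : quot_scale a (quot_scale b x) = quot_scale (a * b) x.
Proof. by rewrite -[x]reprK (quot_scale_pi b (repr x)) !quot_scale_pi scalerA. Qed.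

Fact quot_scale1 : left_id 1 quot_scale.
Proof. by move=> x; rewrite -[x]reprK quot_scale_pi scale1r. Qed.

Fact quot_scaleDr : right_distributive quot_scale +%R.
Proof.
move=> a x y; rewrite -[x]reprK -[y]reprK -(raddfD pi) !quot_scale_pi.
by rewrite scalerDr raddfD.
Qed.

Fact quot_scaleDl x : {morph quot_scale^~ x : a b / a + b}.
Proof. by move=> a b; rewrite -[x]reprK !quot_scale_pi scalerDl raddfD. Qed.

HB.instance Definition _ := GRing.Zmodule_isLmodule.Build R quot_module
  quot_scaleA quot_scale1 quot_scaleDr quot_scaleDl.

End QuotientModule.

Section PrincipalModule.
Variables (R : pzRingType) (e : R).

(* The left module R e, for an idempotent e. *)
Record principal := Principal {
  principal_val :> R^o;
  _ : principal_val * e == principal_val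
}.
HB.instance Definition _ := [isSub for principal_val].
HB.instance Definition _ := [Choice of principal by <:].

Fact principal_submod_closed :
  GRing.submod_closed [pred x : R^o | x * e == x].
Proof.
split=> [|a x y]; rewrite !inE ?mul0r // => /eqP hx /eqP hy.
by rewrite mulrDl hy -[a *: x]/(a * x) -mulrA hx.
Qed.
HB.instance Definition _ := GRing.SubChoice_isSubLmodule.Build R R^o _ principal
  (GRing.submod_closed_semi principal_submod_closed).

(* The submodule J(R) e of R e. *)
Definition principal_rad : {pred principal} :=
  fun x => `[< exists2 j, jacobson j & principal_val x = j * e >].

Fact principal_rad_closed : GRing.submod_closed principal_rad.
Proof.
split=> [|a x y /asboolP[j hj xE] /asboolP[j' hj' yE]]; apply/asboolP.
  by exists 0; [move=> I [[]] | rewrite mul0r].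
exists (a * j + j').
  by move=> I mI; have [[_ cI] _ _] := mI; apply: cI; [apply: hj|apply: hj'].
by rewrite mulrDl -mulrA -xE -yE.
Qed.

(* R e / J(R) e *)
Definition top_module : lmodType R := quot_module principal_rad_closed.

End PrincipalModule.

Record idempotent_elt (R : pzRingType) :=
  Idempotent { idem_val : R; idemP : idempotent idem_val }.

Section Corner.
Variables (R : pzRingType) (e : idempotent_elt R).
Local Notation e0 := (idem_val e).

(* The ring e R e, whose unit is e. *)
Record corner :=
  Corner { corner_val : R; _ : e0 * corner_val * e0 == corner_val }.
HB.instance Definition _ := [isSub for corner_val].
HB.instance Definition _ := [Choice of corner by <:].

Fact corner_zmod_closed : zmod_closed [pred x : R | e0 * x * e0 == x].
Proof.
split=> [|x y]; rewrite !inE ?mulr0 ?mul0r // => /eqP hx /eqP hy.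
by rewrite mulrBr mulrBl hx hy.
Qed.
HB.instance Definition _ := GRing.SubChoice_isSubZmodule.Build R _ corner
  corner_zmod_closed.

Fact corner_one_subproof : e0 * e0 * e0 == e0.
Proof. by rewrite !(idemP e). Qed.
Definition corner_one := Corner corner_one_subproof.

Fact corner_mull (x : corner) : e0 * corner_val x = corner_val x.
Proof. by case: x => x /= /eqP <-; rewrite !mulrA (idemP e). Qed.
Fact corner_mulr (x : corner) : corner_val x * e0 = corner_val x.
Proof. by case: x => x /= /eqP <-; rewrite -!mulrA (idemP e). Qed.

Fact corner_mul_subproof (x y : corner) :
  e0 * (corner_val x * corner_val y) * e0 == corner_val x * corner_val y.
Proof. by rewrite mulrA corner_mull -mulrA corner_mulr. Qed.
Definition corner_mul x y := Corner (corner_mul_subproof x y).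

Fact corner_mulA : associative corner_mul.
Proof. by move=> x y z; apply: val_inj; rewrite /= mulrA. Qed.
Fact corner_mul1l : left_id corner_one corner_mul.
Proof. by move=> x; apply: val_inj; rewrite /= corner_mull. Qed.
Fact corner_mul1r : right_id corner_one corner_mul.
Proof. by move=> x; apply: val_inj; rewrite /= corner_mulr. Qed.
Fact corner_mulDl : left_distributive corner_mul +%R.
Proof. by move=> x y z; apply: val_inj; rewrite /= mulrDl. Qed.
Fact corner_mulDr : right_distributive corner_mul +%R.
Proof. by move=> x y z; apply: val_inj; rewrite /= mulrDr. Qed.

HB.instance Definition _ := GRing.Zmodule_isPzRing.Build corner
  corner_mulA corner_mul1l corner_mul1r corner_mulDl corner_mulDr.

End Corner.

(* Main.v *)
(* Put S = e Lambda e.  The functor X |-> e X from Lambda-modules to S-modules has the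
   right adjoint G = Hom_S(e Lambda, -), and e (G M) = M.  The hypothesis on the simple
   modules makes e Lambda projective over S and bounds by 1 the projective dimension of
   the finitely generated Lambda-modules killed by e.  As soon as e Lambda and the
   modules killed by e have bounded projective dimension (the corner is then called
   good), a finitely generated X has finite projective dimension if and only if e X
   does.  Hence e and G carry approximations to approximations, which gives the claim
   on contravariant finiteness.

   A strong tilting module is the same as an injective cogenerator of P^{<oo} (relative
   to exact sequences with cokernel in P^{<oo}) when projective dimensions are bounded;
   by the Auslander-Reiten argument it exists if and only if P^{<oo} is contravariantly
   finite with bounded projective dimensions.  So it exists for Lambda if and only if it
   exists for S, and then the basic ones T and T' may be chosen with G T' a direct
   summand of T.  This makes End(T') a corner of End(T), and the main point is that this
   corner is good again: Hom(-, T) turns add(T)-coresolutions into projective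
   resolutions, and an End(T)-module killed by the idempotent is Hom(X, T) for some X
   killed by e.  Thus the comparison can be iterated on alternating sides. *)

Require Import Defs.
From HB Require Import structures.
From mathcomp Require Import all_boot all_algebra.
From mathcomp Require Import boolp.
From mathcomp Require classical_sets.

Set Implicit Arguments.
Unset Strict Implicit.
Unset Printing Implicit Defensive.

Import GRing.Theory.
Local Open Scope ring_scope.

(** * Linear maps and short exact sequences *)

Section LinearMaps.
Variable R : pzRingType.
Implicit Types A B C L M N P Q V X Y Z : lmodType R.

(** Two features of the iteration shape the definitions. At later stages the new corner is only
    known to have finite projective dimension of e A over e A e, and some bound for the modules
    killed by e; this is why goodness is stated with an arbitrary bound c, which starts at 1.
    Moreover the sides alternate and the new rings arise as endomorphism rings, so a corner is an
    embedding of one ring in another, not a literal subset, and basicness is restated in a form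
    symmetric under passing to the converse ring.

    The two directions differ: given a strong tilting T over Lambda, the module over the corner must
    be found inside this very T; given T' over the corner, T is built around G T'.

    Ext groups are never formed. Only the extension property Ext^1 = 0 occurs, since P^{<oo} is
    closed under syzygies up to projective summands and the higher vanishing follows by dimension
    shifting. Minimality arguments count strict steps in chains of k-submodules, k being the base
    ring, so that modules over A and over e A e can be compared. *)

Definition lin_of M N (f : M -> N) (lf : linear f) : {linear M -> N} :=
  HB.pack f (GRing.isLinear.Build R M N _ f lf).

Definition lcomp L M N (g : {linear M -> N}) (f : {linear L -> M}) :
  {linear L -> N} := g \o f.
Lemma lcompE L M N (g : {linear M -> N}) (f : {linear L -> M}) x : lcomp g f x = g (f x).
Proof. by []. Qed.
Definition lid M : {linear M -> M} := idfun.
Definition lzero M N : {linear M -> N} := \0%R.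
Definition ladd M N (f g : {linear M -> N}) : {linear M -> N} := f \+ g.
Definition lsub M N (f g : {linear M -> N}) : {linear M -> N} := f \- g.
Definition lfst M N : {linear (M * N)%type -> M} := fst.
Definition lsnd M N : {linear (M * N)%type -> N} := snd.

Fact linl_linear M N : linear (fun x : M => (x, 0) : (M * N)%type).
Proof. by move=> a x y; congr pair; rewrite /= scaler0 addr0. Qed.
Definition linl M N := lin_of (@linl_linear M N).
Fact linr_linear M N : linear (fun x : N => (0, x) : (M * N)%type).
Proof. by move=> a x y; congr pair; rewrite /= scaler0 addr0. Qed.
Definition linr M N := lin_of (@linr_linear M N).

Fact lpair_linear M N X (f : {linear X -> M}) (g : {linear X -> N}) :
  linear (fun x => (f x, g x) : (M * N)%type).
Proof. by move=> a x y; rewrite !linearP. Qed.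
Definition lpair M N X f g := lin_of (@lpair_linear M N X f g).

Definition lcopair M N X (f : {linear M -> X}) (g : {linear N -> X}) :=
  ladd (lcomp f (lfst M N)) (lcomp g (lsnd M N)).

Lemma lcopairE M N X (f : {linear M -> X}) (g : {linear N -> X}) x y :
  lcopair f g (x, y) = f x + g y.
Proof. by []. Qed.

Fact lsum_linear M N (I : finType) (f : I -> {linear M -> N}) :
  linear (fun x => \sum_i f i x).
Proof.
move=> a x y; rewrite scaler_sumr -big_split /=.
by apply: eq_bigr => i _; rewrite linearP.
Qed.
Definition lsum M N I f := lin_of (@lsum_linear M N I f).

Fact lcol_linear M N (I : finType) (f : I -> {linear M -> N}) :
  linear (fun x => [ffun i => f i x]).
Proof. by move=> a x y; apply/ffunP=> i; rewrite !ffunE linearP. Qed.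
Definition lcol M N I f := lin_of (@lcol_linear M N I f).

Fact lproj_linear M (I : finType) (i : I) : linear (fun x : {ffun I -> M} => x i).
Proof. by move=> a x y; rewrite !ffunE. Qed.
Definition lproj M I i := lin_of (@lproj_linear M I i).

Fact lrow_linear M (I : finType) (v : I -> M) :
  linear (fun c : {ffun I -> R^o} => \sum_i (c i : R) *: v i).
Proof.
move=> a x y; rewrite scaler_sumr -big_split /=.
by apply: eq_bigr => i _; rewrite !ffunE scalerDl scalerA.
Qed.
Definition lrow M I v := lin_of (@lrow_linear M I v).

Fact lmulr_linear M (v : M) : linear (fun c : R^o => (c : R) *: v).
Proof. by move=> a x y; rewrite scalerDl scalerA. Qed.
Definition lmulr M v := lin_of (@lmulr_linear M v).

Definition submod M (W : M -> Prop) :=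
  W 0 /\ forall a x y, W x -> W y -> W (a *: x + y).

Section Submod.
Variables (M : lmodType R) (W : M -> Prop) (hW : submod W).

Lemma submod0 : W 0. Proof. by case: hW. Qed.
Lemma submodP a x y : W x -> W y -> W (a *: x + y).
Proof. by case: hW => _; apply. Qed.
Lemma submodZ a x : W x -> W (a *: x).
Proof. by move=> Wx; rewrite -[_ *: _]addr0; apply: submodP => //; apply: submod0. Qed.
Lemma submodD x y : W x -> W y -> W (x + y).
Proof. by move=> Wx Wy; rewrite -[x]scale1r; apply: submodP. Qed.
Lemma submodN x : W x -> W (- x).
Proof. by move=> Wx; rewrite -scaleN1r; apply: submodZ. Qed.
Lemma submodB x y : W x -> W y -> W (x - y).
Proof. by move=> Wx Wy; apply/submodD/submodN. Qed.

Lemma submod_closed_pred : GRing.submod_closed (fun x => `[< W x >]).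
Proof.
split=> [|a x y /asboolP Wx /asboolP Wy]; apply/asboolP; first exact: submod0.
exact: submodP.
Qed.
End Submod.

Lemma submod_of_closed M (W : {pred M}) :
  GRing.submod_closed W -> submod (fun x => x \in W).
Proof. by case=> W0 WP; split=> // a x y; apply: WP. Qed.

(** Membership is a proposition, so that submodules can be given by existential formulas; the
    Boolean reflection inside the record makes the subtype machinery apply. *)
Record subm (M : lmodType R) (W : M -> Prop) (hW : submod W) :=
  Subm { subm_val : M; _ : `[< W subm_val >] }.
Section SubmInst.
Variables (M : lmodType R) (W : M -> Prop) (hW : submod W).
HB.instance Definition _ := [isSub for @subm_val M W hW].
HB.instance Definition _ := [Choice of subm hW by <:].
HB.instance Definition _ := GRing.SubChoice_isSubLmodule.Build R M _ (subm hW)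
  (GRing.submod_closed_semi (submod_closed_pred hW)).
End SubmInst.

Lemma sub_exists M (W : M -> Prop) : submod W ->
  exists (L : lmodType R) (i : {linear L -> M}),
    injective i /\ forall x, W x <-> exists y, i y = x.
Proof.
move=> hW; exists (subm hW), (\val : {linear subm hW -> M}).
split; first exact: val_inj.
move=> x; split=> [Wx|].
  by exists (@Subm _ _ hW x (asboolT Wx)).
by case=> y <-; apply/asboolP; exact: (valP y).
Qed.

Lemma quot_module_proj M (W : {pred M}) (hW : GRing.submod_closed W) :
  exists p : {linear M -> quot_module hW}, surjective p /\ forall x, p x = 0 <-> x \in W.
Proof.
pose Wz := submod_zmodClosed hW.
have pl : linear (fun x : M => (\pi_(Quotient.quot Wz) x)%qT : quot_module hW).
  move=> a x y; rewrite raddfD; apply: (congr1 (fun z => z + _)).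
  exact/esym/quot_scale_pi.
exists (lin_of pl); split=> [y|x]; first by exists (repr y); apply: reprK.
have -> : (lin_of pl x = 0) <-> (x - 0 \in Wz).
  rewrite Quotient.idealrBE; split=> [h|/eqP h].
    by apply/eqP; rewrite raddf0 -[LHS]/(lin_of pl x) h.
  by rewrite /= h raddf0.
by rewrite subr0.
Qed.

Lemma quot_exists M (W : M -> Prop) : submod W ->
  exists (N : lmodType R) (p : {linear M -> N}),
    surjective p /\ forall x, p x = 0 <-> W x.
Proof.
move=> hW; have [p [pS pE]] := quot_module_proj (submod_closed_pred hW).
exists (quot_module (submod_closed_pred hW)), p; split=> // x.
by split=> [/pE/asboolP|h] //; apply/pE/asboolP.
Qed.

Definition ses L M N (i : {linear L -> M}) (p : {linear M -> N}) :=
  [/\ injective i, surjective p & exact i p].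

Lemma lker0_inj M N (f : {linear M -> N}) : (forall x, f x = 0 -> x = 0) -> injective f.
Proof.
by move=> h x y fxy; apply/eqP; rewrite -subr_eq0; apply/eqP/h; rewrite linearB fxy subrr.
Qed.

Lemma linj0 M N (f : {linear M -> N}) x : injective f -> f x = 0 -> x = 0.
Proof. by move=> fI fx; apply: fI; rewrite fx linear0. Qed.

Lemma ker_submod M N (f : {linear M -> N}) : submod (fun x => f x = 0).
Proof.
split=> [|a x y fx fy]; first exact: linear0.
by rewrite linearP fx fy scaler0 addr0.
Qed.

Lemma im_submod M N (f : {linear M -> N}) : submod (fun y => exists x, f x = y).
Proof.
split=> [|a x y [u <-] [v <-]]; first by exists 0; exact: linear0.
by exists (a *: u + v); rewrite linearP.
Qed.

Lemma preim_submod M N (f : {linear M -> N}) W : submod W -> submod (fun x => W (f x)).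
Proof.
move=> hW; split=> [|a x y fx fy]; first by rewrite linear0; apply: submod0.
by rewrite linearP; apply: submodP.
Qed.

Lemma ker_exists M N (f : {linear M -> N}) :
  exists L (i : {linear L -> M}), injective i /\ exact i f.
Proof. exact: sub_exists (ker_submod f). Qed.

Lemma ker_ses M N (f : {linear M -> N}) : surjective f ->
  exists L (i : {linear L -> M}), ses i f.
Proof. by move=> fS; have [L [i [iI ex]]] := ker_exists f; exists L, i. Qed.

Lemma coker_exists M N (f : {linear M -> N}) :
  exists Q (p : {linear N -> Q}), surjective p /\ exact f p.
Proof. exact: quot_exists (im_submod f). Qed.

Lemma coker_ses M N (f : {linear M -> N}) : injective f ->
  exists Q (p : {linear N -> Q}), ses f p.
Proof. by move=> fI; have [Q [p [pS ex]]] := coker_exists f; exists Q, p. Qed.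

Lemma exact_comp0 L M N (i : {linear L -> M}) (p : {linear M -> N}) x :
  exact i p -> p (i x) = 0.
Proof. by move=> ex; apply/ex; exists x. Qed.

Lemma factor_inj L M Q (i : {linear L -> M}) (f : {linear Q -> M}) :
  injective i -> (forall q, exists x, i x = f q) ->
  exists g : {linear Q -> L}, forall q, i (g q) = f q.
Proof.
move=> iI hf; pose g q := sval (cid (hf q)).
have gE q : i (g q) = f q by rewrite /g; case: cid.
have gl : linear g by move=> a x y; apply: iI; rewrite linearP !gE linearP.
by exists (lin_of gl).
Qed.

Lemma factor_surj M N Q (p : {linear M -> N}) (f : {linear M -> Q}) :
  surjective p -> (forall x, p x = 0 -> f x = 0) ->
  exists g : {linear N -> Q}, forall x, g (p x) = f x.
Proof.
move=> pS hf; pose s y := sval (cid (pS y)).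
have sE y : p (s y) = y by rewrite /s; case: cid.
have fE x y : p x = p y -> f x = f y.
  by move=> pxy; apply/eqP; rewrite -subr_eq0 -linearB; apply/eqP/hf; rewrite linearB pxy subrr.
have gl : linear (fun y => f (s y)).
  by move=> a x y; rewrite -linearP; apply: fE; rewrite linearP !sE.
by exists (lin_of gl) => x; apply: fE; rewrite sE.
Qed.

Lemma im_factor M N (f : {linear M -> N}) :
  exists (I : lmodType R) (q : {linear M -> I}) (j : {linear I -> N}),
    [/\ surjective q, injective j & forall x, j (q x) = f x].
Proof.
have [I [j [jI jE]]] := sub_exists (im_submod f).
have [q qE] : exists q : {linear M -> I}, forall x, j (q x) = f x.
  by apply: factor_inj => // x; apply/jE; exists x.
exists I, q, j; split=> // y.
have /jE[x fx] : exists z, j z = j y by exists y.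
by exists x; apply: jI; rewrite qE.
Qed.

Lemma bij_inv M N (f : {linear M -> N}) : injective f -> surjective f ->
  exists g : {linear N -> M}, cancel f g /\ cancel g f.
Proof.
move=> fI fS.
have [g gE] : exists g : {linear N -> M}, forall y, f (g y) = lid N y.
  by apply: factor_inj => // y; have [x] := fS y; exists x.
by exists g; split=> // x; apply: fI; rewrite gE.
Qed.

Lemma iso_summand M N (f : {linear M -> N}) : injective f -> surjective f ->
  direct_summand M N /\ direct_summand N M.
Proof.
move=> fI fS; have [g [fK gK]] := bij_inv fI fS.
by split; [exists f, g|exists g, f].
Qed.

Lemma summand_refl M : direct_summand M M.
Proof. by exists (lid M), (lid M). Qed.

Lemma summand_trans L M N : direct_summand L M -> direct_summand M N -> direct_summand L N.
Proof.
move=> [s [p sK]] [s' [p' sK']]; exists (lcomp s' s), (lcomp p p') => x /=.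
by rewrite sK' sK.
Qed.

Lemma summandl M N : direct_summand M (M * N)%type.
Proof. by exists (linl M N), (lfst M N). Qed.

Lemma summandr M N : direct_summand N (M * N)%type.
Proof. by exists (linr M N), (lsnd M N). Qed.

Lemma idem_split X (p : {linear X -> X}) : (forall x, p (p x) = p x) ->
  exists Y (s : {linear Y -> X}) (r : {linear X -> Y}),
    cancel s r /\ forall x, s (r x) = p x.
Proof.
move=> pp; have [Y [r [s [rS sI E]]]] := im_factor p.
exists Y, s, r; split=> // y; apply: sI; rewrite E.
by have [x <-] := rS y; rewrite E pp.
Qed.

Lemma summand_compl X M (s : {linear X -> M}) (p : {linear M -> X}) : cancel s p ->
  exists Y (s' : {linear Y -> M}) (p' : {linear M -> Y}),
   [/\ cancel s' p', forall x, p' (s x) = 0, forall y, p (s' y) = 0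
     & forall m, s (p m) + s' (p' m) = m].
Proof.
move=> sK.
have [|Y [s' [p' [s'K E]]]] := @idem_split M (lsub (lid M) (lcomp s p)).
  by move=> x /=; rewrite linearB /= sK subrr linear0 subr0.
exists Y, s', p'; split=> //.
- by move=> x; apply: (can_inj s'K); rewrite E linear0 /= sK subrr.
- by move=> y; have := E (s' y); rewrite s'K /= => {1}->; rewrite linearB sK subrr.
by move=> m; rewrite E /= addrC subrK.
Qed.

Lemma ses_split L M N (i : {linear L -> M}) (p : {linear M -> N}) (s : {linear N -> M}) :
  ses i p -> cancel s p ->
  exists r : {linear M -> L},
    [/\ cancel i r, forall n, r (s n) = 0 & forall m, m = i (r m) + s (p m)].
Proof.
move=> [iI pS ex] sK.
have [r rE] : exists r : {linear M -> L}, forall m, i (r m) = lsub (lid M) (lcomp s p) m.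
  by apply: factor_inj => // m; apply/ex; rewrite /= linearB /= sK subrr.
exists r; split=> [x|n|m].
- by apply: iI; rewrite rE /= (exact_comp0 _ ex) linear0 subr0.
- by apply: iI; rewrite rE linear0 /= sK subrr.
by rewrite rE /= subrK.
Qed.

Lemma ses_split_retr L M N (i : {linear L -> M}) (p : {linear M -> N}) (r : {linear M -> L}) :
  ses i p -> cancel i r ->
  exists s : {linear N -> M}, cancel s p /\ forall m, m = i (r m) + s (p m).
Proof.
move=> [iI pS ex] rK.
have [s sE] : exists s : {linear N -> M}, forall m, s (p m) = lsub (lid M) (lcomp i r) m.
  by apply: factor_surj => // m /ex[x <-] /=; rewrite rK subrr.
exists s; split=> [n|m]; last by rewrite sE /= addrC subrK.
by have [m <-] := pS n; rewrite sE /= linearB /= (exact_comp0 _ ex) subr0.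
Qed.

(** [Q] is the cokernel of [A -> Y * B], [a |-> (h a, - i a)]. The two middle clauses describe the
    elements of [Q] and their relations, in the form needed for element chases. *)
Lemma pushout A B Y (i : {linear A -> B}) (h : {linear A -> Y}) :
  exists Q (j : {linear Y -> Q}) (k : {linear B -> Q}),
   [/\ forall a, k (i a) = j (h a),
       forall q, exists y b, q = j y + k b,
       forall y b, j y + k b = 0 -> exists a, b = i a /\ y = - h a
     & forall Z (v : {linear Y -> Z}) (w : {linear B -> Z}),
         (forall a, v (h a) = w (i a)) ->
         exists u : {linear Q -> Z}, (forall y, u (j y) = v y) /\ (forall b, u (k b) = w b)].
Proof.
pose d : {linear A -> (Y * B)%type} := lpair h (lsub (lzero A B) i).
have [Q [p [pS ex]]] := coker_exists d.
exists Q, (lcomp p (linl Y B)), (lcomp p (linr Y B)); split=> [a|q|y b|Z v w vw].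
- apply/eqP; rewrite eq_sym -subr_eq0 /= -linearB /=; apply/eqP/ex.
  by exists a; rewrite /=; congr pair => /=; rewrite ?subr0.
- have [[y b] <-] := pS q; exists y, b; rewrite /= -linearD /=.
  by congr (p _); congr pair; rewrite /= ?addr0 ?add0r.
- rewrite /= -linearD /= => /ex[a E].
  exists (- a); move: E => [/= E1 E2]; rewrite !linearN opprK; split.
    by move: E2; rewrite sub0r add0r.
  by rewrite E1 addr0.
have [u uE] : exists u : {linear Q -> Z}, forall x, u (p x) = lcopair v w x.
  by apply: factor_surj => // x /ex[a <-]; rewrite /= sub0r linearN /= vw subrr.
by exists u; split=> x; rewrite uE /= linear0 ?addr0 ?add0r.
Qed.

Lemma pushout_ses A B C Y (i : {linear A -> B}) (p : {linear B -> C}) (h : {linear A -> Y}) :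
  ses i p ->
  exists Q (j : {linear Y -> Q}) (q : {linear Q -> C}) (k : {linear B -> Q}),
   [/\ ses j q, forall a, k (i a) = j (h a), forall b, q (k b) = p b
     & forall Z (v : {linear Y -> Z}) (w : {linear B -> Z}),
         (forall a, v (h a) = w (i a)) ->
         exists u : {linear Q -> Z}, (forall y, u (j y) = v y) /\ (forall b, u (k b) = w b)].
Proof.
move=> [iI pS ex]; have [Q [j [k [E1 E2 E3 U]]]] := pushout i h.
have [|q [qj qk]] := U C (lzero Y C) p; first by move=> a; rewrite (exact_comp0 _ ex).
exists Q, j, q, k; split=> //; split.
- apply: lker0_inj => y jy; have [|a [/esym ia ->]] := E3 y 0; first by rewrite jy linear0 addr0.
  by rewrite (linj0 iI ia) linear0 oppr0.
- by move=> c; have [b <-] := pS c; exists (k b).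
move=> z; split=> [qz|[y <-]]; last by rewrite qj.
have [y [b zE]] := E2 z; move: qz; rewrite zE linearD qj qk add0r => /ex[a <-].
by exists (y + h a); rewrite linearD E1.
Qed.

Lemma pushout_inj A B Y (i : {linear A -> B}) (h : {linear A -> Y}) :
  injective h -> forall Q (j : {linear Y -> Q}) (k : {linear B -> Q}),
  (forall y b, j y + k b = 0 -> exists a, b = i a /\ y = - h a) -> injective k.
Proof.
move=> hI Q j k E3; apply: lker0_inj => b kb.
have [|a [-> /esym /eqP]] := E3 0 b; first by rewrite linear0 add0r.
by rewrite oppr_eq0 => /eqP /(linj0 hI) ->; rewrite linear0.
Qed.

Lemma pullback B C Z (p : {linear B -> C}) (g : {linear Z -> C}) :
  exists Q (q : {linear Q -> Z}) (k : {linear Q -> B}),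
   [/\ forall x, p (k x) = g (q x),
       forall z b, p b = g z -> exists x, q x = z /\ k x = b,
       forall x, q x = 0 -> k x = 0 -> x = 0
     & forall V (v : {linear V -> Z}) (w : {linear V -> B}),
         (forall a, g (v a) = p (w a)) ->
         exists u : {linear V -> Q}, (forall a, q (u a) = v a) /\ (forall a, k (u a) = w a)].
Proof.
pose d : {linear (Z * B)%type -> C} := lsub (lcomp g (lfst _ _)) (lcomp p (lsnd _ _)).
have [Q [i [iI ex]]] := ker_exists d.
exists Q, (lcomp (lfst _ _) i), (lcomp (lsnd _ _) i); split=> [x|z b pb|x /= x1 x2|V v w vw].
- by apply/esym/eqP; rewrite -subr_eq0; apply/eqP/ex; exists x.
- by have /ex[x xE] : d (z, b) = 0; [rewrite /= pb subrr | exists x; rewrite /= xE].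
- by apply: (linj0 iI); case: (i x) x1 x2 => /= ? ? -> ->.
have [u uE] : exists u : {linear V -> Q}, forall x, i (u x) = lpair v w x.
  by apply: factor_inj => // x; apply/ex; rewrite /= vw subrr.
by exists u; split=> x; rewrite /= uE.
Qed.

End LinearMaps.

(** * Projective dimension *)

Section Homological.
Variable R : pzRingType.
Implicit Types A B C K KA KB KC L M N P Q V X Y Z : lmodType R.

Definition free n : lmodType R := {ffun 'I_n -> R^o}.

Lemma proj_lift P X M (p : {linear M -> X}) (g : {linear P -> X}) :
  projective P -> surjective p -> exists h : {linear P -> M}, forall x, p (h x) = g x.
Proof. by move=> hP pS; apply: hP. Qed.

Lemma proj_free n : projective (free n).
Proof.
move=> M N f g fS; pose e i : free n := [ffun j => (i == j)%:R].
have /choice[v vE] : forall i : 'I_n, exists x, f x = g (e i) by move=> i; apply: fS.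
exists (lrow v) => x; rewrite /= linear_sum.
rewrite [in RHS](_ : x = \sum_i (x i : R) *: e i).
  by rewrite linear_sum; apply: eq_bigr => i _; rewrite !linearZ vE.
apply/ffunP=> j; rewrite sum_ffunE (bigD1 j) //= big1 => [|i /negPf ij].
  by rewrite !ffunE eqxx addr0 /GRing.scale /= mulr1.
by rewrite !ffunE ij /GRing.scale /= mulr0.
Qed.

Lemma proj_summand P Q : projective P -> direct_summand Q P -> projective Q.
Proof.
move=> hP [s [p sK]] M N f g fS.
by have [h hE] := hP _ _ f (lcomp g p) fS; exists (lcomp h s) => x; rewrite /= hE /= sK.
Qed.

Lemma proj_prod P Q : projective P -> projective Q -> projective (P * Q)%type.
Proof.
move=> hP hQ M N f g fS.
have [h hE] := hP _ _ f (lcomp g (linl P Q)) fS.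
have [k kE] := hQ _ _ f (lcomp g (linr P Q)) fS.
exists (lcopair h k) => -[x y]; rewrite /= linearD hE kE /= -linearD /=.
by congr (g _); congr pair; rewrite /= ?addr0 ?add0r.
Qed.

Lemma fg_surj M N (f : {linear M -> N}) :
  surjective f -> finitely_generated M -> finitely_generated N.
Proof.
move=> fS [n [g gE]]; exists n, (fun i => f (g i)) => y.
have [x <-] := fS y; have [c ->] := gE x; exists c.
by rewrite linear_sum; apply: eq_bigr => i _; rewrite linearZ.
Qed.

Lemma fg_summand X M : direct_summand X M -> finitely_generated M -> finitely_generated X.
Proof. by move=> [s [p sK]]; apply: (@fg_surj _ _ p) => x; exists (s x). Qed.

Lemma fg_ext L M N (i : {linear L -> M}) (p : {linear M -> N}) : surjective p -> exact i p ->
  finitely_generated L -> finitely_generated N -> finitely_generated M.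
Proof.
move=> pS ex [n [g gE]] [m [h hE]].
have /choice[k kE] : forall j : 'I_m, exists x, p x = h j by move=> j; apply: pS.
exists (n + m)%N, (fun j => match split j with inl a => i (g a) | inr b => k b end) => x.
have [d dE] := hE (p x).
have /ex[y yE] : p (x - \sum_j d j *: k j) = 0.
  rewrite linearB dE linear_sum; apply/eqP; rewrite subr_eq0; apply/eqP.
  by apply: eq_bigr => j _; rewrite linearZ /= kE.
have [c cE] := gE y.
exists (fun j => match split j with inl a => c a | inr b => d b end).
rewrite big_split_ord /= -[LHS](subrK (\sum_j d j *: k j)) -yE cE linear_sum.
congr (_ + _); apply: eq_bigr => j _.
  by rewrite linearZ; case: split_ordP => [a /lshift_inj ->//|b /eqP]; rewrite eq_lrshift.
by case: split_ordP => [a /eqP|b /rshift_inj ->//]; rewrite eq_rlshift.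
Qed.

Lemma fg_prod M N : finitely_generated M -> finitely_generated N ->
  finitely_generated (M * N)%type.
Proof.
apply: (@fg_ext _ _ _ (linl M N) (lsnd M N)) => [y|[x y]]; first by exists (0, y).
by rewrite /= ; split=> [->|[z [_ ->]]] //; exists x.
Qed.

Lemma fg_free n : finitely_generated (free n).
Proof.
exists n, (fun i => [ffun j => (i == j)%:R]) => x; exists (fun i => x i).
apply/ffunP=> j; rewrite sum_ffunE (bigD1 j) //= big1 => [|i /negPf ij].
  by rewrite !ffunE eqxx addr0 /GRing.scale /= mulr1.
by rewrite !ffunE ij /GRing.scale /= mulr0.
Qed.

Lemma fg_cover M : finitely_generated M -> exists n (p : {linear free n -> M}), surjective p.
Proof.
move=> [n [v h]]; exists n, (lrow v) => x; have [c ->] := h x; exists [ffun i => c i].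
by apply: eq_bigr => i _; rewrite ffunE.
Qed.

Lemma fg_regular : finitely_generated R^o.
Proof. by exists 1%N, (fun=> 1) => x; exists (fun=> x); rewrite big_ord1 [RHS]mulr1. Qed.

Lemma ffun_closed (F : lmodType R -> Prop) :
  (forall X Y, F X -> F Y -> F (X * Y)%type) ->
  (forall X Y, direct_summand X Y -> F Y -> F X) ->
  forall X, F X -> forall n, F {ffun 'I_n -> X}.
Proof.
move=> FP FS X FX; elim=> [|n IH].
  apply: FS FX; exists (lzero _ _), (lzero _ _) => x; apply/ffunP; case=> //.
apply: FS (FP _ _ FX IH).
exists (lpair (@lproj _ X _ ord0) (lcol (fun i : 'I_n => @lproj _ X _ (lift ord0 i)))).
pose q (i : 'I_n.+1) : {linear (X * {ffun 'I_n -> X})%type -> X} :=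
  match unlift ord0 i with
  | None => lfst _ _
  | Some j => lcomp (lproj _ j) (lsnd _ _)
  end.
exists (lcol q) => x; apply/ffunP => i; rewrite ffunE /q.
by case: unliftP => [j|] -> //=; rewrite ffunE.
Qed.

(* Ext^1(X, Y) = 0. *)
Definition ext1_eq0 X Y := forall A B (i : {linear A -> B}) (p : {linear B -> X}),
  ses i p -> forall f : {linear A -> Y}, exists g : {linear B -> Y}, forall a, g (i a) = f a.

(** Any extension [B] of [X] by [A] receives a lift of [p] and is therefore a quotient of [A * P]; a
    map on [A] extends to [B] as soon as its composite with [K -> A] extends to [P]. So vanishing
    may be tested on one projective presentation. *)
Lemma ext1_crit K P X Y (i : {linear K -> P}) (p : {linear P -> X}) :
  projective P -> ses i p ->
  (forall f : {linear K -> Y}, exists g : {linear P -> Y}, forall a, g (i a) = f a) ->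
  ext1_eq0 X Y.
Proof.
move=> hP [iI pS ex] H A B j q [jI qS ex'] f.
have [t tE] := proj_lift p hP qS.
have [t' t'E] : exists t' : {linear K -> A}, forall k, j (t' k) = lcomp t i k.
  by apply: factor_inj => // k; apply/ex'; rewrite /= tE (exact_comp0 _ ex).
have [g gE] := H (lcomp f t').
have [||h hE] := @factor_surj _ _ _ _ (lcopair j t) (lcopair f g).
- move=> b; have [u uE] := pS (q b).
  have /ex'[a aE] : q (b - t u) = 0 by rewrite linearB tE uE subrr.
  by exists (a, u); rewrite lcopairE aE subrK.
- case=> a u; rewrite !lcopairE => E.
  have /ex[k kE] : p u = 0.
    by rewrite -tE; have := congr1 q E; rewrite linearD (exact_comp0 _ ex') add0r linear0.
  rewrite -kE gE /= -linearD (_ : a + t' k = 0) ?linear0 //.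
  by apply: (linj0 jI); rewrite linearD t'E /= kE.
exists h => a; have := hE (a, 0); rewrite !lcopairE !linear0 !addr0; exact.
Qed.

Lemma proj_ext1 P Y : projective P -> ext1_eq0 P Y.
Proof.
move=> hP A B i p hs f; have [s sK] := proj_lift (lid P) hP (let: And3 _ h _ := hs in h).
have [r [rK _ _]] := ses_split hs sK.
by exists (lcomp f r) => a; rewrite /= rK.
Qed.

Lemma ext1_split X Y B (i : {linear Y -> B}) (p : {linear B -> X}) :
  ext1_eq0 X Y -> ses i p -> exists r : {linear B -> Y}, cancel i r.
Proof. by move=> h hs; have [r rE] := h _ _ _ _ hs (lid Y); exists r. Qed.

(** Pulling the extension [B] of [X'] back along the retraction [r] gives an extension of [X], over
    which [f] extends; the section [s] lets [B] map back into the pullback compatibly with [A]. *)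
Lemma ext1_summandl X X' Y : direct_summand X' X -> ext1_eq0 X Y -> ext1_eq0 X' Y.
Proof.
move=> [s [r sK]] h A B i p [iI pS ex] f.
have [Q [q [k [Q1 Q2 Q3 _]]]] := pullback p r.
have [K0 [j [jI jE]]] := ker_exists q.
have [kA kE] : exists kA : {linear A -> Q}, forall a, q (kA a) = 0 /\ k (kA a) = i a.
  have [u [u1 u2]] : exists u : {linear A -> Q},
     (forall a, q (u a) = lzero A X a) /\ (forall a, k (u a) = i a).
    have [_ [_ [_ [_ _ _ _]]]] := pullback p r.
    have [g gE] : exists g : {linear A -> Q}, forall a, lpair q k (g a) = lpair (lzero A X) i a.
      apply: factor_inj.
        by apply: lker0_inj => x [/= x1 x2]; apply: Q3.
      move=> a; have [|x [x1 x2]] := Q2 0 (i a); first by rewrite linear0 (exact_comp0 _ ex).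
      by exists x; rewrite /= x1 x2.
    by exists g; split=> a; have [] := gE a.
  by exists u => a; rewrite u1 u2.
have hs : ses kA q.
  split=> [a b E|x|x].
  - by apply: iI; rewrite -(proj2 (kE a)) E (proj2 (kE b)).
  - by have [b bE] := pS (r x); have [z [<- _]] := Q2 _ _ bE; exists z.
  split=> [qx|[a <-]]; last by case: (kE a).
  have /ex[a aE] : p (k x) = 0 by rewrite Q1 qx linear0.
  exists a; apply/eqP; rewrite -subr_eq0; apply/eqP/Q3.
    by rewrite linearB qx (proj1 (kE a)) subrr.
  by rewrite linearB (proj2 (kE a)) aE subrr.
have [g gE] := h _ _ _ _ hs f.
have [t tE] : exists t : {linear B -> Q}, forall b, lpair q k (t b) = lpair (lcomp s p) (lid B) b.
  apply: factor_inj; first by apply: lker0_inj => x [/= x1 x2]; apply: Q3.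
  move=> b; have [|x [x1 x2]] := Q2 (s (p b)) b; first by rewrite sK.
  by exists x; rewrite /= x1 x2.
exists (lcomp g t) => a; rewrite /= -gE; congr (g _).
have [t1 t2] := tE (i a); apply/eqP; rewrite -subr_eq0; apply/eqP/Q3.
  by rewrite linearB t1 /= (exact_comp0 _ ex) linear0 (proj1 (kE a)) subrr.
by rewrite linearB t2 (proj2 (kE a)) subrr.
Qed.

(** The map is extended in two stages: to the preimage [B0] of the factor [X'], and from there to
    [B]. *)
Lemma ext1_prodl X X' Y : ext1_eq0 X Y -> ext1_eq0 X' Y -> ext1_eq0 (X * X')%type Y.
Proof.
move=> h h' A B i p [iI pS ex] f.
pose p1 := lcomp (lfst X X') p.
have [B0 [j [jI jE]]] := ker_exists p1.
have [i0 i0E] : exists i0 : {linear A -> B0}, forall a, j (i0 a) = i a.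
  by apply: factor_inj => // a; apply/jE; rewrite /= (exact_comp0 _ ex).
have hs0 : ses i0 (lcomp (lcomp (lsnd X X') p) j).
  split=> [a b E|x|x].
  - by apply: iI; rewrite -!i0E E.
  - have [b bE] := pS (0, x).
    have /jE[y yE] : p1 b = 0 by rewrite /= bE.
    by exists y; rewrite /= yE bE.
  split=> [E|[a <-]]; last by rewrite /= i0E (exact_comp0 _ ex).
  have : p1 (j x) = 0 by apply/jE; exists x.
  move: E; rewrite /= => E2 E1.
  have /ex[a aE] : p (j x) = 0 by case: (p (j x)) E1 E2 => ? ? /= -> ->.
  by exists a; apply: jI; rewrite i0E.
have [g gE] := h' _ _ _ _ hs0 f.
have hs1 : ses j p1.
  split=> //; move=> x; have [b bE] := pS (x, 0); exists b; by rewrite /= bE.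
have [k kE] := h _ _ _ _ hs1 g.
by exists k => a; rewrite -i0E kE gE.
Qed.

(** The piece [Hom(X, M) -> Hom(X, N) -> Ext^1(X, Y)] of the long exact sequence: the pullback of
    the sequence along [f] splits. *)
Lemma ext1_lift X Y M N (i : {linear Y -> M}) (p : {linear M -> N}) (f : {linear X -> N}) :
  ext1_eq0 X Y -> ses i p -> exists g : {linear X -> M}, forall x, p (g x) = f x.
Proof.
move=> h [iI pS ex].
have [Q [q [k [Q1 Q2 Q3 _]]]] := pullback p f.
have [u uE] : exists u : {linear Y -> Q}, forall y, lpair q k (u y) = lpair (lzero Y X) i y.
  apply: factor_inj; first by apply: lker0_inj => x [/= x1 x2]; apply: Q3.
  move=> y; have [|x [x1 x2]] := Q2 0 (i y); first by rewrite linear0 (exact_comp0 _ ex).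
  by exists x; rewrite /= x1 x2.
have hs : ses u q.
  split=> [a b E|x|x].
  - by apply: iI; have [_ <-] := uE a; have [_ <-] := uE b; rewrite /= E.
  - by have [b bE] := pS (f x); have [z [<- _]] := Q2 _ _ bE; exists z.
  split=> [qx|[a <-]]; last by case: (uE a).
  have /ex[a aE] : p (k x) = 0 by rewrite Q1 qx linear0.
  exists a; apply/eqP; rewrite -subr_eq0; apply/eqP/Q3; have [a1 a2] := uE a.
    by rewrite linearB qx a1 subrr.
  by rewrite linearB a2 aE subrr.
have [r rK] := ext1_split h hs.
have [s [sK _]] := ses_split_retr hs rK.
by exists (lcomp k s) => x; rewrite /= Q1 sK.
Qed.

(** A relation and not a function: [P] may be any projective module, even infinitely generated, so
    that the kernels in every projective resolution qualify. *)
Definition syz K X := exists P (i : {linear K -> P}) (p : {linear P -> X}),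
  projective P /\ ses i p.

(** Being a summand up to projectives is the relation that passes to syzygies ([stable_syz]),
    whatever projective modules are used to form them. *)
Definition stable_summand X X' :=
  exists2 P, projective P & direct_summand X (X' * P)%type.

Lemma stable_summandW X X' : direct_summand X X' -> stable_summand X X'.
Proof.
move=> h; exists (free 0); first exact: proj_free.
exact: summand_trans h (summandl _ _).
Qed.

Lemma syz_prod K X P : projective P -> syz K X -> syz K (X * P)%type.
Proof.
move=> hP [Q [i [p [hQ [iI pS ex]]]]].
exists (Q * P)%type, (lcomp (linl Q P) i), (lpair (lcomp p (lfst Q P)) (lsnd Q P)).
split; first exact: proj_prod.
split=> [a b [/iI]|[x y]|[q y]] //; first by have [q <-] := pS x; exists (q, y).
split=> [[/= /ex[k <-] ->]|[k [<- <-]]]; first by exists k.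
by rewrite /= (exact_comp0 _ ex).
Qed.

(** Lift [s] and [r] to maps [a] and [b] between the projectives. Then [b a - 1] takes values in
    [K], and subtracting this correction makes [K -> K' * Q -> K] the identity. The case [X = X'] is
    what makes projective dimension independent of choices. *)
Lemma schanuel_summand K X K' X' :
  direct_summand X X' -> syz K X -> syz K' X' -> stable_summand K K'.
Proof.
move=> [s [r sK]] [Q [i [p [hQ [iI pS ex]]]]] [Q' [i' [p' [hQ' [iI' pS' ex']]]]].
have [a aE] := proj_lift (lcomp s p) hQ pS'.
have [b bE] := proj_lift (lcomp r p') hQ' pS.
have [a' a'E] : exists a' : {linear K -> K'}, forall k, i' (a' k) = lcomp a i k.
  by apply: factor_inj => // k; apply/ex'; rewrite /= aE /= (exact_comp0 _ ex) linear0.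
have [b' b'E] : exists b' : {linear K' -> K}, forall k, i (b' k) = lcomp b i' k.
  by apply: factor_inj => // k; apply/ex; rewrite /= bE /= (exact_comp0 _ ex') linear0.
have [d dE] : exists d : {linear Q -> K}, forall x, i (d x) = lsub (lcomp b a) (lid Q) x.
  apply: factor_inj => // x; apply/ex.
  by rewrite /= linearB bE /= aE /= sK subrr.
exists Q => //; exists (lpair a' i), (lsub (lcomp b' (lfst _ _)) (lcomp d (lsnd _ _))) => k.
apply: iI; rewrite /= linearB b'E dE /= a'E /=.
by rewrite opprB addrC subrK.
Qed.

Lemma stable_syz K X K' X' : stable_summand X X' -> syz K X -> syz K' X' -> stable_summand K K'.
Proof.
by move=> [P hP h] sK sK'; apply: schanuel_summand h sK (syz_prod hP sK').
Qed.

Fixpoint pdl n X := if n is n'.+1 then exists2 K, syz K X & pdl n' K else projective X.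

Lemma pdl_stable n X X' : pdl n X' -> stable_summand X X' -> pdl n X.
Proof.
elim: n X X' => [|n IH] X X' /=.
  by move=> hX [P hP h]; apply: proj_summand h; apply: proj_prod.
move=> [K' sK' hK'] ss; have [P hP [s [r sK]]] := ss.
have [Q [i [p [hQ [iI pS ex]]]]] := syz_prod hP sK'.
have fS : surjective (lcomp r p).
  by move=> x; have [q qE] := pS (s x); exists q; rewrite /= qE sK.
have [K [j hj]] := ker_ses fS.
have sX : syz K X by exists Q, j, (lcomp r p).
by exists K => //; apply: IH hK' (stable_syz ss sX sK').
Qed.

Lemma pdl_summand n X X' : direct_summand X X' -> pdl n X' -> pdl n X.
Proof. by move=> /stable_summandW h hX; apply: pdl_stable hX h. Qed.

Lemma pdl_syz n K X : pdl n.+1 X -> syz K X -> pdl n K.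
Proof.
move=> [K' sK' hK'] sK; apply: pdl_stable hK' _.
exact: schanuel_summand (summand_refl _) sK sK'.
Qed.

Lemma syz_proj P : projective P -> syz (free 0) P.
Proof.
move=> hP; exists P, (lzero _ _), (lid P); split=> //; split=> [x y _|x|x].
- by apply/ffunP=> -[].
- by exists x.
by split=> [/= ->|[_ <-]] //; exists 0.
Qed.

Lemma pdlS n X : pdl n X -> pdl n.+1 X.
Proof.
elim: n X => [|n IH] X; last by move=> [K sK hK]; exists K => //; apply: IH.
by move=> hX; exists (free 0); [apply: syz_proj|apply: proj_free].
Qed.

Lemma pdl_leq m n X : (m <= n)%N -> pdl m X -> pdl n X.
Proof.
move=> /subnK <-; elim: (n - m)%N => // k IH /IH; rewrite addSn; exact: pdlS.
Qed.

Lemma pdl_proj n P : projective P -> pdl n P.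
Proof. exact: (@pdl_leq 0). Qed.

Lemma horseshoe A B C (i : {linear A -> B}) (p : {linear B -> C}) KA KC :
  ses i p -> syz KA A -> syz KC C ->
  exists KB (i' : {linear KA -> KB}) (p' : {linear KB -> KC}), syz KB B /\ ses i' p'.
Proof.
move=> [iI pS ex] [P [j [q [hP [jI qS exP]]]]] [P' [j' [q' [hP' [jI' qS' exP']]]]].
have [t tE] := proj_lift q' hP' pS.
pose f := lcopair (lcomp i q) t.
have fS : surjective f.
  move=> b; have [y yE] := qS' (p b).
  have /ex[a aE] : p (b - t y) = 0 by rewrite linearB tE yE subrr.
  by have [x xE] := qS a; exists (x, y); rewrite lcopairE /= xE aE subrK.
have [KB [k [kI _ kE]]] := ker_ses fS.
have fE x y : f (x, y) = 0 -> q' y = 0.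
  rewrite lcopairE /= => /(congr1 p); rewrite linearD (exact_comp0 _ ex) add0r linear0.
  by rewrite tE.
have [i' i'E] : exists i' : {linear KA -> KB}, forall x, k (i' x) = lcomp (linl P P') j x.
  apply: factor_inj => // x; apply/kE.
  by rewrite lcopairE /= (exact_comp0 _ exP) !linear0 addr0.
have [p' p'E] : exists p' : {linear KB -> KC}, forall x, j' (p' x) = lcomp (lsnd P P') k x.
  apply: factor_inj => // x; apply/exP'.
  have : f (k x) = 0 by apply/kE; exists x.
  by rewrite [k x]surjective_pairing => /fE.
exists KB, i', p'; split; first by exists (P * P')%type, k, f; split=> //; apply: proj_prod.
split=> [x y E|y|z].
- by have := i'E x; rewrite E i'E => -[/jI].
- have y0 : q' (j' y) = 0 by apply/exP'; exists y.
  have /ex[a aE] : p (t (j' y)) = 0 by rewrite tE.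
  have [x xE] := qS (- a).
  have /kE[z zE] : f (x, j' y) = 0 by rewrite lcopairE /= xE linearN aE addNr.
  by exists z; apply: jI'; rewrite p'E /= zE.
split=> [E|[x <-]]; last by apply: jI'; rewrite p'E /= i'E /= linear0.
have z2 : (k z).2 = 0 by have := p'E z; rewrite E linear0 => ->.
have : f (k z) = 0 by apply/kE; exists z.
rewrite [k z]surjective_pairing z2 lcopairE linear0 addr0 /= => /(linj0 iI) /exP[x xE].
by exists x; apply: kI; rewrite i'E [RHS]surjective_pairing z2 /= xE.
Qed.

Lemma ses_proj_iso A B C (i : {linear A -> B}) (p : {linear B -> C}) :
  projective C -> ses i p -> direct_summand A B /\ direct_summand B (A * C)%type.
Proof.
move=> hC hs; have [_ pS _] := hs; have [s sK] := proj_lift (lid C) hC pS.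
have [r [rK rs dec]] := ses_split hs sK.
split; first by exists i, r.
exists (lpair r p), (lcopair i s) => b; by rewrite lcopairE -dec.
Qed.

Lemma pdl_ext n A B C (i : {linear A -> B}) (p : {linear B -> C}) :
  ses i p -> pdl n A -> pdl n C -> pdl n B.
Proof.
elim: n A B C i p => [|n IH] A B C i p hs.
  move=> hA hC; have [_ h] := ses_proj_iso hC hs.
  by apply: proj_summand h; apply: proj_prod.
move=> [KA sA hA] [KC sC hC]; have [KB [i' [p' [sB hs']]]] := horseshoe hs sA sC.
by exists KB => //; apply: IH hs' hA hC.
Qed.

(** If [P -> B] is a projective presentation with kernel [KB], the kernel [L] of [P -> B -> C] sits
    in [0 -> KB -> L -> A -> 0], so both bounds apply to it. *)
Lemma pdl_coker n A B C (i : {linear A -> B}) (p : {linear B -> C}) :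
  ses i p -> pdl n A -> pdl n.+1 B -> pdl n.+1 C.
Proof.
move=> [iI pS ex] hA [KB [P [j [q [hP [jI qS exP]]]]] hB].
pose f := lcomp p q.
have fS : surjective f by move=> c; have [b <-] := pS c; have [x <-] := qS b; exists x.
have [L [k [kI _ kE]]] := ker_ses fS.
exists L; first by exists P, k, f.
have [i' i'E] : exists i' : {linear KB -> L}, forall x, k (i' x) = j x.
  by apply: factor_inj => // x; apply/kE; rewrite /= (exact_comp0 _ exP) linear0.
have [p' p'E] : exists p' : {linear L -> A}, forall x, i (p' x) = lcomp q k x.
  by apply: factor_inj => // x; apply/ex; apply/kE; exists x.
apply: (@pdl_ext n _ _ _ i' p') => //; split=> [x y E|a|x].
- by apply: jI; rewrite -!i'E E.
- have [x xE] := qS (i a).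
  have /kE[l lE] : f x = 0 by rewrite /= xE (exact_comp0 _ ex).
  by exists l; apply: iI; rewrite p'E /= lE xE.
split=> [E|[y <-]]; last by apply: iI; rewrite p'E /= i'E (exact_comp0 _ exP) linear0.
have /exP[y yE] : q (k x) = 0 by have := p'E x; rewrite E linear0.
by exists y; apply: kI; rewrite i'E.
Qed.

(** The module [L] of [pdl_coker] again, with the bound now known for [KB] and [L] and deduced for
    the cokernel [A]. *)
Lemma pdl_ker n A B C (i : {linear A -> B}) (p : {linear B -> C}) :
  ses i p -> pdl n B -> pdl n C -> pdl n A.
Proof.
case: n => [|n] hs hB hC.
  by have [h _] := ses_proj_iso hC hs; apply: proj_summand hB h.
have [_ pS _] := hs; have [iI _ ex] := hs.
have [KB [P [j [q [hP [jI qS exP]]]]] hKB] := hB.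
pose f := lcomp p q.
have fS : surjective f by move=> c; have [b <-] := pS c; have [x <-] := qS b; exists x.
have [L [k [kI _ kE]]] := ker_ses fS.
have hL : pdl n L by apply: pdl_syz hC _; exists P, k, f.
have [i' i'E] : exists i' : {linear KB -> L}, forall x, k (i' x) = j x.
  by apply: factor_inj => // x; apply/kE; rewrite /= (exact_comp0 _ exP) linear0.
have [p' p'E] : exists p' : {linear L -> A}, forall x, i (p' x) = lcomp q k x.
  by apply: factor_inj => // x; apply/ex; apply/kE; exists x.
apply: (@pdl_coker n _ _ _ i' p') => //; last exact: pdlS.
split=> [x y E|a|x].
- by apply: jI; rewrite -!i'E E.
- have [x xE] := qS (i a).
  have /kE[l lE] : f x = 0 by rewrite /= xE (exact_comp0 _ ex).
  by exists l; apply: iI; rewrite p'E /= lE xE.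
split=> [E|[y <-]]; last by apply: iI; rewrite p'E /= i'E (exact_comp0 _ exP) linear0.
have /exP[y yE] : q (k x) = 0 by have := p'E x; rewrite E linear0.
by exists y; apply: kI; rewrite i'E.
Qed.

Lemma pdl_prod n X Y : pdl n X -> pdl n Y -> pdl n (X * Y)%type.
Proof.
apply: (@pdl_ext n _ _ _ (linl X Y) (lsnd X Y)); split=> [x y []|y|[x y]] //.
  by exists (0, y).
by rewrite /=; split=> [->|[z [_ ->]]] //; exists x.
Qed.

Lemma ext1_stable X X' Y : stable_summand X X' -> ext1_eq0 X' Y -> ext1_eq0 X Y.
Proof.
move=> [P hP h] h'; apply: ext1_summandl h _; apply: ext1_prodl => //.
exact: proj_ext1.
Qed.

End Homological.

(** * Resolutions and coresolutions unrolled into short exact sequences *)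

Section Resolutions.
Variable R : pzRingType.
Implicit Types A B C K L M N P Q V X Y Z T : lmodType R.

Section ResShift.
Variables (M K : lmodType R) (P : proj_resolution M) (j : {linear K -> P 0}).
Hypothesis hj : ses j (res_aug P).
Variable a : {linear P 1 -> K}.
Hypothesis aE : forall x, j (a x) = res_diff P 0 x.

Fact res_shift_surj : surjective a.
Proof.
have [jI _ ex] := hj; move=> k.
have /(@res_exact_aug _ _ P)[x xE] : res_aug P (j k) = 0 by apply/ex; exists k.
by exists x; apply: jI; rewrite aE.
Qed.

Fact res_shift_exact : exact (res_diff P 1) a.
Proof.
have [jI _ ex] := hj; move=> x; rewrite -(@res_exact_diff _ _ P 0 x) -aE.
by split=> [->|/(linj0 jI)]; rewrite ?linear0.
Qed.

Definition res_shift : proj_resolution K :=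
  @ProjResolution R K (fun i => P i.+1) (fun i => res_diff P i.+1) a
    (fun i => @res_projective _ _ P i.+1) res_shift_surj res_shift_exact
    (fun i => @res_exact_diff _ _ P i.+1).
End ResShift.

Lemma res_shift_exists M (P : proj_resolution M) :
  exists K (j : {linear K -> P 0}) (a : {linear P 1 -> K}),
    ses j (res_aug P) /\ forall x, j (a x) = res_diff P 0 x.
Proof.
have [K [j hj]] := ker_ses (@res_aug_surjective _ _ P).
have [jI _ ex] := hj.
have [a aE] : exists a : {linear P 1 -> K}, forall x, j (a x) = res_diff P 0 x.
  by apply: factor_inj => // x; apply/ex; apply: exact_comp0 (@res_exact_aug _ _ P).
by exists K, j, a.
Qed.

Definition zero_resolution : proj_resolution (free R 0).
Proof.
refine (@ProjResolution R (free R 0) (fun=> free R 0) (fun=> lzero _ _) (lzero _ _) _ _ _ _).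
- by move=> i; apply: proj_free.
- by move=> y; exists 0; apply/ffunP=> -[].
- by move=> y; split=> // _; exists 0; apply/ffunP=> -[].
- by move=> i y; split=> // _; exists 0; apply/ffunP=> -[].
Defined.

Section ResCons.
Variables (K P M : lmodType R) (i : {linear K -> P}) (p : {linear P -> M}).
Hypotheses (hP : projective P) (hs : ses i p).
Variable Q : proj_resolution K.

Definition cons_obj n : lmodType R := if n is n'.+1 then Q n' else P.
Definition cons_diff n : {linear cons_obj n.+1 -> cons_obj n} :=
  match n with 0 => lcomp i (res_aug Q) | n'.+1 => res_diff Q n' end.

Lemma res_cons_exists : exists F : proj_resolution M, forall n, F n = cons_obj n.
Proof.
have [iI pS ex] := hs.
have h1 n : projective (cons_obj n) by case: n => [|n] //=; apply: res_projective.
have h2 : exact (cons_diff 0) p.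
  move=> y; rewrite (ex y); split=> [[k <-]|[x <-]]; last by exists (res_aug Q x).
  by have [x <-] := @res_aug_surjective _ _ Q k; exists x.
have h3 n : exact (cons_diff n.+1) (cons_diff n).
  case: n => [|n] /= y; last exact: res_exact_diff.
  rewrite -(@res_exact_aug _ _ Q y); split=> [/= /(linj0 iI)//|/= ->]; exact: linear0.
by exists (@ProjResolution R M cons_obj cons_diff p h1 pS h2 h3).
Qed.
End ResCons.

Lemma pdim_leP M n : pdim_le M n <-> pdl n M.
Proof.
split.
  elim: n M => [|n IH] M [P hP] /=.
    have augI : injective (res_aug P).
      apply: lker0_inj => y /(@res_exact_aug _ _ P)[x <-].
      by rewrite (hP 1%N isT x) linear0.
    have [_ h] := iso_summand augI (@res_aug_surjective _ _ P).
    exact: proj_summand (@res_projective _ _ P 0) h.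
  have [K [j [a [hj aE]]]] := res_shift_exists P.
  exists K; first by exists (P 0), j, (res_aug P); split=> //; apply: res_projective.
  by apply: IH; exists (res_shift hj aE) => i ni; apply: hP.
have z0 : zero_module (free R 0) by move=> x; apply/ffunP=> -[].
elim: n M => [|n IH] M /=.
  move=> /syz_proj[P [i [p [hP hs]]]].
  have [F FE] := res_cons_exists hP hs zero_resolution.
  exists F => -[|k] //; rewrite FE => _; exact: z0.
move=> [K [P [i [p [hP hs]]]] /IH[Q hQ]].
have [F FE] := res_cons_exists hP hs Q.
by exists F => -[|k] //; rewrite FE ltnS => /hQ.
Qed.

(** Dimension shifting: dropping the first term of a resolution of [X] leaves a resolution of its
    first syzygy, so vanishing in degree one on a class closed under syzygies suffices. *)
Lemma ext_succ_class (F : lmodType R -> Prop) N :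
  (forall X K, F X -> syz K X -> F K) -> (forall X, F X -> ext1_eq0 X N) ->
  forall i X, F X -> ext_succ_eq0 X N i.
Proof.
move=> Fs FN; elim=> [|i IH] X FX P f hf.
  have [K [j [a [hj aE]]]] := res_shift_exists P.
  have [f' f'E] : exists f' : {linear K -> N}, forall x, f' (a x) = f x.
    apply: factor_surj; first exact: res_shift_surj hj _ aE.
    by move=> x /(res_shift_exact hj aE)[y <-].
  have [g gE] := FN _ FX _ _ _ _ hj f'.
  by exists g => x; rewrite -aE gE f'E.
have [K [j [a [hj aE]]]] := res_shift_exists P.
have FK : F K.
  by apply: Fs FX _; exists (P 0), j, (res_aug P); split=> //; apply: res_projective.
exact: (IH K FK (res_shift hj aE) f hf).
Qed.

Lemma ext_succ0_ext1 M N n : pdim_le M n -> ext_succ_eq0 M N 0 -> ext1_eq0 M N.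
Proof.
move=> [P _] h.
have [K [j [a [hj aE]]]] := res_shift_exists P.
apply: (ext1_crit (@res_projective _ _ P 0) hj) => f.
have [|g gE] := h P (lcomp f a).
  by move=> x /=; rewrite (exact_comp0 _ (res_shift_exact hj aE)) linear0.
exists g => k; have [x <-] := res_shift_surj hj aE k.
by rewrite aE -gE.
Qed.

(** Coresolutions of length [s] by [add T], given by successive cosyzygies instead of one long
    complex, so that induction on [s] applies. *)
Fixpoint cor T s X : Prop := if s is s'.+1 then
    exists C X' (i : {linear X -> C}) (p : {linear C -> X'}),
      [/\ add_of T C, ses i p & cor T s' X']
  else add_of T X.

Definition coresolved T X s :=
  exists (C : nat -> lmodType R) (eta : {linear X -> C 0})
         (d : forall i, {linear C i -> C i.+1}),
    [/\ injective eta, exact eta (d 0), forall i, exact (d i) (d i.+1),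
        forall j, (j <= s)%N -> add_of T (C j)
      & forall j, (s < j)%N -> zero_module (C j)].

Section CoresCons.
Variables (X C X' : lmodType R) (i : {linear X -> C}) (p : {linear C -> X'}).
Variables (C' : nat -> lmodType R) (eta : {linear X' -> C' 0}).
Variable d' : forall i, {linear C' i -> C' i.+1}.
Definition ccons_obj n : lmodType R := if n is n'.+1 then C' n' else C.
Definition ccons_diff n : {linear ccons_obj n -> ccons_obj n.+1} :=
  match n with 0 => lcomp eta p | n'.+1 => d' n' end.
End CoresCons.

Lemma corP T X s : coresolved T X s <-> cor T s X.
Proof.
split.
  elim: s X => [|s IH] X [C [eta [d [eI ex0 ex hT hz]]]] /=.
    have eS : surjective eta by move=> y; apply/ex0; apply: (hz 1%N).
    have [h _] := iso_summand eI eS.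
    by have [n hn] := hT 0%N isT; exists n; apply: summand_trans h hn.
  have [X' [p hp]] := coker_ses eI; have [_ pS ep] := hp.
  have [e' e'E] : exists e' : {linear X' -> C 1}, forall x, e' (p x) = d 0%N x.
    by apply: factor_surj => // x /ep[y <-]; apply: exact_comp0 ex0.
  exists (C 0%N), X', eta, p; split=> //; first exact: hT.
  apply: IH; exists (fun i => C i.+1), e', (fun i => d i.+1); split=> //.
  - apply: lker0_inj => y; have [c <-] := pS y.
    by rewrite e'E => /ex0[x <-]; apply: exact_comp0 ep.
  - move=> y; rewrite (ex 0%N y); split=> [[x <-]|[z <-]]; first by exists (p x).
    by have [x <-] := pS z; exists x; rewrite e'E.
  - by move=> j js; apply: hT.
  - by move=> j js; apply: hz.
elim: s X => [|s IH] X /=.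
  move=> hX; exists (ccons_obj X (fun=> free R 0)), (lid X).
  exists (@ccons_diff X (free R 0) (lzero _ _) (fun=> free R 0) (lzero _ _) (fun=> lzero _ _)).
  have z0 (x : free R 0) : x = 0 by apply/ffunP=> -[].
  split=> //.
  - by move=> x; split=> // _; exists x.
  - case=> [|i] y; split=> // _.
      by exists 0; rewrite [LHS]z0 [RHS]z0.
    by exists 0; rewrite [LHS]z0 [RHS]z0.
  - by case.
  - by case=> //= j _ x; apply: z0.
move=> [C [X' [i [p [hC [iI pS ep] /IH[C' [eta [d' [eI ex0 ex hT hz]]]]]]]]].
exists (ccons_obj C C'), i, (ccons_diff p eta d'); split=> //.
- by move=> y; rewrite -(ep y) /=; split=> [/(linj0 eI)//|->]; rewrite linear0.
- case=> [|k] /= y; last exact: ex.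
  rewrite (ex0 y); split=> [[x <-]|[x <-]]; last by exists (p x).
  by have [c <-] := pS x; exists c.
- by case.
- by case.
Qed.

Lemma add_coresolutionP T : add_coresolution T <-> exists s, cor T s R^o.
Proof.
split=> [[s [C [eta [d h]]]]|[s /corP[C [eta [d h]]]]].
  by exists s; apply/corP; exists C, eta, d.
by exists s, C, eta, d.
Qed.

End Resolutions.

(** * Strong tilting modules as relatively injective cogenerators *)

Section RelativeInjective.
Variable R : pzRingType.
Implicit Types A B C D E F K L M N P Q QX T TA TC TP U V W X Y Z : lmodType R.

(** For [A <= B <= D] this is the sequence [0 -> B/A -> D/A -> D/B -> 0]. *)
Lemma third_iso A B C D E (a : {linear A -> B}) (p : {linear B -> C})
    (i : {linear B -> D}) (q : {linear D -> E}) :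
  ses a p -> ses i q ->
  exists F (r : {linear D -> F}) (u : {linear C -> F}) (v : {linear F -> E}),
    [/\ ses (lcomp i a) r, ses u v, forall b, u (p b) = r (i b) & forall d, v (r d) = q d].
Proof.
move=> [aI pS ep] [iI qS eq].
have [F [r [iaI rS er]]] : exists F (r : {linear D -> F}), ses (lcomp i a) r.
  by apply: coker_ses => x y /= /iI /aI.
have [u uE] : exists u : {linear C -> F}, forall b, u (p b) = lcomp r i b.
  by apply: factor_surj => // b /ep[x <-]; apply/er; exists x.
have [v vE] : exists v : {linear F -> E}, forall d, v (r d) = q d.
  by apply: factor_surj => // d /er[x <-]; apply: exact_comp0 eq.
exists F, r, u, v; split=> //; split=> [|e|f].
- apply: lker0_inj => c; have [b <-] := pS c; rewrite uE /= => /er[x /= /iI <-].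
  exact: exact_comp0 ep.
- by have [d <-] := qS e; exists (r d).
have [d <-] := rS f; rewrite vE; split=> [/eq[b <-]|[c]].
  by exists (p b); rewrite uE.
have [b <-] := pS c; rewrite uE -vE => <-.
by rewrite vE /= (exact_comp0 _ eq).
Qed.

Lemma pushout_ses2 A B C Y D (i : {linear A -> B}) (p : {linear B -> C})
    (h : {linear A -> Y}) (t : {linear Y -> D}) :
  ses i p -> ses h t ->
  exists Q (j : {linear Y -> Q}) (q : {linear Q -> C}) (k : {linear B -> Q}) (u : {linear Q -> D}),
   ses j q /\ ses k u.
Proof.
move=> [iI pS ex] [hI tS eh]; have [Q [j [k [E1 E2 E3 U]]]] := pushout i h.
have [|q [qj qk]] := U C (lzero Y C) p; first by move=> a; rewrite (exact_comp0 _ ex).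
have [|u [uj uk]] := U D t (lzero B D); first by move=> a; rewrite (exact_comp0 _ eh).
exists Q, j, q, k, u; split; split.
- apply: lker0_inj => y jy; have [|a [/esym ia ->]] := E3 y 0; first by rewrite jy linear0 addr0.
  by rewrite (linj0 iI ia) linear0 oppr0.
- by move=> c; have [b <-] := pS c; exists (k b).
- move=> z; split=> [qz|[y <-]]; last by rewrite qj.
  have [y [b zE]] := E2 z; move: qz; rewrite zE linearD qj qk add0r => /ex[a <-].
  by exists (y + h a); rewrite linearD E1.
- exact: pushout_inj hI _ _ _ E3.
- by move=> d; have [y <-] := tS d; exists (j y).
move=> z; split=> [uz|[b <-]]; last by rewrite uk.
have [y [b zE]] := E2 z; move: uz; rewrite zE linearD uj uk addr0 => /eh[a <-].
by exists (i a + b); rewrite linearD E1.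
Qed.

(** Dual of [horseshoe]; the given extension [e] of [a] along [i] replaces the lifting property of a
    projective. *)
Lemma cohorseshoe A B C TA TC A1 C1 (i : {linear A -> B}) (p : {linear B -> C})
    (a : {linear A -> TA}) (a' : {linear TA -> A1})
    (c : {linear C -> TC}) (c' : {linear TC -> C1}) (e : {linear B -> TA}) :
  ses i p -> ses a a' -> ses c c' -> (forall x, e (i x) = a x) ->
  exists B1 (b : {linear B -> (TA * TC)%type}) (b' : {linear (TA * TC)%type -> B1})
    (u : {linear A1 -> B1}) (v : {linear B1 -> C1}), ses b b' /\ ses u v.
Proof.
move=> [iI pS ep] [aI aS ea] [cI cS ec] eE.
pose f := lpair e (lcomp c p).
have fI : injective f.
  apply: lker0_inj => x [/= x1 /(linj0 cI) /ep[y yE]].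
  by move: x1; rewrite -yE eE => /(linj0 aI) ->; rewrite linear0.
have [B1 [b' hb]] := coker_ses fI; have [_ bS eb] := hb.
have [u uE] : exists u : {linear A1 -> B1}, forall t, u (a' t) = lcomp b' (linl _ _) t.
  apply: factor_surj => // t /ea[x <-]; apply/eb; exists (i x).
  by rewrite /= eE (exact_comp0 _ ep) linear0.
have [v vE] : exists v : {linear B1 -> C1}, forall t, v (b' t) = lcomp c' (lsnd _ _) t.
  by apply: factor_surj => // t /eb[x <-]; rewrite /= (exact_comp0 _ ec).
exists B1, f, b', u, v; split=> //; split=> [|y|y].
- apply: lker0_inj => z; have [t <-] := aS z; rewrite uE => /eb[x [xe /(linj0 cI) /ep[y yE]]].
  by rewrite -xe -yE eE; apply: exact_comp0 ea.
- by have [t <-] := cS y; exists (b' (0, t)); rewrite vE.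
have [[t w] <-] := bS y; rewrite vE /=; split=> [/ec[z <-]|[z]].
  have [x <-] := pS z; exists (a' (t - e x)); rewrite uE /=.
  apply/eqP; rewrite -subr_eq0 -linearB /=; apply/eqP/eb; exists (- x).
  rewrite linearN /=; congr pair; rewrite /= ?sub0r //.
  by rewrite addrC addKr.
have [t' <-] := aS z; rewrite uE /= => /eqP; rewrite -subr_eq0 -linearB /=.
move=> /eqP /eb[x [_ /= E]].
have -> : w = c (- p x) by rewrite linearN E sub0r opprK.
exact: exact_comp0 ec.
Qed.

(** Dual of [schanuel_summand], with two Ext-vanishing conditions in place of the projectivity of
    the middle terms. *)
Lemma coschanuel_summand X X' T T' Q Q' (i : {linear X -> T}) (p : {linear T -> Q})
    (i' : {linear X' -> T'}) (p' : {linear T' -> Q'}) :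
  direct_summand X X' -> ses i p -> ses i' p' -> ext1_eq0 Q T' -> ext1_eq0 Q' T ->
  direct_summand Q (Q' * T)%type.
Proof.
move=> [s [r sK]] hs hs' h h'; have [iI pS ex] := hs; have [iI' pS' ex'] := hs'.
have [a aE] := h _ _ _ _ hs (lcomp i' s).
have [b bE] := h' _ _ _ _ hs' (lcomp i r).
have [a' a'E] : exists a' : {linear Q -> Q'}, forall x, a' (p x) = lcomp p' a x.
  by apply: factor_surj => // x /ex[y <-]; rewrite /= aE /= (exact_comp0 _ ex').
have [b' b'E] : exists b' : {linear Q' -> Q}, forall x, b' (p' x) = lcomp p b x.
  by apply: factor_surj => // x /ex'[y <-]; rewrite /= bE /= (exact_comp0 _ ex).
have [d dE] : exists d : {linear Q -> T}, forall x, d (p x) = lsub (lcomp b a) (lid T) x.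
  apply: factor_surj => // x /ex[y <-].
  by rewrite /= aE /= bE /= sK subrr.
exists (lpair a' d), (lsub (lcomp b' (lfst _ _)) (lcomp p (lsnd _ _))) => y.
have [x <-] := pS y.
by rewrite /= a'E dE b'E /= -linearB opprB addrC subrK.
Qed.

Lemma ext1_ffun X Y n : ext1_eq0 X Y -> ext1_eq0 X {ffun 'I_n -> Y}.
Proof.
move=> h A B i p hs f.
have /choice[g gE] : forall j, exists g : {linear B -> Y}, forall a, g (i a) = f a j.
  by move=> j; have [g gE] := h _ _ _ _ hs (lcomp (lproj _ j) f); exists g.
by exists (lcol g) => a; apply/ffunP=> j; rewrite ffunE gE.
Qed.

Lemma ext1_summandr X Y Y' : direct_summand Y' Y -> ext1_eq0 X Y -> ext1_eq0 X Y'.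
Proof.
move=> [s [r sK]] h A B i p hs f.
have [g gE] := h _ _ _ _ hs (lcomp s f); exists (lcomp r g) => a.
by rewrite /= gE /= sK.
Qed.

Lemma ext1_prodr X Y Y' : ext1_eq0 X Y -> ext1_eq0 X Y' -> ext1_eq0 X (Y * Y')%type.
Proof.
move=> h h' A B i p hs f.
have [g gE] := h _ _ _ _ hs (lcomp (lfst _ _) f).
have [g' gE'] := h' _ _ _ _ hs (lcomp (lsnd _ _) f).
exists (lpair g g') => a; rewrite /= gE gE' /=; by case: (f a).
Qed.

Lemma add_of_refl T : add_of T T.
Proof.
exists 1%N, (lcol (fun=> lid T)), (lproj _ ord0) => x; by rewrite /= ffunE.
Qed.

Lemma add_of_summand T X Y : direct_summand X Y -> add_of T Y -> add_of T X.
Proof. by move=> h [n hn]; exists n; apply: summand_trans h hn. Qed.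

Lemma add_of_zero T : add_of T (free R 0).
Proof. by exists 0%N, (lzero _ _), (lzero _ _) => x; apply/ffunP=> -[]. Qed.

Lemma add_of_prod T X Y : add_of T X -> add_of T Y -> add_of T (X * Y)%type.
Proof.
move=> [n [s [r sK]]] [m [s' [r' sK']]]; exists (n + m)%N.
pose u (i : 'I_(n + m)) : {linear (X * Y)%type -> T} :=
  match split i with
  | inl j => lcomp (lproj _ j) (lcomp s (lfst _ _))
  | inr j => lcomp (lproj _ j) (lcomp s' (lsnd _ _))
  end.
pose v := lpair (lcomp r (lcol (fun j => @lproj _ T _ (lshift m j))))
  (lcomp r' (lcol (fun j => @lproj _ T _ (rshift n j)))).
exists (lcol u), v => -[x y]; rewrite /=.
congr pair.
  rewrite -[RHS]sK; congr (r _); apply/ffunP=> j; rewrite !ffunE /u.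
  by case: split_ordP => [a /lshift_inj ->//|b /eqP]; rewrite eq_lrshift.
rewrite -[RHS]sK'; congr (r' _); apply/ffunP=> j; rewrite !ffunE /u.
by case: split_ordP => [a /eqP|b /rshift_inj ->//]; rewrite eq_rlshift.
Qed.

Lemma add_of_ffun T X n : add_of T X -> add_of T {ffun 'I_n -> X}.
Proof.
move=> h; apply: (@ffun_closed _ (add_of T)) => // [Y Z|Y Z].
  exact: add_of_prod.
exact: add_of_summand.
Qed.

Lemma add_of_trans T U X : add_of T U -> add_of U X -> add_of T X.
Proof. by move=> h [n hn]; apply: add_of_summand hn (add_of_ffun n h). Qed.

Lemma ext1_add X T Y : ext1_eq0 X T -> add_of T Y -> ext1_eq0 X Y.
Proof. by move=> h [n hn]; apply: ext1_summandr hn (@ext1_ffun _ _ n h). Qed.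

End RelativeInjective.

Definition noetherian_ring (R : pzRingType) :=
  forall M : lmodType R, finitely_generated M ->
  forall (L : lmodType R) (i : {linear L -> M}), injective i -> finitely_generated L.

(** * Closure properties of P^{<oo} and the intrinsic form of strong tilting *)

Section FinitePdim.
Variable R : pzRingType.
Hypothesis noeth : noetherian_ring R.
Implicit Types A B C D E F K L M N P Q QX T TA TC TP U V W X Y Z : lmodType R.

Definition fp X := finitely_generated X /\ exists n, pdl n X.

Lemma fin_pdimP X : fin_pdim X <-> fp X.
Proof. by split=> -[fX [n hn]]; split=> //; exists n; apply/pdim_leP. Qed.

Lemma fp_ext A B C (i : {linear A -> B}) (p : {linear B -> C}) :
  ses i p -> fp A -> fp C -> fp B.
Proof.
move=> hs [fA [n hA]] [fC [m hC]]; have [iI pS ex] := hs.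
split; first exact: fg_ext ex fA fC.
exists (maxn n m); apply: pdl_ext hs _ _.
  exact: pdl_leq (leq_maxl _ _) hA.
exact: pdl_leq (leq_maxr _ _) hC.
Qed.

Lemma fp_coker A B C (i : {linear A -> B}) (p : {linear B -> C}) :
  ses i p -> fp A -> fp B -> fp C.
Proof.
move=> hs [fA [n hA]] [fB [m hB]]; have [iI pS ex] := hs.
split; first exact: fg_surj pS fB.
exists (maxn n m).+1; apply: pdl_coker hs _ _.
  exact: pdl_leq (leq_maxl _ _) hA.
by apply: pdl_leq hB; rewrite leqW // leq_maxr.
Qed.

Lemma fp_ker A B C (i : {linear A -> B}) (p : {linear B -> C}) :
  ses i p -> fp B -> fp C -> fp A.
Proof.
move=> hs [fB [n hB]] [fC [m hC]]; have [iI pS ex] := hs.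
split; first exact: noeth fB _ _ iI.
exists (maxn n m); apply: pdl_ker hs _ _.
  exact: pdl_leq (leq_maxl _ _) hB.
exact: pdl_leq (leq_maxr _ _) hC.
Qed.

Lemma fp_summand X Y : direct_summand X Y -> fp Y -> fp X.
Proof.
move=> h [fY [n hY]]; split; first exact: fg_summand h fY.
by exists n; apply: pdl_summand h hY.
Qed.

Lemma fp_prod X Y : fp X -> fp Y -> fp (X * Y)%type.
Proof.
apply: (@fp_ext _ _ _ (linl X Y) (lsnd X Y)); split=> [x y []|y|[x y]] //.
  by exists (0, y).
by rewrite /=; split=> [->|[z [_ ->]]] //; exists x.
Qed.

Lemma fp_add T X : add_of T X -> fp T -> fp X.
Proof.
move=> [n hn] hT; apply: fp_summand hn _.
by apply: (@ffun_closed _ fp) => // [Y Z|Y Z]; [apply: fp_prod|apply: fp_summand].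
Qed.

Lemma pdl_add n T X : add_of T X -> pdl n T -> pdl n X.
Proof.
move=> [m hm] hT; apply: pdl_summand hm _.
by apply: (@ffun_closed _ (pdl n)) => // [Y Z|Y Z]; [apply: pdl_prod|apply: pdl_summand].
Qed.

Lemma fp_free n : fp (free R n).
Proof. by split; [apply: fg_free|exists 0%N; apply: proj_free]. Qed.

Lemma fg_syz X : finitely_generated X ->
  exists n K (i : {linear K -> free R n}) (p : {linear free R n -> X}),
  [/\ ses i p, syz K X & finitely_generated K].
Proof.
move=> /fg_cover[n [p pS]]; have [K [i hs]] := ker_ses pS.
exists n, K, i, p; split=> //; first by exists (free R n), i, p; split=> //; apply: proj_free.
by have [iI _ _] := hs; apply: noeth (fg_free R n) _ _ iI.
Qed.

Lemma fp_syz X m : finitely_generated X -> pdl m.+1 X -> exists K, [/\ fp K, syz K X & pdl m K].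
Proof.
move=> fX hX; have [n [K [i [p [hs sK fK]]]]] := fg_syz fX.
have hK := pdl_syz hX sK.
by exists K; split=> //; split=> //; exists m.
Qed.

Definition rel_injective Y := forall X, fp X -> ext1_eq0 X Y.

(* The intrinsic form of strong_tilting (see strong_tiltingP): a relatively injective
   cogenerator of P^{<oo}, whose projective dimensions are bounded. *)
Definition strong_tilt T := [/\ fp T, rel_injective T,
    forall X, fp X -> exists n (u : {linear X -> {ffun 'I_n -> T}}), injective u
  & exists d, forall X, fp X -> pdl d X].

Lemma rel_injective_add T X : rel_injective T -> add_of T X -> rel_injective X.
Proof. by move=> hT hX W hW; apply: ext1_add hX; apply: hT. Qed.

Section TiltCoresolution.
Variable T : lmodType R.
Hypotheses (hT : fp T) (hI : rel_injective T).

Lemma cor_fp s X : cor T s X -> fp X.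
Proof.
elim: s X => [|s IH] X /=; first by move=> h; apply: fp_add h hT.
by move=> [C [X' [i [p [hC hs /IH hX']]]]]; apply: fp_ker hs (fp_add hC hT) hX'.
Qed.

Lemma corS s X : cor T s X -> cor T s.+1 X.
Proof.
elim: s X => [|s IH] X.
  move=> hX; exists X, (free R 0), (lid X), (lzero _ _); split=> //; last exact: add_of_zero.
  split=> // [y|y]; first by exists 0; apply/ffunP=> -[].
  by split=> // _; exists y.
by move=> [C [X' [i [p [hC hs /IH hX']]]]]; exists C, X', i, p.
Qed.

Lemma cor_leq s t X : (s <= t)%N -> cor T s X -> cor T t X.
Proof. by move=> /subnK <-; elim: (t - s)%N => // k IH /IH; rewrite addSn; exact: corS. Qed.

Lemma cor_ext s A B C (i : {linear A -> B}) (p : {linear B -> C}) :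
  ses i p -> cor T s A -> cor T s C -> cor T s B.
Proof.
elim: s A B C i p => [|s IH] A B C i p hs.
  move=> /= hA hC.
  have [r rK] := ext1_split (rel_injective_add hI hA (fp_add hC hT)) hs.
  have [t [tK dec]] := ses_split_retr hs rK.
  apply: add_of_summand (add_of_prod hA hC).
  by exists (lpair r p), (lcopair i t) => b; rewrite lcopairE -dec.
move=> [TA [A1 [a [a' [hTA ha hA1]]]]] hC'; have hC := cor_fp hC'.
move: hC' => [TC [C1 [c [c' [hTC hc hC1]]]]].
have [e eE] := rel_injective_add hI hTA hC hs a.
have [B1 [b [b' [u [v [hb huv]]]]]] := cohorseshoe hs ha hc eE.
exists (TA * TC)%type, B1, b, b'; split=> //; first exact: add_of_prod.
exact: IH huv hA1 hC1.
Qed.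

Lemma cor_prod s X Y : cor T s X -> cor T s Y -> cor T s (X * Y)%type.
Proof.
apply: (@cor_ext _ _ _ _ (linl X Y) (lsnd X Y)); split=> [x y []|y|[x y]] //.
  by exists (0, y).
by rewrite /=; split=> [->|[z [_ ->]]] //; exists x.
Qed.

(** Embed [X] in [T0] through [Z]. By the dual Schanuel lemma the cosyzygy [QX] is a summand of
    [Q * T0], which again has a coresolution of length [s]. *)
Lemma cor_summand s X Z : direct_summand X Z -> cor T s Z -> cor T s X.
Proof.
elim: s X Z => [|s IH] X Z; first exact: add_of_summand.
move=> hXZ hZ'; have hZ := cor_fp hZ'; move: hZ' => [T0 [Q [i [p [hT0 hs hQ]]]]].
have [sg [rr sK]] := hXZ; have [iI _ _] := hs.
have jI : injective (lcomp i sg) by move=> x y /= /iI /(can_inj sK).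
have [QX [q hq]] := coker_ses jI.
have fX : fp X := fp_summand hXZ hZ.
have fT0 : fp T0 := fp_add hT0 hT.
exists T0, QX, (lcomp i sg), q; split=> //.
apply: (IH _ (Q * T0)%type).
  apply: (coschanuel_summand hXZ hq hs); apply: (rel_injective_add hI hT0).
    exact: fp_coker hq fX fT0.
  exact: fp_coker hs hZ fT0.
by apply: cor_prod => //; apply: (@cor_leq 0).
Qed.

(** [T0] embeds in [P] and hence in the first term [TP]. The quotient [TP / T0] is in P^{<oo}, so
    [T0] splits off and the quotient stays in [add T]; it contains [X = P / T0] with cokernel
    [P1]. *)
Lemma cor_coker_add s T0 P X (i : {linear T0 -> P}) (p : {linear P -> X}) :
  ses i p -> add_of T T0 -> fp X -> cor T s.+1 P -> cor T s.+1 X.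
Proof.
move=> hs hT0 hX [TP [P1 [j [q [hTP hj hP1]]]]].
have [Q [r [u [v [hr huv _ _]]]]] := third_iso hs hj.
have hQ : fp Q by apply: fp_ext huv hX (cor_fp hP1).
have [t tK] := ext1_split (rel_injective_add hI hT0 hQ) hr.
have [w [wK _]] := ses_split_retr hr tK.
exists Q, P1, u, v; split=> //; apply: add_of_summand hTP.
by exists w, r.
Qed.

(** Push [P] out along the embedding of [K] in [T0]: then [X] is [W / T0], and [W] is an extension
    of [K1] by [P], hence coresolved by [cor_ext]. *)
Lemma cor_coker s t K P X (i : {linear K -> P}) (p : {linear P -> X}) :
  ses i p -> cor T s K -> cor T t P -> fp X -> exists m, cor T m X.
Proof.
elim: s t K P X i p => [|s IH] t K P X i p hs hK hP hX.
  by exists t.+1; apply: cor_coker_add hs hK hX (corS hP).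
move: hK => [T0 [K1 [j [q [hT0 hj hK1]]]]].
have [W [a [b [k [u [h1 h2]]]]]] := pushout_ses2 hs hj.
exists (maxn t s).+1; apply: cor_coker_add h1 hT0 hX _.
apply: corS; apply: cor_ext h2 _ _.
  exact: cor_leq (leq_maxl _ _) hP.
exact: cor_leq (leq_maxr _ _) hK1.
Qed.

Lemma cor_free s n : cor T s R^o -> cor T s (free R n).
Proof.
move=> h; apply: (@ffun_closed _ (cor T s)) => // [X Y|X Y].
  exact: cor_prod.
exact: cor_summand.
Qed.

(** The coresolution of the regular module spreads to all of P^{<oo} by induction on projective
    dimension: [cor_summand] handles projectives, and [cor_coker] a quotient of a free module by a
    syzygy. *)
Lemma cor_fin_pdim s : cor T s R^o -> forall X, fp X -> exists t, cor T t X.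
Proof.
move=> h X [fX [n hX]]; elim: n X fX hX => [|n IH] X fX hX.
  have [n [p pS]] := fg_cover fX; have [r rK] := proj_lift (lid X) hX pS.
  by exists s; apply: cor_summand (cor_free n h); exists r, p.
have [m [K [i [p [hs sK fK]]]]] := fg_syz fX.
have [t ht] := IH K fK (pdl_syz hX sK).
apply: cor_coker hs ht (cor_free m h) _; split=> //; by exists n.+1.
Qed.

Lemma cor_pdl d s X : pdl d T -> cor T s X -> pdl d X.
Proof.
move=> hd; elim: s X => [|s IH] X; first by move=> h; apply: pdl_add h hd.
by move=> [C [X' [i [p [hC hs /IH hX']]]]]; apply: pdl_ker hs (pdl_add hC hd) hX'.
Qed.

Lemma cor_cogen s X : cor T s X -> exists n (u : {linear X -> {ffun 'I_n -> T}}), injective u.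
Proof.
case: s => [[n [u [r uK]]]|s [C [X' [i [p [[n [u [r uK]]] [iI _ _] _]]]]]].
  by exists n, u; apply: can_inj uK.
by exists n, (lcomp u i) => x y /= /(can_inj uK) /iI.
Qed.

End TiltCoresolution.

(** Dimension shift in both variables: Ext^1(W, X') embeds in Ext^2(W, X) = Ext^1(K, X) because
    Ext^1(W, Y) vanishes. *)
Lemma cosyz_ext1 K W X Y X' (i : {linear X -> Y}) (p : {linear Y -> X'}) :
  ses i p -> syz K W -> ext1_eq0 K X -> ext1_eq0 W Y -> ext1_eq0 W X'.
Proof.
move=> hs [P [j [q [hP hj]]]] hK hW; apply: (ext1_crit hP hj) => f.
have [g gE] := ext1_lift f hK hs; have [g' g'E] := hW _ _ _ _ hj g.
by exists (lcomp p g') => a; rewrite /= g'E gE.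
Qed.

(** Partial relative injectivity. Each passage to a cosyzygy in a relatively injective module raises
    [j] by one, so once [j] reaches a bound on the projective dimensions in P^{<oo} the module is
    relatively injective. *)
Definition pdl_injective j Y := forall W, fp W -> pdl j W -> ext1_eq0 W Y.

Lemma pdl_injective0 Y : pdl_injective 0 Y.
Proof. by move=> W _ /proj_ext1. Qed.

Lemma cosyz_pdl_injective j X Y X' (i : {linear X -> Y}) (p : {linear Y -> X'}) :
  ses i p -> rel_injective Y -> pdl_injective j X -> pdl_injective j.+1 X'.
Proof.
move=> hs hY hX W hW pW; have [K [fK sK pK]] := fp_syz (proj1 hW) pW.
by apply: cosyz_ext1 hs sK _ _; [apply: hX|apply: hY].
Qed.

Section StrongTilt.
Variable T : lmodType R.
Hypothesis hT : strong_tilt T.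

Lemma strong_tilt_embed X : fp X ->
  exists n X' (i : {linear X -> {ffun 'I_n -> T}}) (p : {linear {ffun 'I_n -> T} -> X'}),
    ses i p /\ fp X'.
Proof.
have [fT _ cT _] := hT; move=> hX; have [n [u uI]] := cT X hX.
have [X' [p hs]] := coker_ses uI; exists n, X', u, p; split=> //.
apply: fp_coker hs hX (fp_add _ fT); exact: add_of_ffun (add_of_refl T).
Qed.

(** The embedding of [X] in a power of [T] has cokernel in P^{<oo}, so relative injectivity of [X]
    splits it. *)
Lemma strong_tilt_add X : fp X -> rel_injective X -> add_of T X.
Proof.
move=> hX iX; have [n [X' [i [p [hs hX']]]]] := strong_tilt_embed hX.
have [r rK] := ext1_split (iX _ hX') hs; by exists n, i, r.
Qed.

Lemma strong_tilt_cor d X : (forall W, fp W -> pdl d W) -> fp X -> cor T d X.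
Proof.
move=> hd hX.
(* [j] counts the cosyzygies already taken and [k] those that remain; at [k = 0] the module is
   relatively injective, hence in [add T]. *)
suff H k j Y : (j + k)%N = d -> fp Y -> pdl_injective j Y -> cor T k Y.
  by apply: (H d 0%N) => //; apply: pdl_injective0.
elim: k j Y => [|k IH] j Y jk hY iY.
  apply: strong_tilt_add => // W hW; apply: iY => //.
  by rewrite -[j]addn0 jk; apply: hd.
have [n [Y' [i [p [hs hY']]]]] := strong_tilt_embed hY.
exists {ffun 'I_n -> T}, Y', i, p; split=> //; first exact: add_of_ffun (add_of_refl T).
apply: (IH j.+1) => //; first by rewrite addSnnS.
have [_ iT _ _] := hT; apply: cosyz_pdl_injective hs _ iY.
exact: rel_injective_add iT (add_of_ffun _ (add_of_refl T)).
Qed.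

End StrongTilt.

(** A coresolution of the regular module makes [T] a cogenerator of P^{<oo} and bounds all
    projective dimensions there by that of [T]. Conversely, with a bound [d], taking cosyzygies in
    powers of [T] reaches [add T] after [d] steps. *)
Lemma strong_tiltingP T : strong_tilting T <-> strong_tilt T.
Proof.
split.
  move=> [[/fin_pdimP hT _ /add_coresolutionP[s hs]] hI].
  have iT : rel_injective T.
    move=> X hX; have [_ [n /pdim_leP hn]] := hX.
    by apply: ext_succ0_ext1 hn _; apply: hI; apply/fin_pdimP.
  have [_ [d hd]] := hT.
  split=> //.
    by move=> X /(cor_fin_pdim hT iT hs)[t]; apply: cor_cogen.
  by exists d => X /(cor_fin_pdim hT iT hs)[t]; apply: cor_pdl.
move=> hT; have [fT iT cT [d hd]] := hT.
have hE M : fin_pdim M -> forall i, ext_succ_eq0 M T i.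
  move=> /fin_pdimP hM i.
  (* The terms of an arbitrary projective resolution need not be finitely generated, so its syzygies
     belong to P^{<oo} only up to projective summands. *)
  apply: (@ext_succ_class _ (fun X => exists2 X', fp X' & stable_summand X X')).
  - move=> X K [X' hX' ss] sK.
    have [_ [n /pdlS hn]] := hX'.
    have [K' [hK' sK' _]] := fp_syz (proj1 hX') hn.
    by exists K' => //; apply: stable_syz ss sK sK'.
  - by move=> X [X' hX' ss]; apply: ext1_stable ss _; apply: iT.
  by exists M => //; apply: stable_summandW; apply: summand_refl.
split=> //; split=> //; first exact/fin_pdimP.
  by apply: hE; apply/fin_pdimP.
apply/add_coresolutionP; exists d; apply: strong_tilt_cor => //.
split; first exact: fg_regular.
exists 0%N; apply: (proj_summand (@proj_free R 1)).
by exists (lcol (fun=> lid R^o)), (lproj _ ord0) => x; rewrite /= ffunE.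
Qed.

End FinitePdim.

(** * Finite length *)

Section Length.
Variable k : pzRingType.
Implicit Types R : pzRingType.

Definition kclosed (R : pzRingType) (phi : k -> R) (M : lmodType R) (W : M -> Prop) :=
  [/\ W 0, forall x y, W x -> W y -> W (x - y) & forall c x, W x -> W (phi c *: x)].

(* M has length at most n over k. *)
Definition len_le (R : pzRingType) (phi : k -> R) (M : lmodType R) n :=
  forall W : nat -> M -> Prop, (forall i, kclosed phi (W i)) ->
    (forall i x, W i x -> W i.+1 x) ->
    forall m, (\sum_(i < m) `[< exists2 x, W i.+1 x & ~ W i x >] <= n)%N.

(** The two modules may live over different rings; only the actions of [k] are compared. This
    transports lengths between [A]-modules and modules over a corner. *)
Definition klinear (R R' : pzRingType) (phi : k -> R) (phi' : k -> R')
    (M : lmodType R) (M' : lmodType R') (f : M -> M') :=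
  (forall x y, f (x - y) = f x - f y) /\ forall c x, f (phi c *: x) = phi' c *: f x.

Lemma klinear0 R R' (phi : k -> R) (phi' : k -> R') (M : lmodType R) (M' : lmodType R') f :
  @klinear R R' phi phi' M M' f -> f 0 = 0.
Proof. by move=> [fB _]; rewrite -[X in f X]subr0 fB subrr. Qed.

Lemma linear_klinear R (phi : k -> R) (M N : lmodType R) (f : {linear M -> N}) :
  klinear phi phi f.
Proof. by split=> *; rewrite ?linearB ?linearZ. Qed.

Lemma submod_kclosed R (phi : k -> R) (M : lmodType R) W : submod W -> @kclosed R phi M W.
Proof.
move=> hW; split; first exact: submod0.
  by move=> x y; apply: submodB.
by move=> c x; apply: submodZ.
Qed.

Lemma kclosedD (R : pzRingType) (phi : k -> R) (M : lmodType R) W x y :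
  @kclosed R phi M W -> W x -> W y -> W (x + y).
Proof.
move=> [W0 WB _] Wx Wy; rewrite -[y]opprK; apply: (WB) => //.
by rewrite -sub0r; apply: WB.
Qed.

Section Maps.
Variables (R R' : pzRingType) (phi : k -> R) (phi' : k -> R').
Variables (M : lmodType R) (M' : lmodType R') (f : M -> M').
Hypothesis fk : klinear phi phi' f.

Lemma preim_kclosed W : kclosed phi' W -> kclosed phi (fun x => W (f x)).
Proof.
have f0 := klinear0 fk; case: fk => fB fZ [W0 WB WZ]; split=> [|x y|c x]; first by rewrite f0.
  by rewrite fB; apply: WB.
by rewrite fZ; apply: WZ.
Qed.

Lemma img_kclosed W : kclosed phi W -> kclosed phi' (fun y => exists2 x, W x & f x = y).
Proof.
have f0 := klinear0 fk; case: fk => fB fZ [W0 WB WZ].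
split=> [|_ _ [x Wx <-] [y Wy <-]|c _ [x Wx <-]]; first by exists 0.
  by exists (x - y); [apply: WB|].
by exists (phi c *: x); [apply: WZ|].
Qed.

Lemma len_inj n : injective f -> len_le phi' M' n -> len_le phi M n.
Proof.
move=> fI h W cW iW m; apply: leq_trans (h _ (fun i => img_kclosed (cW i)) _ m).
  apply: leq_sum => i _; case: asboolP => // -[x Wx nx].
  by case: asboolP => // -[]; exists (f x); [exists x | move=> [y Wy /fI xy]; apply: nx; rewrite -xy].
by move=> i y [x Wx <-]; exists x => //; apply: iW.
Qed.

Lemma len_surj n : (forall y, exists x, f x = y) -> len_le phi M n -> len_le phi' M' n.
Proof.
move=> fS h W cW iW m; apply: leq_trans (h _ (fun i => preim_kclosed (cW i)) _ m).
  apply: leq_sum => i _; case: asboolP => // -[y Wy ny].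
  by have [x xE] := fS y; case: asboolP => // -[]; exists x; rewrite xE.
by move=> i x; apply: iW.
Qed.

(** At each strict step of a chain in the middle module, either the preimage in [M] or the image in
    [N] grows strictly. *)
Lemma len_ext R'' (phi'' : k -> R'') (N : lmodType R'') (g : M' -> N) a b :
  klinear phi' phi'' g -> (forall y, g y = 0 -> exists x, f x = y) ->
  len_le phi M a -> len_le phi'' N b -> len_le phi' M' (a + b).
Proof.
move=> gk ex ha hb W cW iW m.
have hA := ha _ (fun i => preim_kclosed (cW i)) (fun i x => iW i (f x)) m.
have img i : kclosed phi'' (fun y => exists2 x, W i x & g x = y).
  have g0 := klinear0 gk; case: gk => gB gZ; have [W0 WB WZ] := cW i.
  split=> [|_ _ [x Wx <-] [y Wy <-]|c _ [x Wx <-]]; first by exists 0.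
    by exists (x - y); [apply: WB|].
  by exists (phi' c *: x); [apply: WZ|].
have hB : (\sum_(i < m) `[< exists2 x, (exists2 z, W i.+1 z & g z = x) &
             ~ (exists2 z, W i z & g z = x) >] <= b)%N.
  by apply: (hb _ img) => i y [x Wx <-]; exists x => //; apply: iW.
apply: leq_trans (leq_add hA hB); rewrite -big_split /=; apply: leq_sum => i _.
case: asboolP => // -[y Wy ny].
case: (asboolP (exists2 x, W i.+1 (f x) & _)) => // n1.
case: asboolP => // -[]; exists (g y); first by exists y.
move=> [z Wz gz]; apply: n1.
have [|x xE] := ex (y - z); first by rewrite (proj1 gk) gz subrr.
have [W0 WB WZ] := cW i.+1; exists x; rewrite xE; first by apply: WB => //; apply: iW.
by move=> Wyz; apply: ny; rewrite -[y](subrK z); apply: kclosedD (cW i) _ _.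
Qed.
End Maps.

Lemma len_proper R (phi : k -> R) (L M : lmodType R) (i : {linear L -> M}) n :
  injective i -> ~ surjective i -> len_le phi M n -> (0 < n)%N /\ len_le phi L n.-1.
Proof.
move=> iI /existsNP[y0 hy0] h.
have ik := linear_klinear phi i.
have key (W : nat -> L -> Prop) (cW : forall j, kclosed phi (W j)) (iW : forall j x, W j x -> W j.+1 x) m :
   (\sum_(j < m) `[< exists2 x, W j.+1 x & ~ W j x >] < n)%N.
  (* The chain is carried into [M] and continued after index [m] by the whole module; that step is
     strict because [i] is not onto, which gains one unit of length. *)
  pose V j y := (exists2 x, W j x & i x = y) \/ (m < j)%N.
  have cV j : kclosed phi (V j).
    have [V0 VB VZ] := img_kclosed ik (cW j).
    split=> [|x y [hx|?] [hy|?]|c x [hx|?]]; try by right.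
    - by left; apply: V0.
    - by left; apply: VB.
    - by left; apply: VZ.
  have iV j y : V j y -> V j.+1 y.
    by move=> [[x Wx <-]|mj]; [left; exists x => //; apply: iW|right; apply: leqW].
  apply: leq_trans (h V cV iV m.+1); rewrite big_ord_recr /= -[X in (X <= _)%N]addn1.
  apply: leq_add; last first.
    case: asboolP => // -[]; exists y0; first by right.
    by move=> [[x _ xy]|]; [apply: hy0; exists x|rewrite ltnn].
  apply: leq_sum => j _; case: asboolP => // -[x Wx nx].
  case: asboolP => // -[]; exists (i x); first by left; exists x.
  move=> [[z Wz /iI zx]|]; first by apply: nx; rewrite -zx.
  by rewrite ltnNge (ltnW (ltn_ord j)).
have n0 : (0 < n)%N.
  have z0 (j : nat) : kclosed phi (fun x : L => x = 0).
    by split=> [|x y -> ->|c x ->]; rewrite ?subrr ?scaler0.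
  by have := key (fun _ x => x = 0) z0 (fun _ _ h => h) 0%N; apply: leq_ltn_trans.
by split=> // W cW iW m; rewrite -ltnS prednK //; apply: key.
Qed.

Fixpoint kspan R (phi : k -> R) (M : lmodType R) (s : seq M) (x : M) : Prop :=
  if s is v :: s' then exists c, kspan phi s' (x - phi c *: v) else x = 0.

Definition kfg R (phi : k -> R) (M : lmodType R) :=
  exists n (g : 'I_n -> M), forall x, exists c : 'I_n -> k, x = \sum_i phi (c i) *: g i.

Section Span.
Variables (R : pzRingType) (phi : {rmorphism k -> R}) (M : lmodType R).

Lemma kspan_closed s : kclosed phi (@kspan R phi M s).
Proof.
elim: s => [|v s [S0 SB SZ]] /=.
  by split=> [|x y -> ->|c x ->]; rewrite ?subrr ?scaler0.
split=> [|x y [c hc] [d hd]|c x [d hd]].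
- by exists 0; rewrite rmorph0 scale0r subr0.
- exists (c - d); rewrite rmorphB scalerBl.
  rewrite (_ : _ - _ - _ = (x - phi c *: v) - (y - phi d *: v)); first exact: SB.
  by rewrite !opprB addrACA [RHS]addrACA; congr (_ + _); apply: addrC.
by exists (c * d); rewrite rmorphM -scalerA -scalerBr; apply: SZ.
Qed.

Lemma kspanP (s : seq M) (x : M) : kspan phi s x ->
  exists c : 'I_(size s) -> k, x = \sum_i phi (c i) *: s`_i.
Proof.
elim: s x => [|v s IH] x /=; first by move=> ->; exists (fun=> 0); rewrite big_ord0.
move=> [c /IH[d dE]].
exists (fun i => if unlift ord0 i is Some j then d j else c).
rewrite big_ord_recl unlift_none /= -[LHS](subrK (phi c *: v)) dE addrC; congr (_ + _).
by apply: eq_bigr => i _; rewrite liftK.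
Qed.

Lemma len_kspan n W : len_le phi M n -> kclosed phi W ->
  exists n (g : 'I_n -> M), (forall i, W (g i)) /\
    forall x, W x -> exists c : 'I_n -> k, x = \sum_i phi (c i) *: g i.
Proof.
move=> h cW; apply: contrapT => nfg.
have /choice[nxt hnxt] : forall s : seq M, exists x, (forall y, y \in s -> W y) ->
    W x /\ ~ @kspan R phi M s x.
  move=> s; apply: contrapT => /forallNP hs; apply: nfg.
  have sW y : y \in s -> W y by have /not_implyP[] := hs 0; auto.
  exists (size s), (fun i => s`_i); split; first by move=> i; apply/sW/mem_nth.
  move=> x Wx; apply: kspanP; apply: contrapT => nx.
  by have := hs x; apply.
pose S := fix S i := if i is i'.+1 then nxt (S i') :: S i' else [::].
have SW i : forall y, y \in S i -> W y.
  elim: i => [|i IH] y //=; rewrite inE => /predU1P[->|/IH//].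
  by case: (hnxt (S i) IH).
have := h (fun i => kspan phi (S i)) (fun i => kspan_closed (S i)).
move=> /(_ _ n.+1); rewrite (eq_bigr (fun=> 1%N)) => [|i _].
  rewrite sum1_card card_ord ltnn => H; suff: false by [].
  by apply: H => i x hx /=; exists 0; rewrite rmorph0 scale0r subr0.
case: asboolP => // -[]; exists (nxt (S i)); last by case: (hnxt _ (SW i)).
by exists 1; rewrite rmorph1 scale1r subrr; have [] := kspan_closed (S i).
Qed.

Lemma len_kfg n : len_le phi M n -> kfg phi M.
Proof.
move=> h; have [|m [g [_ hg]]] := len_kspan (W := fun=> True) h; first by split.
by exists m, g => x; apply: hg.
Qed.

Lemma kfg_fg : kfg phi M -> finitely_generated M.
Proof. by move=> [n [g h]]; exists n, g => x; have [c ->] := h x; exists (fun i => phi (c i)). Qed.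

Lemma kfg_len l : len_le idfun (k^o : lmodType k) l -> kfg phi M -> exists n, len_le phi M n.
Proof.
move=> hk [n [g hg]].
have [a ha] : exists a, len_le idfun (free k n) a.
  apply: (@ffun_closed k (fun X => exists a, len_le idfun X a)) => [X Y [a ha] [b hb]|X Y [s [p sK]] [a ha]|];
    last by exists l.
  - exists (a + b)%N; apply: (len_ext (linear_klinear idfun (linl X Y))
      (linear_klinear idfun (lsnd X Y)) _ ha hb).
    by move=> [x y] /= ->; exists x.
  - by exists a; apply: (len_inj (linear_klinear idfun s) (can_inj sK) ha).
exists a; apply: (@len_surj _ _ idfun phi (free k n) M (fun c => \sum_i phi (c i) *: g i)) ha.
  split=> [x y|c x].
    by rewrite -sumrB; apply: eq_bigr => i _; rewrite !ffunE rmorphB scalerBl.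
  by rewrite scaler_sumr; apply: eq_bigr => i _; rewrite !ffunE rmorphM scalerA.
move=> x; have [c ->] := hg x; exists [ffun i => c i].
by apply: eq_bigr => i _; rewrite ffunE.
Qed.
End Span.

End Length.

(** * Commutative artinian rings have finite length *)

Section ArtinianLength.
Variable k : comPzRingType.
Hypothesis hk : artinian k.
Implicit Types W V U : k^o -> Prop.

Lemma artinian_min (P : (k^o -> Prop) -> Prop) W0 : submod W0 -> P W0 ->
  exists W, [/\ submod W, P W & forall V, submod V -> P V ->
    (forall x, V x -> W x) -> forall x, W x -> V x].
Proof.
move=> sW0 PW0; apply: contrapT => H.
pose T := {W | submod W /\ P W}.
have /choice[f hf] : forall t : T, exists t' : T,
    (forall x, sval t' x -> sval t x) /\ exists2 x, sval t x & ~ sval t' x.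
  move=> [W [sW PW]]; apply: contrapT => H'; apply: H; exists W; split=> // V sV PV VW x Wx.
  apply: contrapT => nVx; apply: H'; exists (exist _ V (conj sV PV)); split=> //=.
  by exists x.
pose t i : T := iter i f (exist _ W0 (conj sW0 PW0)).
pose I i : {pred k^o} := fun x : k^o => `[< sval (t i) x >].
have [|i x|N hN] := @hk I.
- by move=> i; apply: submod_closed_pred; case: (svalP (t i)).
- by move=> /asboolP h; apply/asboolP; case: (hf (t i)) => + _; apply.
have [_ [x h1 h2]] := hf (t N); apply: h2.
have h3 : x \in I N by apply/asboolP.
by have := hN N.+1 (leqnSn N) x; rewrite h3 => /asboolP.
Qed.

Lemma leq1_strict m (b : nat -> bool) :
  (forall i j, (i < j)%N -> b i -> b j -> False) -> (\sum_(i < m) b i <= 1)%N.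
Proof.
move=> h; elim: m => [|m IH]; first by rewrite big_ord0.
rewrite big_ord_recr /=; case bm: (b m); last by rewrite addn0.
rewrite big1 // => i _; case bi: (b i) => //.
by have := h i m (ltn_ord i) bi bm.
Qed.

(** The quotient by [W] has length at most [n], expressed through chains of ideals containing [W] so
    that no quotient is formed. *)
Definition len_above W n := forall V : nat -> k^o -> Prop, (forall i, submod (V i)) ->
  (forall i x, V i x -> V i.+1 x) -> (forall i x, W x -> V i x) ->
  forall m, (\sum_(i < m) `[< exists2 x, V i.+1 x & ~ V i x >] <= n)%N.

Lemma sub_inter V W : submod V -> submod W -> submod (fun x : k^o => V x /\ W x).
Proof.
move=> sV sW; split; first by split; apply: submod0.
by move=> a x y [? ?] [? ?]; split; apply: submodP.
Qed.

Lemma sub_add V W : submod V -> submod W ->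
  submod (fun x : k^o => exists y z, [/\ V y, W z & x = y + z]).
Proof.
move=> sV sW; split; first by exists 0, 0; rewrite addr0; split=> //; apply: submod0.
move=> a _ _ [y [z [Vy Wz ->]]] [y' [z' [Vy' Wz' ->]]].
exists (a *: y + y'), (a *: z + z'); split; try exact: submodP.
by rewrite scalerDr addrACA.
Qed.

(** [W / V] is simple here: along a chain above [V] the intersection with [W] changes at most once,
    and every other strict step shows in the sum with [W]. *)
Lemma len_above_step W V n : submod W -> submod V -> (forall x, V x -> W x) ->
  (forall U, submod U -> (forall x, V x -> U x) -> (forall x, U x -> W x) ->
     (exists2 x, U x & ~ V x) -> forall x, W x -> U x) ->
  len_above W n -> len_above V n.+1.
Proof.
move=> sW sV VW hsimple hW U sU iU VU m.
pose b i := `[< exists2 x, U i.+1 x /\ W x & ~ (U i x /\ W x) >].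
have hb : (\sum_(i < m) b i <= 1)%N.
  apply: leq1_strict => i j ij /asboolP[x [Ux Wx] nx] /asboolP[y [Uy Wy] ny].
  have full : forall z, W z -> U i.+1 z /\ W z.
    apply: hsimple; first exact: sub_inter.
    - by move=> z Vz; split; [apply: VU|apply: VW].
    - by move=> z [].
    by exists x => // Vx; apply: nx; split=> //; apply: VU.
  apply: ny; split=> //; have [Uz _] := full y Wy.
  elim: (j) ij => // j' IH; rewrite ltnS leq_eqVlt => /predU1P[<-//|/IH]; exact: iU.
pose S i := fun x : k^o => exists y z, [/\ U i y, W z & x = y + z].
have hS := hW S (fun i => sub_add (sU i) sW) _ _ m.
rewrite -addn1 addnC; apply: leq_trans (leq_add hb (hS _ _)); last 2 first.
- by move=> i x [y [z [Uy Wz ->]]]; exists y, z; split=> //; apply: iU.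
- by move=> i x Wx; exists 0, x; rewrite add0r; split=> //; apply: submod0.
rewrite -big_split /=; apply: leq_sum => i _.
case: asboolP => // -[x Ux nx]; rewrite /b.
case: (asboolP (exists2 x, U i.+1 x /\ W x & _)) => // n1.
case: asboolP => // -[]; exists x.
  by exists x, 0; rewrite addr0; split=> //; apply: submod0.
move=> [y [z [Uy Wz xE]]]; apply: n1; exists z.
  by split=> //; rewrite -[z](addKr y) -xE addrC; apply: submodB => //; apply: iU.
by move=> [Uz _]; apply: nx; rewrite xE; apply: submodD.
Qed.

(** The Hopkins-Levitzki theorem for commutative rings. [W] is minimal among the ideals with [k / W]
    of finite length; if it were nonzero, Zorn's lemma would give a smaller [V] with [W / V] simple,
    and [k / V] would still have finite length. *)
Lemma artinian_len : exists n, len_le idfun (k^o : lmodType k) n.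
Proof.
have s0 : submod (fun x : k^o => x = 0).
  by split=> // a x y -> ->; rewrite scaler0 addr0.
have sT : submod (fun _ : k^o => True) by [].
have laT : exists n, len_above (fun _ => True) n.
  exists 0%N => V _ _ VT m; rewrite big1 // => i _.
  by case: asboolP => // -[x _ []]; apply: VT.
have [W [sW [n hn] minW]] := artinian_min (P := fun W => exists n, len_above W n) sT laT.
have [W0|/existsNP[w0' /not_implyP[Ww0' nw0']]] := pselect (forall x, W x -> x = 0).
  exists n => V cV iV m; apply: hn => // i; have [V0 VB VZ] := cV i.
    split=> // a x y Vx Vy; apply: kclosedD (cV i) _ Vy; exact: VZ.
  by move=> x /W0 ->.
(* An ideal [b] is taken minimal with [b W <> 0]. Whenever [c x0] does not annihilate [W], the ideal
   it generates is therefore all of [b] and contains [x0]. *)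
have bT : exists2 x : k, True & exists2 w, W w & x * w <> 0.
  by exists 1 => //; exists w0' => //; rewrite mul1r.
have [b [sb [x0 bx0 [w0 Ww0 xw0]] minb]] :=
  artinian_min (P := fun b => exists2 x : k, b x & exists2 w, W w & x * w <> 0) sT bT.
have unit c : (exists2 w, W w & c * x0 * w <> 0) -> exists d, x0 = d * (c * x0).
  move=> hc; pose D (y : k^o) := exists d : k, y = d * (c * x0).
  have sD : submod D.
    split; first by exists 0; rewrite mul0r.
    by move=> a _ _ [d ->] [d' ->]; exists (a * d + d'); rewrite mulrDl -mulrA.
  apply: (minb D sD _ _ x0 bx0); first by exists (c * x0); first by exists 1; rewrite mul1r.
  move=> _ [d ->]; apply: (submodZ sb d); exact: (submodZ sb c).
pose W1 w := W w /\ x0 * w = 0.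
have sW1 : submod W1.
  split; first by split; [apply: submod0|rewrite mulr0].
  move=> a u v [Wu xu] [Wv xv]; split; first exact: submodP.
  by rewrite mulrDr xv addr0 -[a *: u]/(a * u) mulrCA xu mulr0.
(* The ideal is required to be the union of [W1] and [A], not [A] alone, so that the union of the
   empty chain qualifies too. *)
pose P (A : k^o -> Prop) := [/\ submod (fun x => W1 x \/ A x), forall x, A x -> W x & ~ A w0].
have [|A [[sA AW nA] maxA]] := @classical_sets.Zorn_bigcup _ P.
  move=> F FP totF; split.
  - split; first by left; apply: submod0.
    have key a u v A : F A -> (W1 u \/ A u) -> (W1 v \/ A v) ->
        W1 (a *: u + v) \/ classical_sets.bigcup F id (a *: u + v).
      move=> FA hu hv; have [sA _ _] := FP A FA.
      by have [|?] := submodP sA a hu hv; [left|right; exists A].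
    move=> a u v [W1u|[A FA Au]] [W1v|[B FB Bv]].
    + by left; apply: submodP.
    + by apply: (key a u v B FB); [left|right].
    + by apply: (key a u v A FA); [right|left].
    + have [AB|BA] := totF A B FA FB.
        by apply: (key a u v B FB); right => //; apply: AB.
      by apply: (key a u v A FA); right => //; apply: BA.
  - by move=> x [A FA Ax]; have [_ AW _] := FP A FA; apply: AW.
  by move=> [A FA Ax]; have [_ _ ] := FP A FA; apply.
pose V x := W1 x \/ A x.
have nV : ~ V w0 by move=> [[_ /xw0]|/nA].
have VW x : V x -> W x by move=> [[]|/AW].
case: (nV); apply: (minW V sA _ VW _ Ww0).
exists n.+1; apply: len_above_step hn => // U sU VU UW [u Uu nVu].
  have Uw0 : U w0.
    apply: contrapT => nU; apply: (maxA U).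
      split; first by move=> x Ax; apply: VU; right.
      by move=> UA; apply: nVu; right; apply: UA.
    split=> //; rewrite (_ : (fun x => _) = U) //; apply/funext => x; apply/propext.
    by split=> [[W1x|]//|]; [apply: VU; left|right].
  (* For [y] outside [V], maximality gives [w0 = v + c y]. If [c x0] killed [W], then [c y] would
     lie in [W1] and [w0] in [V]. So [x0 = d c x0] for some [d]; then [x0] kills [y - d c y], and
     [y] lies in [V + k w0], hence in [U]. *)
  move=> y Wy; have [Vy|nVy] := pselect (V y); first exact: VU.
  have [v [c [Vv w0E]]] : exists v c, V v /\ w0 = v + c * y.
    pose U' x := exists v z, [/\ V v, (exists c, z = c * y) & x = v + z].
    have sU' : submod U'.
      apply: sub_add => //; split; first by exists 0; rewrite mul0r.
      by move=> a _ _ [d ->] [d' ->]; exists (a * d + d'); rewrite mulrDl -mulrA.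
    apply: contrapT => nw; apply: (maxA U').
      split.
        by move=> x Ax; exists x, 0; split; [right|exists 0; rewrite mul0r|rewrite addr0].
      move=> U'A; apply: nVy; right; apply: U'A; exists 0, y.
      split; [exact: (submod0 sA)|by exists 1; rewrite mul1r|by rewrite add0r].
    split.
    + rewrite (_ : (fun x => _) = U') //; apply/funext => x; apply/propext.
      split=> [[W1x|]//|]; last by right.
      by exists x, 0; split; [left|exists 0; rewrite mul0r|rewrite addr0].
    + move=> x [v [z [Vv [c ->] ->]]]; apply: (submodD sW); first exact: VW.
      exact: (submodZ sW).
    by move=> [v [z [Vv [c ->] w0E]]]; apply: nw; exists v, c.
  have [cm|/existsNP[w /not_implyP[Ww cw]]] := pselect (forall w, W w -> c * x0 * w = 0).
    case: nV; rewrite w0E; apply: (submodD sA) => //; left; split; first exact: (submodZ sW).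
    by rewrite mulrA [x0 * c]mulrC cm.
  have [|d dE] := unit c; first by exists w.
  have -> : y = d * (w0 - v) + (y - d * (c * y)) by rewrite w0E addrAC subrr add0r addrC subrK.
  apply: (submodD sU); first by apply: (submodZ sU d); apply: (submodB sU) => //; apply: VU.
  apply: VU; left; split; first by apply: (submodB sW) => //; apply: (submodZ sW d); apply: (submodZ sW c).
  by rewrite mulrBr {1}dE !mulrA [d * c * x0]mulrC !mulrA subrr.
Qed.

End ArtinianLength.

Section LengthExtrema.
Variables (k R : pzRingType) (phi : k -> R) (M : lmodType R) (n : nat).
Hypothesis hM : len_le phi M n.

Lemma len_no_chain (W : nat -> M -> Prop) : (forall i, kclosed phi (W i)) ->
  (forall i x, W i x -> W i.+1 x) -> exists2 i, (i <= n)%N & forall x, W i.+1 x -> W i x.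
Proof.
move=> cW iW; apply: contrapT => H.
have := hM cW iW n.+1; rewrite (eq_bigr (fun=> 1%N)) => [|i _].
  by rewrite sum1_card card_ord ltnn.
case: asboolP => // h; case: H; exists (val i); first by rewrite -ltnS ltn_ord.
by move=> x Wx; apply: contrapT => nx; apply: h; exists x.
Qed.

Lemma len_max (P : (M -> Prop) -> Prop) W0 : (forall W, P W -> kclosed phi W) -> P W0 ->
  exists W, P W /\ forall V, P V -> (forall x, W x -> V x) -> forall x, V x -> W x.
Proof.
move=> Pc PW0; apply: contrapT => H.
have /choice[f hf] : forall t : {W | P W}, exists t' : {W | P W},
    (forall x, sval t x -> sval t' x) /\ ~ (forall x, sval t' x -> sval t x).
  move=> [W PW]; apply: contrapT => H'; apply: H; exists W; split=> // V PV WV.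
  by apply: contrapT => nV; apply: H'; exists (exist _ V PV).
pose t i := iter i f (exist _ W0 PW0).
have [|i x|i _ hi] := @len_no_chain (fun i => sval (t i)).
- by move=> i; apply/Pc/svalP.
- exact: (proj1 (hf (t i)) x).
exact: (proj2 (hf (t i))).
Qed.

Lemma len_min (P : (M -> Prop) -> Prop) W0 : (forall W, P W -> kclosed phi W) -> P W0 ->
  exists W, P W /\ forall V, P V -> (forall x, V x -> W x) -> forall x, W x -> V x.
Proof.
move=> Pc PW0; apply: contrapT => H.
have /choice[f hf] : forall t : {W | P W}, exists t' : {W | P W},
    (forall x, sval t' x -> sval t x) /\ ~ (forall x, sval t x -> sval t' x).
  move=> [W PW]; apply: contrapT => H'; apply: H; exists W; split=> // V PV WV.
  by apply: contrapT => nV; apply: H'; exists (exist _ V PV).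
pose t i := iter i f (exist _ W0 PW0).
(* The descending chain is read backwards from index [n.+1]; truncated subtraction makes it constant
   afterwards, which keeps it increasing. *)
have [|i x|i i_n hi] := @len_no_chain (fun i => sval (t (n.+1 - i)%N)).
- by move=> i; apply/Pc/svalP.
- case: (ltnP i n.+1) => ni; last first.
    by rewrite (eqP (ni : _ - _ == 0)%N) (eqP (leqW ni : _ - _ == 0)%N).
  by rewrite subSS subSn //; exact: (proj1 (hf (t (n - i)%N)) x).
have [_ []] := hf (t (n - i)%N); rewrite -[f _]/(t (n - i).+1) -subSn //.
Qed.
End LengthExtrema.

(** * Fitting's lemma and decomposition into indecomposables *)

Section Fitting.
Variables (k R : pzRingType) (phi : k -> R).
Implicit Types L M T X Y Z : lmodType R.

Fixpoint lpow X (g : {linear X -> X}) n : {linear X -> X} :=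
  if n is n'.+1 then lcomp g (lpow g n') else lid X.

Lemma lpowE X (g : {linear X -> X}) n x : lpow g n x = iter n g x.
Proof. by elim: n => //= n ->. Qed.

Lemma bijectiveP X Y (f : {linear X -> Y}) : bijective f <-> injective f /\ surjective f.
Proof.
split=> [[g fK gK]|[fI fS]]; first by split; [apply: can_inj fK|move=> y; exists (g y)].
by have [g [fK gK]] := bij_inv fI fS; exists g.
Qed.

Lemma bij_linear X Y (f : {linear X -> Y}) : bijective f ->
  exists g : {linear Y -> X}, cancel f g /\ cancel g f.
Proof. by move=> /bijectiveP[fI fS]; apply: bij_inv. Qed.

(** Counting steps, the kernels and the images of the powers of [g] are stationary from exponent [n]
    on. Hence [g^(n+1)] induces an automorphism of its own image [Y], and [b] is the inverse of that
    automorphism. *)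
Lemma fitting X n (g : {linear X -> X}) : len_le phi X n ->
  exists Y (q : {linear X -> Y}) (j : {linear Y -> X}) (b : {linear Y -> Y}),
  [/\ surjective q, injective j, forall x, j (q x) = iter n.+1 g x,
      forall y, b (q (j y)) = y & forall y, q (j (b y)) = y].
Proof.
move=> hX; pose N := n.+1.
have [Y [q [j [qS jI jq]]]] := im_factor (lpow g N).
have [i i_n hi] := len_no_chain hX (W := fun i x => lpow g i x = 0)
  (fun i => submod_kclosed phi (ker_submod (lpow g i)))
  (fun i x (gx : lpow g i x = 0) => etrans (congr1 g gx) (linear0 g)).
have ker m x : lpow g (N + m) x = 0 -> lpow g N x = 0.
  have ker1 m' : (i <= m')%N -> forall x, lpow g m'.+1 x = 0 -> lpow g m' x = 0.
    move=> /subnKC <- z; rewrite !lpowE -addSn !iterD -!lpowE; exact: hi.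
  elim: m => [|m IH]; rewrite ?addn0 // addnS => /ker1 h; apply: IH; apply: h.
  by rewrite (leq_trans i_n) // (leq_trans (leqnSn n)) // leq_addr.
have [||i' i'_n hi'] := len_no_chain hX (W := fun i x => exists y, lpow g (N - i)%N y = x).
- by move=> i'; apply/submod_kclosed/im_submod.
- move=> i' x [y <-]; case: (ltnP i' N) => ni.
    by exists (g y); rewrite !lpowE -[in RHS](subnSK ni) iterSr.
  by exists y; rewrite (eqP (ni : _ - _ == 0)%N) (eqP (leqW ni : _ - _ == 0)%N).
have im m x : exists y, lpow g N x = lpow g (N + m) y.
  pose r := (N - i'.+1)%N.
  have rE : (N - i')%N = r.+1 by rewrite /r subnSK.
  have im1 m' : (r <= m')%N -> forall x, exists y, lpow g m' x = lpow g m'.+1 y.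
    move=> rm z; have [|y yE] := hi' (lpow g r z); first by exists z.
    rewrite rE in yE; exists y.
    by rewrite !lpowE -(subnK rm) -addnS !iterD -!lpowE yE.
  elim: m => [|m [y ->]]; first by exists x; rewrite addn0.
  have [|z ->] := im1 (N + m)%N _ y; last by exists z; rewrite addnS.
  by rewrite (leq_trans (leq_subr _ _)) // leq_addr.
have uI : injective (lcomp q j).
  apply: lker0_inj => y; have [x <-] := qS y => h.
  have hN : lpow g (N + N) x = 0.
    rewrite lpowE iterD -!lpowE -[lpow g N x]jq -[LHS]jq.
    exact: etrans (congr1 j h) (linear0 j).
  by apply: jI; rewrite linear0 jq; apply: ker hN.
have uS : surjective (lcomp q j).
  move=> y; have [x <-] := qS y; have [z zE] := im N x.
  by exists (q z); apply: jI; rewrite -[lcomp q j _]/(q (j (q z))) !jq zE !lpowE iterD.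
have [b [bK Kb]] := bij_inv uI uS.
by exists Y, q, j, b; split=> // x; rewrite jq lpowE.
Qed.

(** The image of [g^(n+1)] is a direct summand with retraction [b q], and a proper one when [g] is
    not bijective. This is how modules are shortened in minimality arguments. *)
Lemma noniso_summand X n (g : {linear X -> X}) : len_le phi X n -> ~ bijective g ->
  exists Y (q : {linear X -> Y}) (j : {linear Y -> X}) (b : {linear Y -> Y}),
  [/\ injective j, ~ surjective j, forall x, j (q x) = iter n.+1 g x
    & forall y, b (q (j y)) = y].
Proof.
move=> hX ng; have [Y [q [j [b [qS jI jq bK Kb]]]]] := fitting g hX.
exists Y, q, j, b; split=> // jS; apply: ng; apply/bijectiveP; split.
  apply: lker0_inj => x gx; have [y yE] := jS x.
  have qx : q x = 0 by apply: jI; rewrite jq linear0 iterSr gx -lpowE linear0.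
  by rewrite -yE -(bK y) yE qx !linear0.
move=> x; have [y yE] := jS x; exists (iter n g (j (b y))).
by rewrite -iterS -jq Kb.
Qed.

Lemma indecomposable_endo Z n (g : {linear Z -> Z}) : indecomposable Z -> len_le phi Z n ->
  ~ bijective g -> forall x, iter n.+1 g x = 0.
Proof.
move=> [nZ indZ] hZ ng; have [Y [q [j [b [jI jS jq bK]]]]] := noniso_summand hZ ng.
have bqK : cancel j (lcomp b q) by move=> y; rewrite /= bK.
have [Y' [s' [p' [s'K ps ps' dec]]]] := summand_compl bqK.
have [|Y0|Y'0] := indZ Y Y'.
- exists (lpair (lcomp b q) p'); apply/bijectiveP; split.
    by apply: lker0_inj => x [x1 x2]; rewrite -[x]dec /= x1 x2 !linear0 addr0.
  move=> [y y']; exists (j y + s' y'); rewrite /= !linearD /=.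
  by have := ps' y'; rewrite /= ps s'K bK => ->; rewrite addr0 add0r.
- by move=> x; rewrite -jq (Y0 (q x)) linear0.
by case: jS => x; exists (b (q x)); rewrite -[RHS]dec (Y'0 (p' x)) linear0 addr0.
Qed.

Lemma nilpotent_bij Z n (g : {linear Z -> Z}) : (forall x, iter n g x = 0) ->
  bijective (lsub (lid Z) g).
Proof.
move=> gn; apply/bijectiveP; split.
  apply: lker0_inj => x /eqP; rewrite subr_eq0 => /eqP /= xE.
  by rewrite -(gn x); elim: (n) => //= m <-.
suff H m y : exists x, lsub (lid Z) g x = y - iter m g y.
  by move=> y; have [x xE] := H n y; exists x; rewrite xE gn subr0.
elim: m => [|m [x xE]]; first by exists 0; rewrite linear0 subrr.
exists (x + iter m g y); rewrite linearD xE /= addrA subrK //.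
Qed.

(** Locality of the endomorphism ring, for finite sums. If the last term is not bijective, its
    composite with the inverse [c] of the sum is nilpotent, so the remaining terms already have a
    bijective sum. *)
Lemma indecomposable_sum Z n m (u : 'I_m -> {linear Z -> Z}) :
  indecomposable Z -> len_le phi Z n -> bijective (lsum u) -> exists i, bijective (u i).
Proof.
move=> iZ hZ; elim: m u => [|m IH] u.
  move=> /bijectiveP[uI _]; case: iZ => -[]; move=> x; apply: uI.
  by rewrite /= !big_ord0.
move=> bu; apply: contrapT => /forallNP nu.
have [c [cK Kc]] := bij_linear bu.
pose a := u ord_max; pose v := lsum (fun i : 'I_m => u (widen_ord (leqnSn m) i)).
have E x : v x + a x = lsum u x by rewrite /= big_ord_recr.
have nca : ~ bijective (lcomp c a).
  move=> bca; apply: (nu ord_max); apply: (@eq_bij _ _ (lcomp (lsum u) (lcomp c a))).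
    by apply: bij_comp.
  by move=> x; rewrite -[LHS]/(lsum u (c (a x))) Kc.
have nil := indecomposable_endo iZ hZ nca.
have bcv : bijective (lcomp c v).
  apply: (@eq_bij _ _ (lsub (lid Z) (lcomp c a)) (nilpotent_bij nil)) => x /=.
  by rewrite -[X in X - _]cK -E linearD addrK.
have [|i bi] := IH (fun i => u (widen_ord (leqnSn m) i)); last exact: (nu _ bi).
apply: (@eq_bij _ _ (lcomp (lsum u) (lcomp c v))); first exact: bij_comp.
by move=> x; rewrite -[LHS]/(lsum u (c (v x))) Kc.
Qed.

(** The identity of [Z] is the sum of its components through the copies of [T]; by locality one of
    these is bijective. *)
Lemma indecomposable_add Z n T : indecomposable Z -> len_le phi Z n -> add_of T Z ->
  direct_summand Z T.
Proof.
move=> iZ hZ [m [s [p sK]]].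
pose e (i : 'I_m) : {linear T -> {ffun 'I_m -> T}} :=
  lcol (fun j => if j == i then lid T else lzero T T).
have [|i bi] := @indecomposable_sum Z n m
   (fun i => lcomp (lcomp p (e i)) (lcomp (lproj T i) s)) iZ hZ.
  exists idfun => x; rewrite /= -linear_sum -[RHS]sK; congr (p _); apply/ffunP=> j;
  rewrite sum_ffunE (bigD1 j) //= big1 => [|i /negPf ij]; rewrite ffunE ?eqxx ?addr0 //;
  by rewrite eq_sym ij.
have [c [cK Kc]] := bij_linear bi.
by exists (lcomp (lproj T i) s), (lcomp c (lcomp p (e i))) => x; apply: cK.
Qed.

Lemma indecomposable_prod Z n T T' : indecomposable Z -> len_le phi Z n ->
  direct_summand Z (T * T')%type -> direct_summand Z T \/ direct_summand Z T'.
Proof.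
move=> iZ hZ [s [p sK]].
pose u1 := lcomp (lcomp p (linl T T')) (lcomp (lfst T T') s).
pose u2 := lcomp (lcomp p (linr T T')) (lcomp (lsnd T T') s).
have [|i] := @indecomposable_sum Z n 2 (fun i => if i == ord0 then u1 else u2) iZ hZ.
  exists idfun => x; rewrite /= !big_ord_recl big_ord0 addr0 /= -linearD -[RHS]sK;
  by congr (p _); case: (s x) => a b; congr pair; rewrite /= ?addr0 ?add0r.
case: ifP => _ /bij_linear[c [cK Kc]]; [left|right].
  by exists (lcomp (lfst T T') s), (lcomp c (lcomp p (linl T T'))) => x; apply: cK.
by exists (lcomp (lsnd T T') s), (lcomp c (lcomp p (linr T T'))) => x; apply: cK.
Qed.

(** Existence of decompositions into indecomposables, packaged as an induction principle so that no
    families of summands have to be handled. *)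
Lemma indec_ind (P : lmodType R -> Prop) :
  (forall X, zero_module X -> P X) -> (forall X, indecomposable X -> P X) ->
  (forall X Y Z, isomorphic X (Y * Z)%type -> P Y -> P Z -> P X) ->
  forall n X, len_le phi X n -> P X.
Proof.
move=> P0 PI PP; elim/ltn_ind=> n IH X hX.
have [z|nz] := pselect (zero_module X); first exact: P0.
have [iX|nX] := pselect (indecomposable X); first exact: PI.
have [Y [Z [[f /bijectiveP[fI fS]] nY nZ]]] : exists Y Z,
    [/\ isomorphic X (Y * Z)%type, ~ zero_module Y & ~ zero_module Z].
  apply: contrapT => H; apply: nX; split=> // Y Z iso; apply: contrapT => /not_orP[? ?].
  by apply: H; exists Y, Z.
have [g [fK gK]] := bij_inv fI fS.
apply: (PP X Y Z); first by exists f; exists g.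
  have [||n0 hY] := @len_proper _ _ phi Y X (lcomp g (linl Y Z)) n _ _ hX.
  - by move=> x y /= /(can_inj gK) [].
  - move=> gS; apply: nZ => z; have [y yE] := gS (g (0, z)).
    by have := can_inj gK yE => -[].
  by apply: IH hY; rewrite prednK.
have [||n0 hY] := @len_proper _ _ phi Z X (lcomp g (linr Y Z)) n _ _ hX.
- by move=> x y /= /(can_inj gK) [].
- move=> gS; apply: nY => z; have [y yE] := gS (g (z, 0)).
  by have := can_inj gK yE => -[].
by apply: IH hY; rewrite prednK.
Qed.

End Fitting.

(** The base ring and its structure map are fixed, with finite length in place of the descending
    chain condition; all lengths over an Artin algebra are taken over this [k]. *)
Definition artin_over (k : comPzRingType) (A : pzRingType) (phi : {rmorphism k -> A}) :=
  [/\ exists l, len_le idfun (k^o : lmodType k) l, forall c a, phi c * a = a * phi c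
    & kfg phi (A^o : lmodType A)].

Lemma artin_algebra_over A : artin_algebra A ->
  exists (k : comPzRingType) (phi : {rmorphism k -> A}), artinian k /\ artin_over phi.
Proof.
move=> [k [phi [hk hc [n [g hg]]]]]; exists k, phi; split=> //; split=> //.
  exact: artinian_len.
by exists n, g.
Qed.

(** * Injective hulls over Artin algebras *)

Section ArtinModules.
Variables (k : comPzRingType) (A : pzRingType) (phi : {rmorphism k -> A}).
Hypothesis hA : artin_over phi.
Implicit Types E K L M N S W X Y Z Q : lmodType A.

Lemma fg_len M : finitely_generated M -> exists n, len_le phi M n.
Proof.
have [[l hl] hc hk] := hA.
have [n hn] := kfg_len hl hk.
move=> /fg_cover[m [p pS]].
have [a ha] : exists a, len_le phi (free A m) a.
  apply: (@ffun_closed A (fun X => exists a, len_le phi X a)) => [X Y [a ha] [b hb]|X Y [s [r sK]] [a ha]|];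
    last by exists n.
  - exists (a + b)%N; apply: (len_ext (linear_klinear phi (linl X Y))
      (linear_klinear phi (lsnd X Y)) _ ha hb).
    by move=> [x y] /= ->; exists x.
  - by exists a; apply: (len_inj (linear_klinear phi s) (can_inj sK) ha).
by exists a; apply: (len_surj (linear_klinear phi p) pS ha).
Qed.

Lemma len_fg M n : len_le phi M n -> finitely_generated M.
Proof. by move=> h; apply/kfg_fg/len_kfg; apply: h. Qed.

Lemma artin_noetherian : noetherian_ring A.
Proof.
move=> M /fg_len[n hn] L i iI; apply: len_fg; apply: len_inj iI hn.
exact: linear_klinear.
Qed.

Fact lscale_linear M (c : k) : linear (fun x : M => phi c *: x).
Proof. by have [_ hc _] := hA; move=> a x y; rewrite scalerDr !scalerA hc. Qed.
Definition lscale M c := lin_of (@lscale_linear M c).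

(** Evaluation at generators of [M] embeds [Hom(M, N)] in a finite power of [N], which has finite
    length over [k]. *)
Lemma hom_kfg M N : finitely_generated M -> finitely_generated N ->
  exists m (h : 'I_m -> {linear M -> N}), forall f : {linear M -> N},
    exists c : 'I_m -> k, forall x, f x = \sum_i phi (c i) *: h i x.
Proof.
move=> [n [g hg]] /fg_len[b hb].
have [d hd] : exists d, len_le phi ({ffun 'I_n -> N} : lmodType A) d.
  apply: (@ffun_closed A (fun X => exists a, len_le phi X a)) => [X Y [a ha] [c hc]|X Y [s [r sK]] [a ha]|];
    last by exists b.
  - exists (a + c)%N; apply: (len_ext (linear_klinear phi (linl X Y))
      (linear_klinear phi (lsnd X Y)) _ ha hc).
    by move=> [x y] /= ->; exists x.
  - by exists a; apply: (len_inj (linear_klinear phi s) (can_inj sK) ha).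
pose W (v : {ffun 'I_n -> N}) := exists f : {linear M -> N}, forall j, v j = f (g j).
have [|m [v [/choice[h hE] vW]]] := len_kspan (W := W) hd.
  split=> [|x y [f fE] [f' f'E]|c x [f fE]].
  - by exists (lzero M N) => j; rewrite ffunE.
  - by exists (lsub f f') => j; rewrite !ffunE fE f'E.
  - by exists (lcomp (lscale N c) f) => j; rewrite ffunE fE.
exists m, h => f.
have [|c cE] := vW [ffun j => f (g j)]; first by exists f => j; rewrite ffunE.
exists c; pose r := lsum (fun i => lcomp (lscale N (c i)) (h i)).
have rg j : r (g j) = f (g j).
  have := congr1 (fun u : {ffun _ -> _} => u j) cE; rewrite ffunE sum_ffunE => ->.
  by apply: eq_bigr => i _; rewrite ffunE hE.
move=> x; rewrite -[RHS]/(r x); have [a ->] := hg x.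
by rewrite !linear_sum; apply: eq_bigr => i _; rewrite !linearZ rg.
Qed.

Definition fg_injective E := forall W, finitely_generated W -> ext1_eq0 W E.

(** Essentiality in terms of maps out of [M], which composes easily; [essential_meet] recovers the
    form with intersections. *)
Definition essential S M (i : {linear S -> M}) :=
  injective i /\ forall Q (p : {linear M -> Q}), injective (lcomp p i) -> injective p.

Lemma essential_meet S M (i : {linear S -> M}) (V : M -> Prop) y : essential i ->
  submod V -> V y -> y <> 0 -> exists2 s, s <> 0 & V (i s).
Proof.
move=> [_ ess] sV Vy y0; apply: contrapT => H; apply: y0.
have [Q [p [pS pE]]] := quot_exists sV.
have pI : injective p.
  apply: ess; apply: lker0_inj => s /= /pE Vs; apply: contrapT => s0.
  by apply: H; exists s.
by apply: (linj0 pI); apply/pE.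
Qed.

(* U / I is simple. *)
Definition covers M (I U : M -> Prop) :=
  [/\ submod U, forall x, I x -> U x, exists2 x, U x & ~ I x &
    forall V, submod V -> (forall x, I x -> V x) -> (forall x, V x -> U x) ->
    (exists2 x, V x & ~ I x) -> forall x, U x -> V x].

(** Induction along a composition series of the regular module: a largest left ideal satisfying [G],
    if proper, is covered by a minimal left ideal strictly above it. *)
Lemma cover_ind (G : (A^o -> Prop) -> Prop) :
  (forall I J, (forall x, I x <-> J x) -> G I -> G J) -> G (fun x => x = 0) ->
  (forall I U, submod I -> covers I U -> G I -> G U) -> G (fun=> True).
Proof.
move=> Geq G0 GS; have [n hn] := fg_len (fg_regular A).
have s0 : submod (fun x : A^o => x = 0).
  by split=> // a x y -> ->; rewrite scaler0 addr0.
have [I [[sI GI] Imax]] := len_max hn (P := fun I => submod I /\ G I)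
  (fun I h => submod_kclosed phi (proj1 h)) (conj s0 G0).
have [II|/existsNP[x nIx]] := pselect (forall x, I x).
  by apply: (Geq I).
have [||U [[sU IU neU] Umin]] := len_min hn (P := fun U => [/\ submod U,
   forall x, I x -> U x & exists2 x, U x & ~ I x]) (W0 := fun=> True).
- by move=> U [sU _ _]; apply: submod_kclosed.
- by split=> //; exists x.
have cU : covers I U.
  by split=> // V sV IV VU neV; apply: Umin.
have [y Uy nIy] := neU; case: nIy.
by apply: (Imax U) => //; split=> //; apply: GS cU GI.
Qed.

(* The annihilators M_I = {y | I y = 0} filter M; if U covers I and x is in U but
   not in I, then y |-> x y embeds M_I / M_U into S as k-modules. *)
Lemma essential_len S : finitely_generated S ->
  exists b, forall M (i : {linear S -> M}), essential i -> len_le phi M b.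
Proof.
have [_ hc _] := hA; move=> /fg_len[a ha].
pose ann M (I : A^o -> Prop) (y : M) := forall u, I u -> (u : A) *: y = 0.
pose G (I : A^o -> Prop) := exists b, forall M (i : {linear S -> M}), essential i ->
  forall V : nat -> M -> Prop, (forall j, kclosed phi (V j)) ->
    (forall j x, V j x -> V j.+1 x) -> (forall j y, ann M I y -> V j y) ->
    forall m, (\sum_(j < m) `[< exists2 x, V j.+1 x & ~ V j x >] <= b)%N.
suff [b hb] : G (fun=> True).
  exists b => M i ess V cV iV m; apply: (hb M i ess) => // j y h.
  by have := h 1 I; rewrite scale1r => ->; case: (cV j).
apply: cover_ind.
- move=> I J IJ [b hb]; exists b => M i ess V cV iV VI m; apply: (hb M i ess) => // j y h.
  by apply: VI => u /IJ; apply: h.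
- exists 0%N => M i ess V cV iV VI m; rewrite big1 // => j _.
  by case: asboolP => // -[x _ []]; apply: VI => u ->; rewrite scale0r.
move=> I U sI [sU IU [x0 Ux0 nIx0] Umin] [b hb]; exists (a + b)%N => M i ess V cV iV VU m.
have [iI _] := ess.
have annI_closed : kclosed phi (ann M I).
  split=> [u _|x y hx hy u Iu|c x hx u Iu]; first by rewrite scaler0.
    by rewrite scalerBr hx // hy // subrr.
  by rewrite scalerA -hc -scalerA hx // scaler0.
pose P (j : nat) (s : S) := exists y : M, [/\ V j y, ann M I y & (x0 : A) *: y = i s].
have hP : (\sum_(j < m) `[< exists2 s, P j.+1 s & ~ P j s >] <= a)%N.
  apply: ha => [j|j s [y [Vy Iy yE]]]; last by exists y; split=> //; apply: iV.
  have [V0 VB VZ] := cV j; have [a0 aB aZ] := annI_closed.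
  split=> [|s t [y [Vy Iy yE]] [z [Vz Iz zE]]|c s [y [Vy Iy yE]]].
  - by exists 0; rewrite scaler0 linear0.
  - by exists (y - z); rewrite scalerBr linearB yE zE; split; [apply: VB|apply: aB|].
  - exists (phi c *: y); split; [exact: VZ|exact: aZ|].
    rewrite linearZZ -yE !scalerA; exact: (congr1 (fun t => t *: y) (esym (hc c x0))).
have hS := hb M i ess (fun j y => exists u v, [/\ V j u, ann M I v & y = u + v]) _ _ _ m.
apply: leq_trans (leq_add hP (hS _ _ _)); last first.
- by move=> j y Iy; exists 0, y; rewrite add0r; split=> //; case: (cV j).
- by move=> j y [u [v [Vu Iv ->]]]; exists u, v; split=> //; apply: iV.
- move=> j; have [V0 VB VZ] := cV j; have [a0 aB aZ] := annI_closed; split.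
  + by exists 0, 0; rewrite addr0.
  + move=> _ _ [u [v [Vu Iv ->]]] [u' [v' [Vu' Iv' ->]]]; exists (u - u'), (v - v').
    by split; [apply: VB|apply: aB|rewrite opprD addrACA].
  + move=> c _ [u [v [Vu Iv ->]]]; exists (phi c *: u), (phi c *: v).
    by rewrite scalerDr; split; [apply: VZ|apply: aZ|].
rewrite -big_split /=; apply: leq_sum => j _.
case: asboolP => // -[x Vx nVx].
case: (asboolP (exists2 s, P j.+1 s & ~ P j s)) => // nP.
case: asboolP => // -[]; exists x.
  by exists x, 0; rewrite addr0; split=> //; case: annI_closed.
move=> [u [v [Vu Iv xE]]]; apply: nVx.
have vV : V j.+1 v.
  have [_ VB _] := cV j.+1; have -> : v = x - u by rewrite xE addrC addKr.
  by apply: VB => //; apply: iV.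
(* [I] kills [v] and [U] covers [I], so [U v] is zero or simple; by essentiality it meets the image
   of [S] and hence lies in it. *)
have [s sE] : exists s, (x0 : A) *: v = i s.
  have [z|nz] := pselect ((x0 : A) *: v = 0); first by exists 0; rewrite linear0.
  have sV0 : submod (fun y : M => exists u : A^o, U u /\ y = (u : A) *: v).
    split; first by exists 0; rewrite scale0r; split=> //; apply: submod0.
    move=> c _ _ [w [Uw ->]] [w' [Uw' ->]]; exists (c *: w + w'); split; first exact: submodP.
    by rewrite scalerDl scalerA.
  have [|s s0 [w [Uw wE]]] := essential_meet ess sV0 _ nz; first by exists x0.
  have sT : submod (fun u : A^o => U u /\ exists s, (u : A) *: v = i s).
    split; first by split; [apply: submod0|exists 0; rewrite scale0r linear0].
    move=> c y y' [Uy [t tE]] [Uy' [t' t'E]]; split; first exact: submodP.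
    by exists (c *: t + t'); rewrite scalerDl linearP -tE -t'E scalerA.
  have [|||_ //] := Umin _ sT _ _ _ x0 Ux0.
  - by move=> y Iy; split; [apply: IU|exists 0; rewrite linear0; apply: Iv].
  - by move=> y [].
  - exists w; first by split=> //; exists s.
    by move=> Iw; apply: s0; apply: (linj0 iI); rewrite wE Iv.
have [y [Vy Iy yE]] : P j s.
  by apply: contrapT => nPs; apply: nP; exists s => //; exists v.
have vy : V j (v - y).
  apply: VU => w Uw; have [_ aB _] := annI_closed.
  have sT : submod (fun u : A^o => U u /\ (u : A) *: (v - y) = 0).
    split; first by split; [apply: submod0|rewrite scale0r].
    move=> c z z' [Uz zE] [Uz' z'E]; split; first exact: submodP.
    by rewrite scalerDl z'E addr0 -[c *: z]/(c * z) -scalerA zE scaler0.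
  have [|||_ //] := Umin _ sT _ _ _ w Uw.
  - by move=> z Iz; split; [apply: IU|apply: aB].
  - by move=> z [].
  - by exists x0 => //; split=> //; rewrite scalerBr sE yE subrr.
have Vv : V j v by rewrite -[v](subrK y); apply: kclosedD (cV j) _ _.
by rewrite xE; apply: kclosedD (cV j) _ _.
Qed.

(** Since [essential_len] bounds the essential extensions of [S], one of them, [M], has no proper
    essential extension compatible with [S]. An extension [N] of a finitely generated module by [M]
    splits: dividing [N] by a submodule maximal for meeting [M] in zero gives an essential
    extension, hence [M] itself. *)
Lemma enough_injectives S : finitely_generated S ->
  exists E (i : {linear S -> E}), [/\ finitely_generated E, injective i & fg_injective E].
Proof.
move=> fS; have [b hb] := essential_len fS.
have [M [i [ess Mmax]]] : exists M (i : {linear S -> M}), essential i /\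
    forall M' (j : {linear M -> M'}), injective j -> essential (lcomp j i) -> surjective j.
  apply: contrapT => H.
  have [M [i [ess hM]]] : exists M (i : {linear S -> M}), essential i /\
      forall n, len_le phi M n -> (b < n)%N.
    elim: b.+1 => [|d [M [i [ess hM]]]].
      exists S, (lid S); split=> //; split=> // Q p pI x y; exact: pI.
    apply: contrapT => H'; apply: H; exists M, i; split=> // M' j jI ess'.
    apply: contrapT => nj; apply: H'; exists M', (lcomp j i); split=> // n hn.
    have [n0 hn'] := len_proper jI nj hn.
    by have := hM _ hn'; rewrite -ltnS prednK.
  by have := hM b (hb M i ess); rewrite ltnn.
exists M, i; have [iI essi] := ess; split=> //; first exact: len_fg (hb M i ess).
have fM : finitely_generated M := len_fg (hb M i ess).
have split_all W (fW : finitely_generated W) N (j : {linear M -> N}) (q : {linear N -> W}) :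
    ses j q -> exists r : {linear N -> M}, cancel j r.
  move=> [jI qS ex]; have [n hn] := fg_len (fg_ext qS ex fM fW).
  have [||V [[sV VM] Vmax]] := len_max hn (P := fun V => submod V /\ forall m, V (j m) -> m = 0)
      (W0 := fun x => x = 0).
  - by move=> V [sV _]; apply: submod_kclosed.
  - split=> [|m]; last exact: linj0.
    by split=> // a x y -> ->; rewrite scaler0 addr0.
  have [Q [p [pS pE]]] := quot_exists sV.
  have pjI : injective (lcomp p j) by apply: lker0_inj => m /= /pE; apply: VM.
  have ess' : essential (lcomp (lcomp p j) i).
    split=> [x y /pjI /iI//|Q' p' p'I].
    have {}p'I : injective (lcomp p' (lcomp p j)) by apply: essi => x y; apply: p'I.
    apply: lker0_inj => x; have [y <-] := pS x => p'y; apply/pE.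
    apply: (Vmax (fun z => p' (p z) = 0)) => //.
      split; first exact: (ker_submod (lcomp p' p)).
      by move=> m /= h; apply: (linj0 p'I).
    by move=> z /pE /= ->; rewrite linear0.
  have pjS := Mmax Q (lcomp p j) pjI ess'.
  have [g [gK Kg]] := bij_inv pjI pjS.
  by exists (lcomp g p) => m; apply: gK.
move=> W fW B C j q hs f.
have [Q [j' [q' [h [hs' hE _ _]]]]] := pushout_ses f hs.
have [r rK] := split_all W fW Q j' q' hs'.
by exists (lcomp r h) => x; rewrite /= hE rK.
Qed.

Lemma fg_injective_prod E E' : fg_injective E -> fg_injective E' -> fg_injective (E * E')%type.
Proof. by move=> h h' W fW; apply: ext1_prodr; [apply: h|apply: h']. Qed.

Lemma fg_injective_extend E X Y (i : {linear X -> Y}) (f : {linear X -> E}) :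
  fg_injective E -> finitely_generated Y -> injective i ->
  exists g : {linear Y -> E}, forall x, g (i x) = f x.
Proof.
move=> hE fY iI; have [C [p hs]] := coker_ses iI; have [_ pS _] := hs.
by apply: hE hs f; apply: fg_surj pS fY.
Qed.

(** The injective module gains one factor for each composition factor [U / I] of [A]. If [I] kills
    [y] and some [u] in [U] does not, then [U / I] embeds in [M] by [u |-> u y], and its embedding
    in an injective extends to [M]. *)
Lemma injective_separator : exists E, [/\ finitely_generated E, fg_injective E &
  forall M, finitely_generated M -> forall y : M, y <> 0 -> exists h : {linear M -> E}, h y <> 0].
Proof.
pose G (I : A^o -> Prop) := exists E, [/\ finitely_generated E, fg_injective E &
  forall M, finitely_generated M -> forall y : M, (exists2 u, I u & (u : A) *: y <> 0) ->
  exists h : {linear M -> E}, h y <> 0].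
suff [E [fE iE hE]] : G (fun=> True).
  by exists E; split=> // M fM y y0; apply: hE => //; exists 1; rewrite ?scale1r.
apply: cover_ind.
- move=> I J IJ [E [fE iE hE]]; exists E; split=> // M fM y [u Iu uy]; apply: hE => //.
  by exists u => //; apply/IJ.
- have [E [_ [fE _ iE]]] := enough_injectives (fg_free A 0).
  by exists E; split=> // M fM y [u -> []]; rewrite scale0r.
move=> I U sI [sU IU [x0 Ux0 nIx0] Umin] [E [fE iE hE]].
have [L [i [iI iE']]] := sub_exists sU.
have fL : finitely_generated L := artin_noetherian (fg_regular A) iI.
have [S [p [pS pE]]] := quot_exists (preim_submod i sI).
have fS : finitely_generated S := fg_surj pS fL.
have [E' [e [fE' eI iE'']]] := enough_injectives fS.
exists (E * E')%type; split; [exact: fg_prod|exact: fg_injective_prod|].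
move=> M fM y [u Uu uy].
have [[w Iw wy]|nI] := pselect (exists2 w, I w & (w : A) *: y <> 0).
  have [h hy] := hE M fM y (ex_intro2 _ _ w Iw wy).
  by exists (lcomp (linl E E') h) => -[].
have Iy w : I w -> (w : A) *: y = 0.
  by move=> Iw; apply: contrapT => wy; apply: nI; exists w.
have nIu : ~ I u by move=> /Iy.
have [m mE] : exists m : {linear S -> M}, forall l, m (p l) = lcomp (lmulr y) i l.
  by apply: factor_surj => // l /pE /Iy.
have mI : injective m.
  apply: lker0_inj => s; have [l <-] := pS s; rewrite mE /= => ly; apply/pE.
  apply: contrapT => nIl; apply: uy.
  have sT : submod (fun u : A^o => U u /\ (u : A) *: y = 0).
    split; first by split; [apply: submod0|rewrite scale0r].
    move=> c z z' [Uz zE] [Uz' z'E]; split; first exact: submodP.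
    by rewrite scalerDl z'E addr0 -[c *: z]/(c * z) -scalerA zE scaler0.
  have Ul : U (i l) by apply/iE'; exists l.
  have [|||_ //] := Umin _ sT _ _ _ u Uu.
  - by move=> z Iz; split; [apply: IU|apply: Iy].
  - by move=> z [].
  - by exists (i l).
have [h hm] := fg_injective_extend e iE'' fM mI.
exists (lcomp (linr E E') h) => -[hy].
have /iE'[l lE] := Uu; apply: nIu; rewrite -lE; apply/pE.
apply: (linj0 eI); rewrite -hm mE /= lE linearZZ hy scaler0 //.
Qed.

(** A minimal kernel among the maps from [M] to powers of [E] is zero, since one more map would
    separate a nonzero element of it from zero. *)
Lemma injective_cogenerator : exists E, [/\ finitely_generated E, fg_injective E &
  forall M, finitely_generated M -> exists n (u : {linear M -> {ffun 'I_n -> E}}), injective u].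
Proof.
have [E [fE iE hE]] := injective_separator; exists E; split=> // M fM.
have [n hn] := fg_len fM.
have [||V [[m [u uE]] Vmin]] := len_min hn (P := fun V => exists m (u : {linear M -> {ffun 'I_m -> E}}),
   forall x, V x <-> u x = 0) (W0 := fun x => lzero M (free A 0) x = 0).
- move=> W [m [u uE]]; rewrite (_ : W = fun x => u x = 0); last by apply/funext=> x; apply/propext.
  exact/submod_kclosed/ker_submod.
- have z (w : {ffun 'I_0 -> E}) : w = 0 by apply/ffunP=> -[].
  by exists 0%N, (lcol (fun i : 'I_0 => lzero M E)) => x; split=> _ //; apply: z.
exists m, u; apply: lker0_inj => x ux; apply: contrapT => x0.
have [h hx] := hE M fM x x0.
have /uE Vx := ux; apply: hx.
pose v : {linear M -> {ffun 'I_m.+1 -> E}} :=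
  lcol (fun i => if unlift ord0 i is Some j then lcomp (lproj E j) u else h).
have vE y : v y = 0 -> h y = 0 /\ u y = 0.
  move=> /ffunP vy; split; first by have := vy ord0; rewrite !ffunE unlift_none.
  by apply/ffunP=> j; have := vy (lift ord0 j); rewrite !ffunE liftK.
have [|//] := vE x; apply: (Vmin (fun y => v y = 0)) => //; first by exists m.+1, v.
by move=> y /vE[_ /uE].
Qed.

End ArtinModules.

(** * Approximations *)

Section Approximations.
Variables (k : comPzRingType) (A : pzRingType) (phi : {rmorphism k -> A}).
Hypothesis hA : artin_over phi.
Let noeth : noetherian_ring A := artin_noetherian hA.
Implicit Types B C D E L M N Q T W X Y Z : lmodType A.

Definition fp_approx X M (f : {linear X -> M}) := fp X /\
  forall Y (g : {linear Y -> M}), fp Y -> exists h : {linear Y -> X}, forall y, g y = f (h y).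

Lemma ctfP : fin_pdim_contravariantly_finite A <->
  forall M, finitely_generated M -> exists X (f : {linear X -> M}), fp_approx f.
Proof.
split=> h M fM; have [X [f [hX hf]]] := h M fM; exists X, f; split.
- exact/fin_pdimP.
- by move=> Y g hY; apply: hf; apply/fin_pdimP.
- exact/fin_pdimP.
- by move=> Y g /fin_pdimP hY; apply: hf.
Qed.

(** The right lifting property of [f] against monomorphisms with cokernel in P^{<oo}. It contains
    the vanishing Ext^1(P^{<oo}, Ker f) = 0 of Wakamatsu's lemma and applies directly to maps into
    pullbacks. *)
Definition fp_lifting X M (f : {linear X -> M}) :=
  forall B C D (i : {linear B -> C}) (q : {linear C -> D}), ses i q -> fp D ->
  forall (h : {linear B -> X}) (u : {linear C -> M}), (forall b, u (i b) = f (h b)) ->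
  exists r : {linear C -> X}, (forall b, r (i b) = h b) /\ forall c, f (r c) = u c.

(* Wakamatsu's lemma: an approximation of minimal length is right minimal, and then
   the pushout of B -> C along B -> X splits off X. *)
Lemma lifting_approx M X (f : {linear X -> M}) : fp_approx f ->
  exists X' (f' : {linear X' -> M}), fp_approx f' /\ fp_lifting f'.
Proof.
move=> hf; have [n hn] := fg_len hA (proj1 (proj1 hf)).
elim/ltn_ind: n X f hf hn => n IH X f hf hn; have [hX fX] := hf.
(* If [f g = f] with [g] not bijective, the image of a power of [g] is a shorter summand on which
   [f] still restricts to an approximation. *)
have [[g [fg ng]]|H] := pselect (exists g : {linear X -> X}, (forall x, f (g x) = f x) /\ ~ bijective g).
  have [Y [q [j [b [jI jS jq bK]]]]] := noniso_summand hn ng.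
  have [n0 hY] := len_proper jI jS hn.
  apply: (IH n.-1 _ Y (lcomp f j)) hY; first by rewrite prednK.
  split; first by apply: fp_summand hX; exists j, (lcomp b q).
  move=> W h hW; have [u uE] := fX W h hW; exists (lcomp q u) => w.
  rewrite uE /= jq -lpowE; elim: (n.+1) => //= m ->; by rewrite fg.
exists X, f; split=> // B C D i q hs hD h u uE.
have [Q [j [p [v [hs' E1 E2 U]]]]] := pushout_ses h hs.
have [t [tj tv]] := U M f u (fun b => esym (uE b)).
have [r0 r0E] := fX Q t (fp_ext hs' hX hD).
have [|c [cK Kc]] := @bij_linear _ _ _ (lcomp r0 j).
  apply: contrapT => nb; apply: H; exists (lcomp r0 j); split=> // x.
  by rewrite /= -r0E tj.
have fc x : f (c x) = f x.
  by rewrite -[in RHS](Kc x) /= -r0E tj.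
exists (lcomp c (lcomp r0 v)); split=> [b|x].
  by rewrite /= E1; apply: cK.
by rewrite /= fc -r0E tv.
Qed.

Lemma approx_surj X M (f : {linear X -> M}) : fp_approx f -> surjective f.
Proof.
move=> [_ hf] m; have [h hE] := hf _ (lrow (fun _ : 'I_1 => m)) (fp_free A 1).
exists (h [ffun => 1]); rewrite -hE /= big_ord1 ffunE scale1r //.
Qed.

(** A map from [W] to [M] extends to a power of [T], because the cokernel of [W -> T^n] is in
    P^{<oo}. Maps from [T] to [M] are [k]-combinations of finitely many, so one power of [T] serves
    for all [W]. *)
Lemma rel_injective_approx T M : strong_tilt T -> finitely_generated M -> rel_injective M ->
  exists X (f : {linear X -> M}), fp_approx f.
Proof.
move=> hT fM iM; have [fT _ _ _] := hT.
have [m [h hE]] := hom_kfg hA (proj1 fT) fM.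
exists {ffun 'I_m -> T}, (lsum (fun i => lcomp (h i) (lproj T i))); split.
  by apply: fp_add fT; apply: add_of_ffun; apply: add_of_refl.
move=> W g hW; have [n [W' [i [p [hs hW']]]]] := strong_tilt_embed hT hW.
have [u uE] := iM _ hW' _ _ _ _ hs g.
pose d (j : 'I_n) : {linear T -> {ffun 'I_n -> T}} :=
  lcol (fun l => if l == j then lid T else lzero T T).
have dE (x : {ffun 'I_n -> T}) : x = \sum_j d j (x j).
  apply/ffunP=> l; rewrite sum_ffunE (bigD1 l) //= big1 => [|j /negPf jl].
    by rewrite ffunE eqxx addr0.
  by rewrite ffunE eq_sym jl.
have /choice[c cE] : forall j, exists c : 'I_m -> k, forall x, u (d j x) = \sum_i phi (c i) *: h i x.
  by move=> j; apply: (hE (lcomp u (d j))).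
exists (lcomp (lcol (fun i => lsum (fun j => lcomp (lscale hA T (c j i)) (lproj T j)))) i) => w.
rewrite -uE [in LHS](dE (i w)) linear_sum /=.
under eq_bigr do rewrite cE.
rewrite exchange_big /=; apply: eq_bigr => l _; rewrite ffunE /= linear_sum.
by apply: eq_bigr => j _; rewrite linearZZ.
Qed.

(** Backward induction along an injective coresolution. [N1] is a cosyzygy of [N] in [E] and
    [X1 -> N1] an approximation with the lifting property. The pullback [Q] of [E] and [X1] over
    [N1] is then relatively injective and has an approximation [TQ]; the kernel of [TQ -> X1]
    approximates [N]. *)
Lemma strong_tilt_approx T M : strong_tilt T -> finitely_generated M ->
  exists X (f : {linear X -> M}), fp_approx f.
Proof.
move=> hT; have [fT iT _ [d hd]] := hT.
suff H k' j N : (j + k')%N = d -> finitely_generated N -> pdl_injective j N ->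
    exists X (f : {linear X -> N}), fp_approx f.
  by move=> fM; apply: (H d 0%N) => //; apply: pdl_injective0.
elim: k' j N => [|k' IH] j N jk fN iN.
  apply: (rel_injective_approx hT fN) => W hW; apply: iN => //.
  by rewrite -[j]addn0 jk; apply: hd.
have [E [i [fE iI iE]]] := enough_injectives hA fN.
have rE : rel_injective E by move=> W [fW _]; apply: iE.
have [N1 [p hs]] := coker_ses iI; have [_ pS ep] := hs.
have [|||X1 [f1 hf1]] := IH j.+1 N1.
- by rewrite addSnnS.
- exact: fg_surj pS fE.
- exact: cosyz_pdl_injective hs rE iN.
have {X1 f1 hf1} [X1 [f1 [hf1 lf1]]] := lifting_approx hf1; have [hX1 _] := hf1.
have [Q [q1 [q2 [Q1 Q2 Q3 U]]]] := pullback p f1.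
have fQ : finitely_generated Q.
  apply: (noeth (fg_prod (proj1 hX1) fE) (i := lpair q1 q2)).
  by apply: lker0_inj => x [x1 x2]; apply: Q3.
(* A map to [Q] is a compatible pair of maps to [E] and [X1]. The former extends because [E] is
   injective, and the lifting property extends the latter compatibly. *)
have iQ : rel_injective Q.
  move=> W hW B C b c hs' h.
  have [u uE] := rE W hW _ _ _ _ hs' (lcomp q2 h).
  have [|r [rb rc]] := lf1 _ _ _ _ _ hs' hW (lcomp q1 h) (lcomp p u).
    by move=> x; rewrite /= uE /= Q1.
  have [v [v1 v2]] := U C r u rc.
  exists v => x; apply/eqP; rewrite -subr_eq0; apply/eqP/Q3.
    by rewrite linearB v1 rb /= subrr.
  by rewrite linearB v2 uE /= subrr.
have [TQ [t ht]] := rel_injective_approx hT fQ iQ; have [hTQ _] := ht.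
have tS : surjective (lcomp q1 t).
  move=> x; have [e eE] := pS (f1 x); have [y [y1 _]] := Q2 _ _ eE.
  by have [z zE] := approx_surj ht y; exists z; rewrite /= zE.
have [X [s hs']] := ker_ses tS; have [sI _ es] := hs'.
have [m mE] : exists m : {linear X -> N}, forall x, i (m x) = lcomp (lcomp q2 t) s x.
  apply: factor_inj => // x; apply/ep; rewrite /= Q1.
  by rewrite -[q1 _]/(lcomp q1 t (s x)) (exact_comp0 _ es) linear0.
exists X, m; split; first exact: (fp_ker noeth hs').
move=> W g hW.
have [|v [v1 v2]] := U W (lzero _ _) (lcomp i g).
  by move=> x; rewrite /= linear0 (exact_comp0 _ ep).
have [w wE] := (proj2 ht) W v hW.
have [w' w'E] : exists w' : {linear W -> X}, forall x, s (w' x) = w x.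
  by apply: factor_inj => // x; apply/es; rewrite /= -wE v1.
by exists w' => x; apply: iI; rewrite mE /= w'E -wE v2.
Qed.

(** An approximation [X -> E] of an injective cogenerator, with the lifting property, is relatively
    injective: a map to [X] extends after composition to [E], and the extension lifts. It
    cogenerates P^{<oo} because embeddings in powers of [E] factor through it. *)
Lemma ctf_strong_tilt d : (forall M, finitely_generated M -> exists X (f : {linear X -> M}), fp_approx f) ->
  (forall X, fp X -> pdl d X) -> exists T, strong_tilt T.
Proof.
move=> hctf hd; have [E [fE iE cE]] := injective_cogenerator hA.
have [X0 [f0 hf0]] := hctf E fE.
have [X [f [[hX hf] lf]]] := lifting_approx hf0.
exists X; split=> //; last by exists d.
  move=> W hW B C i p hs h.
  have [u uE] := iE W (proj1 hW) _ _ _ _ hs (lcomp f h).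
  by have [r [rE _]] := lf _ _ _ _ _ hs hW h u uE; exists r.
move=> W hW; have [n [u uI]] := cE W (proj1 hW).
have /choice[v vE] : forall j : 'I_n, exists v : {linear W -> X}, forall w, u w j = f (v w).
  by move=> j; apply: (hf W (lcomp (lproj E j) u)).
exists n, (lcol v); apply: lker0_inj => w /ffunP vw; apply: (linj0 uI).
by apply/ffunP=> j; rewrite vE; have := vw j; rewrite !ffunE => ->; rewrite linear0.
Qed.

End Approximations.

(** * Corners *)

(* Identifies S with the corner e A e for e = iota 1.  The notion passes to the
   converse rings, so that right modules need no separate treatment. *)
Definition corner_embedding (S A : pzRingType) (iota : S -> A) :=
  [/\ forall x y, iota (x + y) = iota x + iota y,
      forall x y, iota (x * y) = iota x * iota y,
      injective iota
    & forall a, iota 1 * a * iota 1 = a -> exists s, iota s = a].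

Section CornerFunctors.
Variables (S A : pzRingType) (iota : S -> A).
Hypothesis hi : corner_embedding iota.
Local Notation e := (iota 1).
Implicit Types X Y Z : lmodType A.
Implicit Types M N : lmodType S.

Lemma iotaD x y : iota (x + y) = iota x + iota y. Proof. by case: hi. Qed.
Lemma iotaM x y : iota (x * y) = iota x * iota y. Proof. by case: hi. Qed.
Lemma iota_inj : injective iota. Proof. by case: hi. Qed.
Lemma iota1l s : e * iota s = iota s. Proof. by rewrite -iotaM mul1r. Qed.
Lemma iota1r s : iota s * e = iota s. Proof. by rewrite -iotaM mulr1. Qed.
Lemma iota11 : e * e = e. Proof. exact: iota1l. Qed.

(** The proof [h] is a parameter of the type because the [S]-module structure declared on it depends
    on it. *)
Record ep_of (h : corner_embedding iota) X :=
  Ep { ep_val : X; _ : e *: ep_val == ep_val }.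
Definition ep := ep_of hi.
Section EpInst.
Variable X : lmodType A.
HB.instance Definition _ := [isSub for @ep_val hi X].
HB.instance Definition _ := [Choice of ep_of hi X by <:].
Fact ep_zmod_closed : zmod_closed [pred x : X | e *: x == x].
Proof.
split=> [|x y]; rewrite !inE ?scaler0 // => /eqP hx /eqP hy.
by rewrite scalerBr hx hy.
Qed.
HB.instance Definition _ := GRing.SubChoice_isSubZmodule.Build X _ (ep_of hi X) ep_zmod_closed.

Fact ep_scale_subproof s (x : ep_of hi X) : e *: (iota s *: ep_val x) == iota s *: ep_val x.
Proof. by rewrite scalerA iota1l. Qed.
Definition ep_scale s x : ep_of hi X := Ep hi (ep_scale_subproof s x).
Fact ep_scaleA a b x : ep_scale a (ep_scale b x) = ep_scale (a * b) x.
Proof. by apply: val_inj; rewrite /= scalerA iotaM. Qed.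
Fact ep_scale1 : left_id 1 ep_scale.
Proof. by move=> [x hx]; apply: val_inj; apply/eqP. Qed.
Fact ep_scaleDr : right_distributive ep_scale +%R.
Proof. by move=> a x y; apply: val_inj; rewrite /= scalerDr. Qed.
Fact ep_scaleDl x : {morph ep_scale^~ x : a b / a + b}.
Proof. by move=> a b; apply: val_inj; rewrite /= iotaD scalerDl. Qed.
HB.instance Definition _ := GRing.Zmodule_isLmodule.Build S (ep_of hi X)
  ep_scaleA ep_scale1 ep_scaleDr ep_scaleDl.
End EpInst.

Definition epart X : lmodType S := ep_of hi X.
Definition epv X (x : epart X) : X := ep_val x.

Lemma epv_inj X : injective (@epv X). Proof. exact: val_inj. Qed.
Lemma epvP X (x : epart X) : e *: epv x = epv x. Proof. by case: x => x /= /eqP. Qed.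
Lemma epvD X (x y : epart X) : epv (x + y) = epv x + epv y. Proof. by []. Qed.
Lemma epvB X (x y : epart X) : epv (x - y) = epv x - epv y. Proof. by []. Qed.
Lemma epv0 X : epv (0 : epart X) = 0. Proof. by []. Qed.
Lemma epvZ X s (x : epart X) : epv (s *: x) = iota s *: epv x. Proof. by []. Qed.
Lemma epv_sum X (I : finType) (F : I -> epart X) : epv (\sum_i F i) = \sum_i epv (F i).
Proof. exact: (big_morph _ (@epvD X) (@epv0 X)). Qed.

Fact epc_subproof X (x : X) : e *: (e *: x) == e *: x.
Proof. by rewrite scalerA iota11. Qed.
Definition epc X (x : X) : epart X := Ep hi (epc_subproof x).
Lemma epcE X (x : X) : epv (epc x) = e *: x. Proof. by []. Qed.
Lemma epc_id X (x : epart X) : epc (epv x) = x.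
Proof. by apply: epv_inj; rewrite epcE epvP. Qed.

Fact emap_linear X Y (f : {linear X -> Y}) : linear (fun x : epart X => epc (f (epv x)) : epart Y).
Proof.
move=> s x y; apply: epv_inj; rewrite epvD epvZ !epcE epvD epvZ linearP scalerDr.
by rewrite !scalerA iota1l iota1r.
Qed.
Definition emap X Y (f : {linear X -> Y}) := lin_of (emap_linear f).
Lemma emapE X Y (f : {linear X -> Y}) x : epv (emap f x) = f (epv x).
Proof. by rewrite epcE -linearZZ epvP. Qed.

Lemma emap_ses X Y Z (i : {linear X -> Y}) (p : {linear Y -> Z}) :
  ses i p -> ses (emap i) (emap p).
Proof.
move=> [iI pS ex]; split=> [x y E|z|y].
- by apply: epv_inj; apply: iI; rewrite -!emapE E.
- have [y yE] := pS (epv z); exists (epc y).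
  by apply: epv_inj; rewrite emapE epcE linearZZ yE epvP.
split=> [E|[x <-]].
  have /ex[x xE] : p (epv y) = 0 by rewrite -emapE E.
  exists (epc x); apply: epv_inj; rewrite emapE epcE linearZZ xE epvP //.
by apply: epv_inj; rewrite !emapE (exact_comp0 _ ex).
Qed.

Lemma emap_summand X Y : direct_summand X Y -> direct_summand (epart X) (epart Y).
Proof.
by move=> [s [p sK]]; exists (emap s), (emap p) => x; apply: epv_inj; rewrite !emapE sK.
Qed.

Lemma emap_ffun X n : direct_summand (epart {ffun 'I_n -> X}) {ffun 'I_n -> epart X}.
Proof.
exists (lcol (fun i => emap (lproj X i))).
have lin : linear (fun x : {ffun 'I_n -> epart X} => epc [ffun i => epv (x i)]).
  move=> s x y; apply: epv_inj; rewrite epvD epvZ !epcE; apply/ffunP=> i.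
  by rewrite !ffunE epvD epvZ scalerDr !scalerA iota1l iota1r.
exists (lin_of lin) => x; apply: epv_inj; rewrite epcE; apply/ffunP=> i.
by rewrite !ffunE /= -[in RHS]epvP ffunE !scalerA iota11.
Qed.

Lemma emap_prod X Y : direct_summand (epart (X * Y)%type) (epart X * epart Y)%type.
Proof.
exists (lpair (emap (lfst X Y)) (emap (lsnd X Y))).
have lin : linear (fun x : (epart X * epart Y)%type => epc (epv x.1, epv x.2)).
  move=> s x y; apply: epv_inj; rewrite epvD epvZ !epcE; congr pair => /=.
    by rewrite scalerDr !scalerA iota1l iota1r.
  by rewrite scalerDr !scalerA iota1l iota1r.
exists (lin_of lin) => x; apply: epv_inj; rewrite epcE -[RHS]epvP /=.
by congr pair; rewrite /= scalerA iota11.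
Qed.

(** Taking [s = 1] in [gm_Z] shows that such a map depends only on [e a]; so these are the
    [S]-linear maps on [e A], written without forming that module. *)
Record gm_of (h : corner_embedding iota) M := Gm {
  gm_fun :> A -> M;
  gm_D : forall a b, gm_fun (a + b) = gm_fun a + gm_fun b;
  gm_Z : forall s a, gm_fun (iota s * a) = s *: gm_fun a }.

Section GmInst.
Variable M : lmodType S.
Local Notation G := (gm_of hi M).

Lemma gm_eq (f g : G) : f =1 g -> f = g.
Proof.
case: f g => f f1 f2 [g g1 g2] /= fg; have E : f = g by apply/funext.
by subst g; congr Gm; apply: Prop_irrelevance.
Qed.

HB.instance Definition _ := gen_eqMixin G.
HB.instance Definition _ := gen_choiceMixin G.

Definition gm_zero : G.
Proof. by exists (fun=> 0) => *; rewrite ?addr0 ?scaler0. Defined.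
Definition gm_add (f g : G) : G.
Proof.
exists (fun a => f a + g a) => [a b|s a]; first by rewrite !gm_D addrACA.
by rewrite !gm_Z scalerDr.
Defined.
Definition gm_opp (f : G) : G.
Proof.
exists (fun a => - f a) => [a b|s a]; first by rewrite !gm_D opprD.
by rewrite !gm_Z scalerN.
Defined.
Fact gm_addA : associative gm_add.
Proof. by move=> f g h; apply: gm_eq => a; apply: addrA. Qed.
Fact gm_addC : commutative gm_add.
Proof. by move=> f g; apply: gm_eq => a; apply: addrC. Qed.
Fact gm_add0 : left_id gm_zero gm_add.
Proof. by move=> f; apply: gm_eq => a; apply: add0r. Qed.
Fact gm_addN : left_inverse gm_zero gm_opp gm_add.
Proof. by move=> f; apply: gm_eq => a; apply: addNr. Qed.
HB.instance Definition _ := GRing.isZmodule.Build G gm_addA gm_addC gm_add0 gm_addN.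

Definition gm_scale (b : A) (f : G) : G.
Proof.
exists (fun a => f (a * b)) => [a c|s a]; first by rewrite mulrDl gm_D.
by rewrite -mulrA gm_Z.
Defined.
Fact gm_scaleA a b f : gm_scale a (gm_scale b f) = gm_scale (a * b) f.
Proof. by apply: gm_eq => c; rewrite /= mulrA. Qed.
Fact gm_scale1 : left_id 1 gm_scale.
Proof. by move=> f; apply: gm_eq => c; rewrite /= mulr1. Qed.
Fact gm_scaleDr : right_distributive gm_scale +%R.
Proof. by move=> b f g; apply: gm_eq. Qed.
Fact gm_scaleDl f : {morph gm_scale^~ f : a b / a + b}.
Proof. by move=> a b; apply: gm_eq => c; rewrite /= mulrDr gm_D. Qed.
HB.instance Definition _ := GRing.Zmodule_isLmodule.Build A G
  gm_scaleA gm_scale1 gm_scaleDr gm_scaleDl.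
End GmInst.

(* Hom_S(e A, M), the right adjoint of X |-> e X. *)
Definition gmod M : lmodType A := gm_of hi M.
Definition gmv M (f : gmod M) (a : A) : M := gm_fun f a.

Lemma gmv_inj M (f g : gmod M) : gmv f =1 gmv g -> f = g. Proof. exact: gm_eq. Qed.
Lemma gmvD M (f g : gmod M) a : gmv (f + g) a = gmv f a + gmv g a. Proof. by []. Qed.
Lemma gmvZ M b (f : gmod M) a : gmv (b *: f) a = gmv f (a * b). Proof. by []. Qed.
Lemma gmv0 M a : gmv (0 : gmod M) a = 0. Proof. by []. Qed.
Lemma gmv_iota M (f : gmod M) s a : gmv f (iota s * a) = s *: gmv f a. Proof. exact: gm_Z. Qed.
Lemma gmv_e M (f : gmod M) a : gmv f (e * a) = gmv f a. Proof. by rewrite gmv_iota scale1r. Qed.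
Lemma gmv_e1 M (f : gmod M) : gmv f e = gmv f 1. Proof. by rewrite -[X in gmv f X = _]mulr1 gmv_e. Qed.
Lemma gmv_add M (f : gmod M) a b : gmv f (a + b) = gmv f a + gmv f b. Proof. exact: gm_D. Qed.

Section Adjunction.
Variables (X : lmodType A) (M : lmodType S).

Section Transpose.
Variable g : {linear epart X -> M}.
Definition adj_fun (x : X) : gmod M.
Proof.
exists (fun a => g (epc (a *: x))) => [a b|s a].
  by rewrite -linearD; congr (g _); apply: epv_inj; rewrite epvD !epcE scalerDl scalerDr.
by rewrite -linearZZ; congr (g _); apply: epv_inj; rewrite epvZ !epcE !scalerA mulrA iota1l iota1r.
Defined.
Fact adj_linear : linear adj_fun.
Proof.
move=> b x y; apply: gmv_inj => a; rewrite gmvD gmvZ /= -linearD; congr (g _).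
by apply: epv_inj; rewrite epvD !epcE scalerDr scalerA scalerDr.
Qed.
Definition adj := lin_of adj_linear.
Lemma adjE x a : gmv (adj x) a = g (epc (a *: x)). Proof. by []. Qed.
Lemma adj_epv x : gmv (adj (epv x)) 1 = g x.
Proof. by rewrite adjE scale1r epc_id. Qed.
End Transpose.

Fact coadj_linear (f : {linear X -> gmod M}) : linear (fun x : epart X => gmv (f (epv x)) 1).
Proof.
move=> s x y; rewrite epvD epvZ linearP gmvD gmvZ mul1r; congr (_ + _).
by rewrite -[iota s]mulr1 gmv_iota.
Qed.
Definition coadj f := lin_of (coadj_linear f).
Lemma coadjE f x : coadj f x = gmv (f (epv x)) 1. Proof. by []. Qed.

Lemma gm_ext (f g : {linear X -> gmod M}) :
  (forall x : epart X, gmv (f (epv x)) 1 = gmv (g (epv x)) 1) -> forall x, f x = g x.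
Proof.
move=> fg x; apply: gmv_inj => a; have := fg (epc (a *: x)); rewrite epcE scalerA !linearZZ !gmvZ.
by rewrite mul1r !gmv_e.
Qed.

Lemma adj_coadj (f : {linear X -> gmod M}) x : adj (coadj f) x = f x.
Proof. by apply: gm_ext => {}x; rewrite adj_epv. Qed.

End Adjunction.

Fact counit_linear M : linear (fun x : epart (gmod M) => gmv (epv x) 1).
Proof. exact: (coadj_linear (lid (gmod M))). Qed.
Definition counit M := lin_of (@counit_linear M).

Lemma counitE M x : counit M x = gmv (epv x) 1. Proof. by []. Qed.

Lemma counit_inj M : injective (@counit M).
Proof.
apply: lker0_inj => x x1; apply: epv_inj; apply: gmv_inj => a.
rewrite epv0 gmv0 -epvP gmvZ -gmv_e mulrA.
have [s sE] : exists s, iota s = e * a * e.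
  by have [_ _ _] := hi; apply; rewrite !mulrA iota11 -!mulrA iota11.
by rewrite -sE -[iota s]mulr1 gmv_iota [gmv _ _]x1 scaler0.
Qed.

Lemma counit_surj M : surjective (@counit M).
Proof.
move=> m.
have /choice[s sE] : forall a, exists s, iota s = e * a * e.
  by move=> a; have [_ _ _] := hi; apply; rewrite !mulrA iota11 -!mulrA iota11.
have D a b : s (a + b) *: m = s a *: m + s b *: m.
  by rewrite -scalerDl; congr (_ *: m); apply: iota_inj; rewrite iotaD !sE mulrDr mulrDl.
have Z t a : s (iota t * a) *: m = t *: (s a *: m).
  rewrite scalerA; congr (_ *: m); apply: iota_inj.
  by rewrite iotaM !sE !mulrA iota1l iota1r.
(* The preimage of [m] comes from the map [a |-> (e a e) m]. *)
pose h : gmod M := Gm hi D Z.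
exists (epc h); rewrite -[LHS]/(gmv (epv (epc h)) 1) epcE gmvZ mul1r.
rewrite -[RHS]scale1r; congr (_ *: m); apply: iota_inj.
by rewrite sE !iota11.
Qed.

Fact gmap_subproof M N (f : {linear M -> N}) :
  exists g : {linear gmod M -> gmod N}, forall h a, gmv (g h) a = f (gmv h a).
Proof.
exists (adj (lcomp f (counit M))) => h a.
by rewrite adjE -[LHS]/(f (gmv (epv (epc (a *: h))) 1)) epcE scalerA gmvZ mul1r gmv_e.
Qed.
Definition gmap M N (f : {linear M -> N}) := sval (cid (gmap_subproof f)).
Lemma gmapE M N (f : {linear M -> N}) h a : gmv (gmap f h) a = f (gmv h a).
Proof. by rewrite /gmap; case: cid => g gE /=. Qed.

Lemma gmap_inj M N (f : {linear M -> N}) : injective f -> injective (gmap f).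
Proof.
move=> fI; apply: lker0_inj => h E; apply: gmv_inj => a; apply: fI.
by rewrite -gmapE E linear0.
Qed.

End CornerFunctors.

Section RingMorphism.
Variables (R R' : pzRingType) (f : R -> R').
Hypotheses (fD : forall x y, f (x + y) = f x + f y) (f1 : f 1 = 1).
Hypothesis fM : forall x y, f (x * y) = f x * f y.

Fact rmorph_of_zmod : zmod_morphism f.
Proof. by move=> x y; apply/eqP; rewrite eq_sym subr_eq -fD subrK. Qed.
Fact rmorph_of_monoid : monoid_morphism f. Proof. by split. Qed.
Definition rmorph_of : {rmorphism R -> R'} :=
  HB.pack f (GRing.isZmodMorphism.Build R R' f rmorph_of_zmod)
    (GRing.isMonoidMorphism.Build R R' f rmorph_of_monoid).
End RingMorphism.

(** * Finiteness over a corner of an Artin algebra *)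

Section ArtinCorner.
Variables (k : comPzRingType) (A S : pzRingType) (phi : {rmorphism k -> A}) (iota : S -> A).
Hypotheses (hA : artin_over phi) (hi : corner_embedding iota).
Local Notation e := (iota 1).
Local Notation ep := (epart hi).
Local Notation G := (gmod hi).

Lemma corner_scalars : exists phiS : {rmorphism k -> S}, forall c, iota (phiS c) = phi c * e.
Proof.
have [_ hc _] := hA.
have /choice[f fE] : forall c, exists s, iota s = phi c * e.
  move=> c; have [_ _ _] := hi; apply.
  by rewrite mulrA -hc -!mulrA !(iota11 hi).
have fD x y : f (x + y) = f x + f y.
  by apply: (iota_inj hi); rewrite (iotaD hi) !fE rmorphD mulrDl.
have f1 : f 1 = 1 by apply: (iota_inj hi); rewrite fE rmorph1 mul1r.
have fM x y : f (x * y) = f x * f y.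
  apply: (iota_inj hi); rewrite (iotaM hi) !fE rmorphM.
  by rewrite -!mulrA; congr (_ * _); rewrite mulrA -hc -mulrA (iota11 hi).
by exists (rmorph_of fD f1 fM).
Qed.

Section Scalars.
Variable phiS : {rmorphism k -> S}.
Hypothesis hphiS : forall c, iota (phiS c) = phi c * e.

Lemma epv_klinear X : klinear phiS phi (@epv _ _ _ hi X).
Proof.
split=> [x y|c x]; first exact: epvB.
by rewrite epvZ hphiS -scalerA epvP.
Qed.

Lemma corner_artin_over : artin_over phiS.
Proof.
have [hl hc hk] := hA; split=> //.
  move=> c a; apply: (iota_inj hi); rewrite !(iotaM hi) hphiS -mulrA (iota1l hi) hc.
  by rewrite -{1}(iota1r hi a) -mulrA -hc.
have [n hn] := fg_len hA (fg_regular A).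
apply: (@len_kfg _ _ phiS S^o n); apply: (@len_inj k S A phiS phi S^o A^o iota _ n (iota_inj hi) hn).
split=> [x y|c x].
  by apply/eqP; rewrite eq_sym subr_eq -(iotaD hi) subrK.
by rewrite (iotaM hi) hphiS -mulrA (iota1l hi).
Qed.

Lemma fg_epart X : finitely_generated X -> finitely_generated (ep X).
Proof.
move=> /(fg_len hA)[n hn]; apply: (len_fg (phi := phiS)).
exact: (len_inj (epv_klinear X) (@epv_inj _ _ _ hi X) hn).
Qed.

(** Evaluation at [k]-generators of [A] embeds [G M] in a finite power of [M]. *)
Lemma fg_gmod M : finitely_generated M -> finitely_generated (G M).
Proof.
have [_ hc [n [g hg]]] := hA.
move=> /(fg_len corner_artin_over)[b hb].
have [d hd] : exists d, len_le phiS ({ffun 'I_n -> M} : lmodType S) d.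
  apply: (@ffun_closed S (fun X => exists a, len_le phiS X a)) => [X Y [a ha] [c hc']|X Y [s [r sK]] [a ha]|];
    last by exists b.
  - exists (a + c)%N; apply: (len_ext (linear_klinear phiS (linl X Y))
      (linear_klinear phiS (lsnd X Y)) _ ha hc').
    by move=> [x y] /= ->; exists x.
  - by exists a; apply: (len_inj (linear_klinear phiS s) (can_inj sK) ha).
have kE (h : G M) c a : gmv h (phi c * a) = phiS c *: gmv h a.
  by rewrite -gmv_iota hphiS -gmv_e mulrA (hc c e).
pose f (h : G M) : {ffun 'I_n -> M} := [ffun j => gmv h (g j)].
apply: (len_fg (phi := phi) (n := d)); apply: (@len_inj _ _ _ phi phiS _ _ f) hd.
  split=> [x y|c x]; apply/ffunP=> j; rewrite !ffunE.
    by [].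
  by rewrite gmvZ -hc kE.
move=> x y /ffunP xy; apply: gmv_inj => a; have [c ->] := hg a.
have sumE (h : G M) : gmv h (\sum_i phi (c i) *: (g i : A^o)) = \sum_i phiS (c i) *: gmv h (g i).
  rewrite (big_morph (gmv h) (gmv_add h) (id1 := 0)).
    by apply: eq_bigr => i _; rewrite -kE.
  by rewrite -[0](mulr0 (iota 0)) gmv_iota scale0r.
by rewrite !sumE; apply: eq_bigr => i _; have := xy i; rewrite !ffunE => ->.
Qed.

End Scalars.

End ArtinCorner.

(* What the hypothesis on the simple modules provides, and what strong tilting on
   both sides preserves: e A has finite projective dimension over S = e A e, and the
   A-modules killed by e have bounded projective dimension. *)
Definition good_corner (A S : pzRingType) (iota : S -> A) (hi : corner_embedding iota) :=
  exists c, pdl c (epart hi A^o) /\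
    forall X : lmodType A, finitely_generated X -> (forall x : X, iota 1 *: x = 0) -> pdl c X.

(** * Transfer of P^{<oo} between an algebra and a good corner *)

Section Transfer.
Variables (k : comPzRingType) (A S : pzRingType) (phi : {rmorphism k -> A}) (iota : S -> A).
Hypotheses (hA : artin_over phi) (hi : corner_embedding iota).
Local Notation e := (iota 1).
Local Notation ep := (epart hi).
Local Notation G := (gmod hi).
Implicit Types F P X Y Z Q K L I : lmodType A.
Implicit Types M N : lmodType S.
Let noeth : noetherian_ring A := artin_noetherian hA.

Let fg_ep X : finitely_generated X -> finitely_generated (ep X).
Proof. have [phiS hphiS] := corner_scalars hA hi; exact: fg_epart hphiS _. Qed.
Let fg_G M : finitely_generated M -> finitely_generated (G M).
Proof. have [phiS hphiS] := corner_scalars hA hi; exact: fg_gmod hphiS _. Qed.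

Lemma corner_noetherian : noetherian_ring S.
Proof.
have [phiS hphiS] := corner_scalars hA hi.
exact: artin_noetherian (corner_artin_over hA hi hphiS).
Qed.

(* F is (A e)^n. *)
Lemma corner_free n : exists F (hF : projective F), [/\ finitely_generated F,
    direct_summand (ep F) (free S n), direct_summand (free S n) (ep F),
    forall Y (f : {linear ep F -> ep Y}), exists g : {linear F -> Y}, forall x, emap hi g x = f x
  & forall Y (g g' : {linear F -> Y}), (forall x, emap hi g x = emap hi g' x) ->
      forall x, g x = g' x].
Proof.
have lin : linear (fun a : A^o => (a : A) * e : A^o).
  by move=> b x y; rewrite mulrDl -mulrA.
have [|P [s [r [sK sr]]]] := @idem_split A A^o (lin_of lin).
  by move=> x /=; rewrite -mulrA (iota11 hi).
have se w : (s w : A) * e = s w by rewrite -[in RHS](sK w) sr.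
have [v vE] : exists v : {linear ep P -> S^o}, forall w, iota (v w) = s (epv w).
  have /choice[v vE] : forall w : ep P, exists t, iota t = s (epv w).
    move=> w; have [_ _ _] := hi; apply.
    by rewrite -mulrA se -[e * _]/(e *: (s (epv w))) -linearZZ epvP.
  have vl : linear (v : ep P -> S^o).
    move=> a x y; apply: (iota_inj hi).
    by rewrite vE epvD epvZ linearP (iotaD hi) (iotaM hi) !vE.
  by exists (lin_of vl).
pose eps0 : ep P := epc hi (r 1).
have seps : s (epv eps0) = e.
  by rewrite epcE linearZZ sr /= mul1r; apply: (iota11 hi).
have vK w : (v w : S) *: eps0 = w.
  apply: epv_inj; apply: (can_inj sK); rewrite epvZ linearZZ seps.
  by rewrite vE; apply: se.
have vK' t : v ((t : S) *: eps0) = t.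
  by apply: (iota_inj hi); rewrite vE epvZ linearZZ seps; apply: (iota1r hi).
pose F : lmodType A := {ffun 'I_n -> P}.
have sumP : direct_summand P A^o by exists s, r.
have hreg : projective (A^o : lmodType A).
  apply: (proj_summand (@proj_free A 1)).
  by exists (lcol (fun=> lid A^o)), (lproj _ ord0) => x; rewrite /= ffunE.
have hF : projective F.
  exact: (@ffun_closed A (@projective A) (@proj_prod A)
    (fun X Y h1 h2 => proj_summand h2 h1) P (proj_summand hreg sumP) n).
pose del (i : 'I_n) : {linear P -> F} := lcol (fun j => if j == i then lid P else lzero P P).
pose eps i : ep F := emap hi (del i) eps0.
have epsE i j : (epv (eps i) : F) j = if j == i then epv eps0 else 0.
  by rewrite /eps emapE [LHS]ffunE; case: ifP.
have scE b (y : F) j : (b *: y) j = b *: y j by rewrite [LHS]ffunE.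
have dec (x : F) : x = \sum_i (s (x i) : A) *: epv (eps i).
  apply/ffunP=> j; rewrite sum_ffunE (bigD1 j) //= big1 => [|i /negPf ij].
    rewrite addr0 scE epsE eqxx; apply: (can_inj sK).
    by rewrite linearZZ seps -[LHS]se.
  by rewrite scE epsE eq_sym ij scaler0.
have decS (x : ep F) : x = \sum_i (v (emap hi (lproj P i) x) : S) *: eps i.
  apply: epv_inj; rewrite epv_sum [LHS]dec; apply: eq_bigr => i _.
  by rewrite epvZ vE emapE.
exists F, hF; split.
- exact: (@ffun_closed A (@finitely_generated A) (@fg_prod A)
    (fun X Y h1 h2 => fg_summand h1 h2) P (fg_summand sumP (fg_regular A)) n).
- exists (lcol (fun i => lcomp v (emap hi (lproj P i)))), (lrow eps) => x.
  by rewrite [RHS]decS; apply: eq_bigr => i _; rewrite ffunE.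
- exists (lrow eps), (lcol (fun i => lcomp v (emap hi (lproj P i)))) => x.
  apply/ffunP=> j; rewrite ffunE -[LHS]/(v (emap hi (lproj P j) (lrow eps x))) -[RHS]vK'.
  congr (v _).
  apply: epv_inj; rewrite emapE epv_sum [lproj P j _]sum_ffunE (bigD1 j) // big1 => [|i /negPf ij].
    by apply: (etrans (addr0 _)); rewrite epvZ scE epsE eqxx.
  by rewrite epvZ scE epsE eq_sym ij scaler0.
- move=> Y f; exists (lsum (fun i => lcomp (lmulr (epv (f (eps i)))) (lcomp s (lproj P i)))) => x.
  rewrite [in RHS](decS x) linear_sum; apply: epv_inj.
  rewrite emapE epv_sum -[LHS]/(\sum_i (s ((epv x : F) i) : A) *: epv (f (eps i))).
  apply: eq_bigr => i _.
  by rewrite linearZZ epvZ vE emapE.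
move=> Y g g' gg x; rewrite (dec x) !linear_sum; apply: eq_bigr => i _.
rewrite [LHS]linearZZ [RHS]linearZZ; congr (_ *: _).
by have := congr1 (@epv _ _ _ hi Y) (gg (eps i)); rewrite !emapE.
Qed.

(** Maps from [(A e)^n] to [X] are the same as [S]-linear maps from [S^n] to [e X], so a free cover
    of [e X] lifts; it is only required to be onto on [e]-parts. *)
Lemma corner_cover X : finitely_generated X -> exists F (f : {linear F -> X}),
  [/\ projective F, finitely_generated F, projective (ep F) & surjective (emap hi f)].
Proof.
move=> /fg_ep/fg_cover[n [q qS]].
have [F [hF [fF [s [r sK]] [s' [r' sK']] lift _]]] := corner_free n.
have [f fE] := lift X (lcomp q r'); exists F, (lcomp f (lid F)); split=> //.
  by apply: (proj_summand (@proj_free S n)); exists s, r.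
move=> x; have [y yE] := qS x; exists (s' y).
by rewrite -[LHS]/(emap hi f (s' y)) fE lcompE sK'.
Qed.

(** A projective [e X] is cut out of [S^n] by an idempotent, which lifts to an idempotent [g] of
    [(A e)^n]; the corresponding summand maps to [X] bijectively on [e]-parts. *)
Lemma corner_cover_proj X : finitely_generated X -> projective (ep X) ->
  exists F (f : {linear F -> X}),
  [/\ projective F, finitely_generated F, injective (emap hi f) & surjective (emap hi f)].
Proof.
move=> /fg_ep/fg_cover[n [q qS]] hX.
have [F [hF [fF [s [r sK]] [s' [r' sK']] lift uniq]]] := corner_free n.
have [f fE] := lift X (lcomp q r').
have efS : surjective (emap hi f).
  by move=> x; have [y yE] := qS x; exists (s' y); rewrite fE lcompE sK'.
have [t tK] := proj_lift (lid (ep X)) hX efS.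
have [g gE] := lift F (lcomp t (emap hi f)).
have emapC (Y Z W : lmodType A) (u : {linear Y -> Z}) (v : {linear Z -> W}) x :
    emap hi (lcomp v u) x = emap hi v (emap hi u x).
  by apply: epv_inj; rewrite !emapE.
have gg x : g (g x) = g x.
  by apply: (uniq F (lcomp g g) g) => y; rewrite emapC !gE !lcompE tK.
have fg x : f (g x) = f x.
  by apply: (uniq X (lcomp f g) f) => y; rewrite emapC gE lcompE tK.
have [F' [i [p [iK ip]]]] := idem_split gg.
exists F', (lcomp f i); split.
- by apply: proj_summand hF _; exists i, p.
- by apply: fg_summand fF; exists i, p.
- apply: lker0_inj => x; rewrite emapC => fx; apply: epv_inj; apply: (can_inj iK).
  have <- : g (i (epv x)) = i (epv x) by rewrite -[in RHS](iK (epv x)) ip.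
  by rewrite -!emapE gE lcompE fx linear0 epv0 linear0.
move=> x; have [y <-] := efS x; exists (emap hi p y).
by apply: epv_inj; rewrite emapC !emapE ip fg.
Qed.

Lemma emap_torsion_ker X Y (f : {linear X -> Y}) Z (i : {linear Z -> X}) :
  injective (emap hi f) -> injective i -> exact i f -> forall z : Z, e *: z = 0.
Proof.
move=> fI iI ex z; apply: (linj0 iI); rewrite linearZZ -epcE.
rewrite (_ : epc hi (i z) = 0) //; apply: (linj0 fI); apply: epv_inj.
by rewrite emapE epcE linearZZ (exact_comp0 _ ex) scaler0.
Qed.

Lemma emap_torsion_coker X Y (f : {linear X -> Y}) Z (p : {linear Y -> Z}) :
  surjective (emap hi f) -> surjective p -> exact f p -> forall z : Z, e *: z = 0.
Proof.
move=> fS pS ex z; have [y <-] := pS z; rewrite -linearZZ -epcE.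
by have [x <-] := fS (epc hi y); rewrite emapE (exact_comp0 _ ex).
Qed.

Section Good.
Variable c : nat.
Hypothesis hc : pdl c (ep A^o).
Hypothesis ht : forall X, finitely_generated X -> (forall x : X, e *: x = 0) -> pdl c X.

(** The functor [e] is exact and sends free modules to modules of projective dimension at most [c],
    so each syzygy adds one to the initial [c]. *)
Lemma pdl_epart m X : finitely_generated X -> pdl m X -> pdl (m + c) (ep X).
Proof.
have hfree n : pdl c (ep (free A n)).
  apply: (@ffun_closed A (fun X => pdl c (ep X))) => // [Y Z hY hZ|Y Z h hZ].
    by apply: pdl_summand (emap_prod hi Y Z) (pdl_prod hY hZ).
  exact: pdl_summand (emap_summand hi h) hZ.
elim: m X => [|m IH] X fX hX.
  have [n [p pS]] := fg_cover fX; have [r rK] := proj_lift (lid X) hX pS.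
  apply: pdl_summand (hfree n); apply: emap_summand; by exists r, p.
have [n [K [i [p [hs sK fK]]]]] := fg_syz noeth fX.
rewrite addSn; apply: pdl_coker (emap_ses hi hs) (IH K fK (pdl_syz hX sK)) _.
by apply: pdl_leq (hfree n); rewrite leqW // leq_addl.
Qed.

(** A map from a projective that is onto on [e]-parts has cokernel [Q] killed by [e], while its
    kernel [L] has as [e]-part a syzygy of [e X], to which induction applies. At [m = 0] the map is
    made bijective on [e]-parts; then [L] is killed by [e] as well and the image has dimension at
    most [c.+1]. *)
Lemma pdl_of_epart m X : finitely_generated X -> pdl m (ep X) -> pdl (m + c.+1) X.
Proof.
elim: m X => [|m IH] X fX hX.
  have [F [f [hF fF fI fS]]] := corner_cover_proj fX hX.
  have [I [q [j [qS jI jq]]]] := im_factor f.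
  have [L [i hs]] := ker_ses qS; have [iI _ ex] := hs.
  have [Q [p hs']] := coker_ses jI; have [_ pS ex'] := hs'.
  have hL : pdl c L.
    apply: ht; first exact: noeth fF _ _ iI.
    apply: emap_torsion_ker fI iI _ => y; rewrite -(ex y) -jq.
    by split=> [/(linj0 jI)//|->]; rewrite linear0.
  have hQ : pdl c Q.
    apply: ht; first exact: fg_surj pS fX.
    apply: emap_torsion_coker fS pS _ => y; rewrite (ex' y).
    by split=> [[x <-]|[x <-]]; [have [z <-] := qS x; exists z|exists (q x)].
  apply: pdl_ext hs' _ _; last exact: pdlS.
  by apply: pdl_coker hs hL _; apply: pdl_proj.
have [F [f [hF fF hep fS]]] := corner_cover fX.
have [I [q [j [qS jI jq]]]] := im_factor f.
have [L [i hs]] := ker_ses qS; have [iI _ ex] := hs.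
have [Q [p hs']] := coker_ses jI; have [_ pS ex'] := hs'.
have fL : finitely_generated L := noeth fF iI.
have hL : pdl (m + c.+1) L.
  apply: IH => //; apply: pdl_syz hX _; exists (ep F), (emap hi i), (emap hi f).
  split=> //; split=> //; first by have [] := emap_ses hi hs.
  move=> x; have [_ _ E] := emap_ses hi hs; rewrite -(E x); split=> h.
    by apply: epv_inj; apply: jI; rewrite emapE jq -emapE h linear0.
  by apply: epv_inj; rewrite emapE -jq -emapE h linear0.
have hQ : pdl c Q.
  apply: ht; first exact: fg_surj pS fX.
  apply: emap_torsion_coker fS pS _ => y; rewrite (ex' y).
  by split=> [[x <-]|[x <-]]; [have [z <-] := qS x; exists z|exists (q x)].
rewrite addSn; apply: pdl_ext hs' _ _.
  by apply: pdl_coker hs hL _; apply: pdl_proj.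
by apply: pdl_leq hQ; rewrite -addSnnS leqW // leq_addl.
Qed.

End Good.

Hypothesis good : good_corner hi.

Lemma fp_epart X : finitely_generated X -> fp X <-> fp (ep X).
Proof.
have [c [hc ht]] := good; move=> fX; split=> [[_ [m hX]]|[_ [m hX]]]; split=> //.
- exact: fg_ep.
- by exists (m + c)%N; apply: pdl_epart.
by exists (m + c.+1)%N; apply: (pdl_of_epart ht).
Qed.

Lemma ep_gmod_iso M : direct_summand M (ep (G M)) /\ direct_summand (ep (G M)) M.
Proof.
have [h h'] := iso_summand (@counit_inj _ _ _ hi M) (@counit_surj _ _ _ hi M); by split.
Qed.

Lemma fp_gmod M : fp M -> fp (G M).
Proof.
move=> hM; apply/(fp_epart (fg_G (proj1 hM))).
by have [_ h] := ep_gmod_iso M; apply: fp_summand h hM.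
Qed.

Lemma corner_pd_bound : (exists d, forall X, fp X -> pdl d X) <->
  (exists d, forall M, fp M -> pdl d M).
Proof.
have [c [hc ht]] := good; split=> -[d hd].
  exists (d + c)%N => M hM; have hG := fp_gmod hM.
  have [h _] := ep_gmod_iso M; apply: pdl_summand h _.
  by apply: pdl_epart => //; [case: hG|apply: hd].
exists (d + c.+1)%N => X hX; apply: (pdl_of_epart ht); first by case: hX.
by apply: hd; apply/fp_epart => //; case: hX.
Qed.

(** The functor [e] is exact and preserves P^{<oo}, so extending a map into [G M] amounts to
    extending its transpose into [M]. *)
Lemma rel_injective_gmod M : rel_injective M -> rel_injective (G M).
Proof.
move=> hM W hW B C i p hs f.
have [g gE] := hM (ep W) (proj1 (fp_epart (proj1 hW)) hW) _ _ _ _ (emap_ses hi hs) (coadj f).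
exists (adj g) => b; rewrite -[RHS]adj_coadj; apply: gmv_inj => a.
rewrite !adjE -gE; congr (g _); apply: epv_inj.
by rewrite emapE !epcE -!linearZZ.
Qed.

(** [G] is only left exact, so [G C -> G W] need not be onto. The cokernel [Q] of [G B -> G C] still
    embeds in [G W] and its [e]-part is [W], which puts [Q] in P^{<oo}; the extension found over [A]
    is then restricted to [e]-parts. *)
Lemma rel_injective_of_gmod M : rel_injective (G M) -> rel_injective M.
Proof.
move=> hM W hW B C i p [iI pS ex] f.
have giI := gmap_inj (hi := hi) iI.
have [Q [q hs]] := coker_ses giI; have [_ qS eq] := hs.
have [q' q'E] : exists q' : {linear Q -> G W}, forall x, q' (q x) = gmap hi p x.
  apply: factor_surj => // x /eq[y <-]; apply: gmv_inj => a.
  by rewrite !gmapE (exact_comp0 _ ex).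
have hQ : fp Q.
  have q'I : injective q'.
    apply: lker0_inj => y; have [x <-] := qS y; rewrite q'E => px; apply/eq.
    have /choice[h hE] : forall a, exists b, i b = gmv x a.
      by move=> a; apply/ex; rewrite -gmapE px.
    have hD a b : h (a + b) = h a + h b by apply: iI; rewrite linearD !hE gmv_add.
    have hZ s a : h (iota s * a) = s *: h a by apply: iI; rewrite linearZZ !hE gmv_iota.
    by exists (Gm hi hD hZ); apply: gmv_inj => a; rewrite gmapE -hE.
  have fQ : finitely_generated Q := noeth (fg_G (proj1 hW)) q'I.
  apply/(fp_epart fQ).
  have [_ h] := ep_gmod_iso W.
  have q'S : surjective (lcomp (counit hi W) (emap hi q')).
    move=> w; have [c0 <-] := pS w; have [z zE] := counit_surj hi c0.
    exists (epc hi (q (epv z))).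
    by rewrite lcompE counitE emapE epcE linearZZ q'E gmvZ mul1r gmapE gmv_e1 -counitE zE.
  have q'i : injective (lcomp (counit hi W) (emap hi q')).
    move=> x y; rewrite !lcompE => /(@counit_inj _ _ _ hi W) E.
    by apply: epv_inj; apply: q'I; rewrite -!emapE E.
  have [h1 h2] := iso_summand q'i q'S.
  exact: fp_summand h1 hW.
have [g gE] := hM Q hQ _ _ _ _ hs (gmap hi f).
have [u [uK Ku]] := bij_inv (@counit_inj _ _ _ hi C) (@counit_surj _ _ _ hi C).
exists (lcomp (lcomp (counit hi M) (emap hi g)) u) => b.
have [z zE] := counit_surj hi b.
have zE' : u (i b) = emap hi (gmap hi i) z.
  apply: (can_inj uK); rewrite Ku -zE.
  by rewrite !counitE emapE gmapE.
by rewrite !lcompE counitE zE' !emapE gE gmapE -counitE zE.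
Qed.

(** Downwards, an approximation of [G M] is transposed. Upwards, an approximation [f : M -> e X] is
    replaced by the pullback of [G f] along the unit [X -> G (e X)]; the [e]-part of the pullback is
    [M], so it lies in P^{<oo}. *)
Lemma ctf_corner : (forall X, finitely_generated X -> exists Y (f : {linear Y -> X}), fp_approx f) <->
  (forall M, finitely_generated M -> exists N (f : {linear N -> M}), fp_approx f).
Proof.
split=> hctf.
  move=> M fM; have [X [f [hX hf]]] := hctf (G M) (fg_G fM).
  exists (ep X), (coadj f); split; first by apply/fp_epart => //; case: hX.
  move=> N g hN; have [h hE] := hf (G N) (gmap hi g) (fp_gmod hN).
  have [u [uK Ku]] := bij_inv (@counit_inj _ _ _ hi N) (@counit_surj _ _ _ hi N).
  exists (lcomp (emap hi h) u) => y.
  by rewrite lcompE coadjE emapE -hE gmapE -counitE Ku.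
move=> X fX; have [M [f [hM hf]]] := hctf (ep X) (fg_ep fX).
pose eta : {linear X -> G (ep X)} := adj (lid (ep X)).
have [Q [q1 [q2 [Q1 Q2 Q3 U]]]] := pullback (gmap hi f) eta.
exists Q, q1; split.
  have fQ : finitely_generated Q.
    apply: (noeth (fg_prod fX (fg_G (proj1 hM))) (i := lpair q1 q2)).
    by apply: lker0_inj => x [x1 x2]; apply: Q3.
  apply/(fp_epart fQ).
  pose v := lcomp (counit hi M) (emap hi q2).
  have vE y : gmv (eta (epv y)) 1 = y by rewrite adj_epv.
  suff [h _] : direct_summand (ep Q) M /\ direct_summand M (ep Q) by apply: fp_summand h hM.
  apply: (@iso_summand _ _ _ v).
    apply: lker0_inj => x /(linj0 (@counit_inj _ _ _ hi M)) x2.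
    have x2' : q2 (epv x) = 0 by rewrite -emapE x2.
    have x1 : emap hi q1 x = 0 by rewrite -[LHS]vE emapE -Q1 x2' linear0.
    by apply: epv_inj; apply: Q3 => //; rewrite -emapE x1.
  move=> m; have [z zE] := counit_surj hi m.
  have [|x [x1 x2]] := Q2 (epv (f m)) (epv z).
    have -> : epv z = e *: epv z by rewrite epvP.
    have -> : epv (f m) = e *: epv (f m) by rewrite epvP.
    rewrite !linearZZ; apply: gmv_inj => a; rewrite !gmvZ gmapE adjE.
    have [s sE] : exists s, iota s = e * (a * e).
      by have [_ _ _] := hi; apply; rewrite !mulrA (iota11 hi) -!mulrA (iota11 hi).
    rewrite -[in LHS]gmv_e -sE -[iota s]mulr1 gmv_iota -counitE zE linearZZ.
    by apply: epv_inj; rewrite epvZ epcE scalerA -sE.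
  exists (epc hi x); rewrite lcompE counitE emapE epcE linearZZ x2 gmvZ mul1r.
  by rewrite gmv_e1 -counitE.
move=> W g hW.
have [h hE] := hf (ep W) (emap hi g) (proj1 (fp_epart (proj1 hW)) hW).
have [|u [u1 u2]] := U W g (adj h).
  move=> w; apply: gmv_inj => a; rewrite gmapE !adjE /= -hE.
  by apply: epv_inj; rewrite emapE !epcE -!linearZZ.
by exists u => w; rewrite u1.
Qed.

End Transfer.

(** * Simple modules of projective dimension at most one *)

Section LowPdimSimples.
Variables (k : comPzRingType) (A : pzRingType) (phi : {rmorphism k -> A}).
Hypothesis hA : artin_over phi.
Hypothesis bA : basic_ring A.
Variables (n r : nat) (eps : 'I_n -> A).
Hypothesis heps : complete_primitive_idempotents eps.
Hypothesis hpdim : forall i : 'I_n, (r <= i)%N -> pdim_le (top_module (eps i)) 1.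
Variables (S : pzRingType) (iota : S -> A).
Hypothesis hi : corner_embedding iota.
Hypothesis hiota : iota 1 = \sum_(i < n | (i < r)%N) eps i.
Implicit Types X : lmodType A.

(** The simple module [X] is a summand of the top of [A (eps i)] for some [i >= r] with [eps i] not
    killing [X]. The projection sends the class of [w] to [w u]; the section sends [a u] to the
    class of [a (xs j) (eps i)], where [xs j] lifts the central idempotent of [A / J] acting as the
    identity on [X]. *)
Lemma simple_torsion_pdl X t : t <> 0 -> (forall x : X, exists a : A, x = a *: t) ->
  (forall x : X, x <> 0 -> exists a : A, t = a *: x) -> (forall x : X, iota 1 *: x = 0) -> pdl 1 X.
Proof.
move=> t0 gt simp tors.
have [i [ri it0]] : exists i : 'I_n, (r <= i)%N /\ eps i *: t <> 0.
  apply: contrapT => H; apply: t0; rewrite -[t]scale1r.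
  have [_ _ <-] := heps; rewrite (bigID (fun i : 'I_n => (i < r)%N)) /= scalerDl -hiota tors.
  rewrite add0r scaler_suml big1 // => i; rewrite -leqNgt => ri.
  by apply: contrapT => it; apply: H; exists i.
have ii : eps i * eps i = eps i by have [h _ _] := heps; have [] := h i.
pose u := eps i *: t; have iu : eps i *: u = u by rewrite scalerA ii.
have {}gu x : exists a : A, x = a *: u.
  have [b bE] := simp _ it0; have [a ->] := gt x.
  by exists (a * b); rewrite -scalerA -bE.
have {}simp x : x <> 0 -> exists a : A, u = a *: x.
  by move=> /simp[b bE]; exists (eps i * b); rewrite -scalerA -bE.
have u0 : u <> 0 := it0.
move: u iu gu simp u0 => u iu gu simp u0 {t t0 gt it0}.
have [N [D [psi [Du psiS psiJ]]]] := bA.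
have sep j : exists x, psi j x = 1 /\ forall l, l != j -> psi l x = 0.
  have [x hx] := psiS (fun l => (l == j)%:R); exists x; split; first by rewrite hx eqxx.
  by move=> l /negPf lj; rewrite hx lj.
have /choice[xs xsE] := sep.
(* The annihilator of [u] is a maximal left ideal because [X] is simple, so the radical kills
   [u]. *)
have radu a : jacobson a -> a *: u = 0.
  pose I : {pred A^o} := fun a : A^o => `[< (a : A) *: u = 0 >].
  move=> /(_ I) h; apply/asboolP; apply: h; split.
  - split=> [|c x y /asboolP xu /asboolP yu]; apply/asboolP; first by rewrite scale0r.
    by rewrite scalerDl yu addr0 -[c *: x]/(c * x) -scalerA xu scaler0.
  - by apply/asboolP; rewrite scale1r.
  move=> L [L0 LP] nL IL x Lx; apply/asboolP; apply: contrapT => xu.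
  have [d dE] := simp _ xu.
  move: nL; rewrite (_ : 1 = d *: x + (1 - d *: x)); last by rewrite addrC subrK.
  rewrite LP //; apply: IL; apply/asboolP.
  by rewrite scalerBl scale1r -[d *: x]/(d * x) -scalerA -dE subrr.
(* The [xs j] lift the unit vectors of the product of division rings, so [1 - \sum_j xs j] is in the
   radical and they cannot all kill [u]. *)
have [j xju] : exists j, xs j *: u <> 0.
  apply: contrapT => /forallNP H; apply: u0.
  have : (1 - \sum_j xs j) *: u = 0.
    apply: radu; apply/psiJ => l; rewrite rmorphB rmorph1 rmorph_sum (bigD1 l) //=.
    rewrite big1 => [|j jl]; first by rewrite (proj1 (xsE l)) addr0 subrr.
    by apply: (proj2 (xsE j)); rewrite eq_sym.
  rewrite scalerBl scale1r scaler_suml big1 ?subr0 // => j _.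
  by apply: contrapT; apply: H.
have cent a : xs j *: (a *: u) = a *: (xs j *: u).
  apply/eqP; rewrite !scalerA -subr_eq0 -scalerBl; apply/eqP/radu/psiJ => l.
  rewrite rmorphB !rmorphM; have [->|/(proj2 (xsE j))->] := eqVneq l j.
    by rewrite (proj1 (xsE j)) mul1r mulr1 subrr.
  by rewrite mul0r mulr0 subrr.
have xu : xs j *: u = u.
  have idem : xs j *: (xs j *: u) = xs j *: u.
    apply/eqP; rewrite scalerA -subr_eq0 -scalerBl; apply/eqP/radu/psiJ => l.
    rewrite rmorphB rmorphM; have [->|/(proj2 (xsE j))->] := eqVneq l j.
      by rewrite (proj1 (xsE j)) mul1r subrr.
    by rewrite mul0r subrr.
  have [b uE] := simp _ xju.
  by have := cent (b * xs j); rewrite -!scalerA -uE idem -uE.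
(* This makes the section well defined: if [a] were nonzero in the factor [D j], it would be
   invertible there, and some [b a] would fix [u]. *)
have annE a : a *: u = 0 -> jacobson (a * xs j).
  move=> au; apply/psiJ => l; rewrite rmorphM.
  have [->|/(proj2 (xsE j))->] := eqVneq l j; last by rewrite mulr0.
  rewrite (proj1 (xsE j)) mulr1; apply: contrapT => /eqP /(Du j) ua.
  have [b bE] := psiS (fun l => if l == j then (psi l a)^-1 else 0).
  apply: u0; rewrite -xu.
  have : (b * a * xs j - xs j) *: u = 0.
    apply: radu; apply/psiJ => m; rewrite rmorphB !rmorphM bE.
    have [->|/(proj2 (xsE j))->] := eqVneq m j; last by rewrite mulr0 subrr.
    by rewrite mulVr // mul1r subrr.
  by rewrite scalerBl -!scalerA xu au scaler0 sub0r => /eqP; rewrite oppr_eq0 => /eqP.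
pose P := principal (eps i).
have [p [pS pE]] := quot_module_proj (principal_rad_closed (eps i)).
have valP (w : P) : (principal_val w : A) * eps i = principal_val w by case: w => w /= /eqP.
have retrl : linear (fun w : P => (principal_val w : A) *: u).
  by move=> a x y; rewrite scalerDl scalerA.
have [rho rhoE] : exists rho : {linear top_module (eps i) -> X},
    forall w, rho (p w) = lin_of retrl w.
  apply: factor_surj => // w /pE /asboolP[c hc wE].
  by rewrite /= wE -scalerA iu radu.
have mulP a : (a * eps i) * eps i == a * eps i by rewrite -mulrA ii.
have secl : linear (fun a : A^o => p (Principal (mulP ((a : A) * xs j)))).
  move=> a x y; rewrite -linearP; congr (p _); apply: val_inj => /=.
  by rewrite !mulrDl -!mulrA.
have [sg sgE] : exists sg : {linear X -> top_module (eps i)}, forall a, sg (lmulr u a) = lin_of secl a.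
  apply: factor_surj => [x|a /annE ja]; first by have [a ->] := gu x; exists a.
  by apply/pE/asboolP; exists (a * xs j).
apply: (@pdl_summand _ 1 X (top_module (eps i))); last exact/pdim_leP/hpdim.
exists sg, rho => x; have [a ->] := gu x.
by rewrite -[a *: u]/(lmulr u a) sgE /= rhoE /= -!scalerA iu xu.
Qed.

Lemma torsion_pdl X : finitely_generated X -> (forall x : X, iota 1 *: x = 0) -> pdl 1 X.
Proof.
move=> /(fg_len hA)[m hm]; elim/ltn_ind: m X hm => m IH X hX tX.
have [z|/existsNP[x0 nx0]] := pselect (forall x : X, x = 0).
  apply: pdl_proj => M N f g fS; exists (lzero X M) => x.
  by rewrite (z x) !linear0.
have [||V [[sV nV] Vmax]] := len_max hX (P := fun V => submod V /\ ~ (forall x, V x))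
    (W0 := fun x => x = 0).
- by move=> V [sV _]; apply: submod_kclosed.
- split; last by move=> h; apply: nx0.
  by split=> // a x y -> ->; rewrite scaler0 addr0.
have [L [i [iI iE]]] := sub_exists sV.
have [Q [p [pS pE]]] := quot_exists sV.
have hs : ses i p by split=> // y; rewrite pE iE.
have iS : ~ surjective i by move=> iS; apply: nV => x; apply/iE/iS.
have [m0 hL] := len_proper iI iS hX.
have /existsNP[y0 ny0] := nV.
apply: (pdl_ext hs).
  apply: IH hL _; first by rewrite prednK.
  by move=> x; apply: iI; rewrite linearZZ tX linear0.
have cyc y : ~ V y -> forall x, exists a, V (x - a *: y).
  move=> nVy; apply: contrapT => /existsNP[x hx].
  apply: nVy; apply: (Vmax (fun z => exists a, V (z - a *: y))).
  - split.
      split; first by exists 0; rewrite scale0r subr0; apply: submod0.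
      move=> c z w [a Vz] [b Vw]; exists (c * a + b).
      rewrite scalerDl -scalerA opprD addrACA -scalerBr; exact: submodP.
    by move=> h; apply: hx; apply: h.
  - by move=> z Vz; exists 0; rewrite scale0r subr0.
  by exists 1; rewrite scale1r subrr; apply: submod0.
apply: (@simple_torsion_pdl Q (p y0)).
- by move=> /pE.
- move=> x; have [z <-] := pS x; have [a /pE] := cyc y0 ny0 z.
  by rewrite linearB linearZZ => /eqP; rewrite subr_eq0 => /eqP ->; exists a.
- move=> x; have [z <-] := pS x => pz; have [|a /pE] := cyc z _ y0; first by move=> /pE.
  by rewrite linearB linearZZ => /eqP; rewrite subr_eq0 => /eqP ->; exists a.
by move=> x; have [z <-] := pS x; rewrite -linearZZ tX linear0.
Qed.

(** The cokernel [Q] of a cover [F -> A] that is onto on [e]-parts is killed by [e], so it has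
    projective dimension at most one and the image [I] of the cover is projective. Hence [I] is a
    summand of [F], and [e A = e I] is a summand of the projective module [e F]. *)
Lemma good_corner_low_pdim : good_corner hi.
Proof.
exists 1%N; split; last exact: torsion_pdl.
apply: pdl_proj.
have [F [f [hF fF hep fS]]] := corner_cover hA hi (fg_regular A).
have [I [q [j [qS jI jq]]]] := im_factor f.
have [Q [p hs]] := coker_ses jI; have [_ pS ex] := hs.
have hQ : pdl 1 Q.
  apply: torsion_pdl; first exact: fg_surj pS (fg_regular A).
  apply: (emap_torsion_coker fS pS) => y; rewrite (ex y).
  by split=> [[x <-]|[x <-]]; [have [z <-] := qS x; exists z|exists (q x)].
have hreg : projective (A^o : lmodType A).
  apply: (proj_summand (@proj_free A 1)).
  by exists (lcol (fun=> lid A^o)), (lproj _ ord0) => x; rewrite /= ffunE.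
have hI : projective I by apply: (@pdl_syz _ 0 _ Q hQ); exists A^o, j, p.
have [s sK] := proj_lift (lid I) hI qS.
have hepI : projective (epart hi I).
  apply: (proj_summand hep); apply: emap_summand; by exists s, q.
have [ejI _ _] := emap_ses hi hs.
have ejS : surjective (emap hi j).
  move=> x; have [y yE] := fS x; exists (emap hi q y).
  by apply: epv_inj; rewrite !emapE jq -emapE yE.
have [_ h] := iso_summand ejI ejS.
exact: proj_summand hepI h.
Qed.

End LowPdimSimples.

(** * Basic rings *)

Definition division (D : unitRingType) := forall x : D, x != 0 -> x \is a GRing.unit.

Lemma division_mul0 (D : unitRingType) (x y : D) : division D -> x * y = 0 -> x = 0 \/ y = 0.
Proof.
move=> hD xy; have [->|/hD ux] := eqVneq x 0; [by left|right].
by apply: (mulrI ux); rewrite xy mulr0.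
Qed.

Lemma division_idem (D : unitRingType) (x : D) : division D -> x * x = x -> x = 0 \/ x = 1.
Proof.
move=> hD xx; have [->|/hD ux] := eqVneq x 0; [by left|right].
by apply: (mulrI ux); rewrite xx mulr1.
Qed.

Definition two_sided_unit (R : pzRingType) (x : R) := exists y, x * y = 1 /\ y * x = 1.

(* Equivalent to basic_ring over an Artin algebra, but visibly left-right symmetric and
   inherited by corners, as it does not mention the radical. *)
Definition basic_sep (R : pzRingType) :=
  exists (I : finType) (D : I -> unitRingType) (psi : forall i, {rmorphism R -> D i}),
    [/\ forall i, division (D i),
        forall i (d : D i), exists x, psi i x = d /\ forall j, j != i -> psi j x = 0
      & forall x, (forall i, psi i x != 0) -> two_sided_unit x].

Lemma jacobson_unit (k : comPzRingType) (R : pzRingType) (phi : {rmorphism k -> R}) (j : R) :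
  @artin_over k R phi -> jacobson j -> exists u, u * (1 - j) = 1.
Proof.
move=> hR hj; have [n hn] := fg_len hR (fg_regular R).
apply: contrapT => H.
have [||L [[sL L1 Lj] Lmax]] := len_max hn (P := fun W => [/\ submod W, ~ W 1 & W (1 - j)])
   (W0 := fun x : R^o => exists u : R, x = u * (1 - j)).
- by move=> W [sW _ _]; apply: submod_kclosed.
- split.
  + split; first by exists 0; rewrite mul0r.
    by move=> a _ _ [u ->] [v ->]; exists (a * u + v); rewrite mulrDl -mulrA.
  + by move=> [u uE]; apply: H; exists u.
  by exists 1; rewrite mul1r.
apply: (L1); rewrite -[1](subrK j); apply: (submodD sL) => //.
apply/asboolP; apply: (hj (fun x : R^o => `[< L x >])); split.
- exact: submod_closed_pred.
- by apply/asboolP.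
move=> K hK nK LK x Kx; apply/asboolP; apply: (Lmax (fun x => x \in K)) => //.
  split; [exact: submod_of_closed| by apply/negP |].
  by apply: LK; apply/asboolP.
by move=> y Ly; apply: LK; apply/asboolP.
Qed.

(** A left inverse [u] of [1 - j] equals [1 + u j], which is left invertible for the same reason; so
    [u] is a two-sided inverse. *)
Lemma jacobson_two_sided_unit (k : comPzRingType) (R : pzRingType) (phi : {rmorphism k -> R}) (j : R) :
  @artin_over k R phi -> jacobson j -> two_sided_unit (1 - j).
Proof.
move=> hR hj; have [u uE] := jacobson_unit hR hj.
have hj' : jacobson (- (u * j)).
  move=> I mI; have [cI _ _] := mI; have := submod_of_closed cI => sI.
  by apply: (submodN sI); apply: (submodZ sI u); apply: hj.
have [v] := jacobson_unit hR hj'; rewrite opprK.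
have -> : 1 + u * j = u by rewrite -[in LHS]uE mulrBr mulr1 subrK.
move=> vu; exists u; split=> //.
by have -> : 1 - j = v by rewrite -[LHS]mul1r -[X in X * _]vu -mulrA uE mulr1.
Qed.

Lemma basic_ring_sep (k : comPzRingType) (R : pzRingType) (phi : {rmorphism k -> R}) :
  @artin_over k R phi -> basic_ring R -> basic_sep R.
Proof.
move=> hR [n [D [psi [hD psiS psiJ]]]]; exists 'I_n, D, psi; split=> // [i d|x hx].
  have [a aE] := psiS (fun j => (j == i)%:R).
  have [b bE] : exists b, psi i b = d.
    have [b bE] := psiS (fun j => if pselect (i = j) is left p then ecast j (D j) p d else 0).
    exists b; rewrite bE; case: pselect => // p; by rewrite (Prop_irrelevance p erefl).
  exists (b * a); split=> [|j /negPf ji]; first by rewrite rmorphM bE aE eqxx mulr1.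
  by rewrite rmorphM aE ji mulr0.
have [y yE] := psiS (fun i => (psi i x)^-1).
have ux i : psi i x \is a GRing.unit by apply: hD; apply: hx.
have [|u [u1 u2]] := jacobson_two_sided_unit (j := 1 - x * y) hR.
  by apply/psiJ => i; rewrite rmorphB rmorph1 rmorphM yE (mulrV (ux i)) subrr.
have [|v [v1 v2]] := jacobson_two_sided_unit (j := 1 - y * x) hR.
  by apply/psiJ => i; rewrite rmorphB rmorph1 rmorphM yE (mulVr (ux i)) subrr.
rewrite !subKr in u1 u2 v1 v2.
exists (y * u); split; first by rewrite mulrA.
have E : y * u = v * y.
  by rewrite -[LHS]mul1r -v2 -!mulrA [y * (x * _)]mulrA -mulrA (mulrA x) u1 mulr1.
by rewrite E -mulrA.
Qed.

(** The kernel of the map to the product is the radical. The kernel of each factor is a maximal left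
    ideal; and if [x] is in all of them but not in a maximal left ideal [J], then [1 = b + c x] with
    [b] in [J], and [b] maps to one in every factor, so it is a unit. *)
Lemma basic_sep_ring (R : pzRingType) : basic_sep R -> basic_ring R.
Proof.
move=> [I [D [psi [hD psiS psiU]]]].
exists #|I|, (fun i => D (enum_val i)), (fun i => psi (enum_val i)); split=> [i|y|x].
- exact: hD.
- have /choice[x xE] : forall i : 'I_#|I|, exists x,
     psi (enum_val i) x = y i /\ forall j, j != enum_val i -> psi j x = 0.
    by move=> i; apply: psiS.
  exists (\sum_i x i) => i; rewrite rmorph_sum (bigD1 i) //= (proj1 (xE i)).
  rewrite big1 ?addr0 // => j ji; apply: (proj2 (xE j)).
  by apply: contra_neq ji => /enum_val_inj.
split=> [jx i|hx J mJ].
  have := jx (fun a : R^o => `[< psi (enum_val i) a = 0 >]) => h; apply/asboolP; apply: h; split.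
  - split=> [|c a b /asboolP a0 /asboolP b0]; apply/asboolP; first by rewrite rmorph0.
    by rewrite rmorphD rmorphM a0 b0 mulr0 addr0.
  - by apply/asboolP; rewrite rmorph1; apply/eqP/oner_neq0.
  move=> K hK nK IK a Ka; apply/asboolP; apply: contrapT => /eqP /(hD _) ua.
  have [b [bE _]] := psiS _ ((psi (enum_val i) a)^-1).
  have sK := submod_of_closed hK.
  move/negP: nK; apply; rewrite -[1](subrK (b * a)); apply: (submodD sK).
    by apply: IK; apply/asboolP; rewrite rmorphB rmorph1 rmorphM bE mulVr // subrr.
  exact: (submodZ sK b).
have [hJ nJ Jmax] := mJ; have sJ := submod_of_closed hJ.
apply: contrapT => nx.
pose K : {pred R^o} := fun a : R^o => `[< exists b c : R, b \in J /\ a = b + c * x >].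
have hK : submod (fun a => a \in K).
  split; first by apply/asboolP; exists 0, 0; rewrite mul0r addr0; split=> //; apply: (submod0 sJ).
  move=> c _ _ /asboolP[b [d [Jb ->]]] /asboolP[b' [d' [Jb' ->]]]; apply/asboolP.
  exists (c * b + b'), (c * d + d'); split; first exact: (submodP sJ c Jb Jb').
  by rewrite [_ *: _]mulrDr mulrDl addrACA mulrA.
have [K1|nK1] := pselect (1 \in K); last first.
  apply: nx; apply: (Jmax K) => //.
  - by apply/negP.
  - by move=> b Jb; apply/asboolP; exists b, 0; rewrite mul0r addr0.
  by apply/asboolP; exists 0, 1; rewrite mul1r add0r; split=> //; apply: (submod0 sJ).
have /asboolP[b [c [Jb bE]]] := K1.
have [|y [_ yb]] := psiU b.
  move=> i; have -> : b = 1 - c * x by rewrite bE addrK.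
  rewrite rmorphB rmorph1 rmorphM; have := hx (enum_rank i); rewrite enum_rankK => ->.
  by rewrite mulr0 subr0 oner_neq0.
by move/negP: nJ; apply; rewrite -yb; apply: (submodZ sJ y).
Qed.

Lemma basic_sep_conv (R : pzRingType) : basic_sep R -> basic_sep R^c.
Proof.
move=> [I [D [psi [hD psiS psiU]]]].
exists I, (fun i => ((D i)^c : unitRingType)).
exists (fun i => @rmorph_of R^c (D i)^c (psi i) (fun x y => rmorphD (psi i) x y)
   (rmorph1 (psi i)) (fun x y => rmorphM (psi i) y x)).
by split=> // x /psiU[y [h1 h2]]; exists y.
Qed.

(** The idempotent [e] becomes zero or one in each division ring, and the factors where it is one
    serve for the corner. Invertibility of [x] in the corner is tested on [x + (1 - e)] in [R]. *)
Lemma basic_sep_corner (R S : pzRingType) (iota : S -> R) :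
  corner_embedding iota -> basic_sep R -> basic_sep S.
Proof.
move=> hi [I [D [psi [hD psiS psiU]]]].
pose e := iota 1.
have pe1 i : psi i e != 0 -> psi i e = 1.
  move=> ne; have ee : psi i e * psi i e = psi i e by rewrite -rmorphM (iota11 hi).
  by have [/eqP|//] := division_idem (hD i) ee; rewrite (negPf ne).
pose J : finType := {i : I | psi i e != 0}.
have psiD (j : J) x y : psi (val j) (iota (x + y)) = psi (val j) (iota x) + psi (val j) (iota y).
  by rewrite (iotaD hi) rmorphD.
have psiM (j : J) x y : psi (val j) (iota (x * y)) = psi (val j) (iota x) * psi (val j) (iota y).
  by rewrite (iotaM hi) rmorphM.
exists J, (fun j => D (val j)), (fun j => rmorph_of (psiD j) (pe1 _ (valP j)) (psiM j)).
split=> [j|j d|x hx]; first exact: hD.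
  have [a [aE a0]] := psiS (val j) d.
  have [s sE] : exists s, iota s = e * a * e.
    by have [_ _ _] := hi; apply; rewrite !mulrA (iota11 hi) -!mulrA (iota11 hi).
  exists s; split.
    by rewrite /= sE !rmorphM aE pe1 ?(valP j) // mulr1 mul1r.
  by move=> l lj; rewrite /= sE !rmorphM a0 // mulr0 mul0r.
have [|y [y1 y2]] := psiU (iota x + (1 - e)).
  move=> i; rewrite rmorphD rmorphB rmorph1.
  have [pe0|pe] := eqVneq (psi i e) 0.
    by rewrite -(iota1l hi) rmorphM pe0 mul0r subr0 add0r oner_neq0.
  by rewrite pe1 // subrr addr0; apply: (hx (exist _ i pe)).
have xy : iota x * y = e.
  have := congr1 (fun z => e * z) y1.
  by rewrite mulrA mulrDr mulrBr (iota1l hi) mulr1 (iota11 hi) subrr addr0.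
have yx : y * iota x = e.
  have := congr1 (fun z => z * e) y2.
  by rewrite -mulrA mulrDl mulrBl (iota1r hi) mul1r (iota11 hi) subrr addr0.
have [z zE] : exists z, iota z = e * y * e.
  by have [_ _ _] := hi; apply; rewrite !mulrA (iota11 hi) -!mulrA (iota11 hi).
exists z; split; apply: (iota_inj hi); rewrite (iotaM hi) zE.
  by rewrite !mulrA (iota1r hi) xy (iota11 hi).
by rewrite -!mulrA (iota1l hi) yx (iota11 hi).
Qed.

(** * The residue division ring of a local ring *)

Section ResidueRing.
Variables (R : pzRingType) (W : {pred R^o}).
Hypothesis hW : GRing.submod_closed W.
Hypothesis Wr : forall a b : R, a \in W -> a * b \in W.
Hypothesis W1 : (1 : R) \notin W.
Hypothesis Wu : forall a : R, a \notin W -> two_sided_unit a.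

(** The hypotheses are arguments of the type so that the ring structures declared on it can use
    them. *)
Definition residue_of (_ : forall a b : R, a \in W -> a * b \in W) (_ : (1 : R) \notin W)
  (_ : forall a : R, a \notin W -> two_sided_unit a) := Quotient.quot (submod_zmodClosed hW).
Local Notation residue := (residue_of Wr W1 Wu).
HB.instance Definition _ := GRing.Zmodule.on residue.
Local Notation pi := (\pi_(Quotient.quot (submod_zmodClosed hW)))%qT.
Definition resid (a : R) : residue := pi (a : R^o).

Lemma residE a b : (resid a = resid b) <-> (a - b \in W).
Proof.
rewrite -[_ \in W]/(a - b \in submod_zmodClosed hW) Quotient.idealrBE.
by split=> [E|/eqP]; first exact/eqP.
Qed.
Lemma residD a b : resid (a + b) = resid a + resid b. Proof. exact: raddfD. Qed.
Lemma resid0 : resid 0 = 0. Proof. exact: raddf0. Qed.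
Lemma resid_repr (x : residue) : exists a, x = resid a.
Proof. by exists (repr x); rewrite /resid reprK. Qed.

Definition residue_mul (x y : residue) : residue := resid ((repr x : R) * (repr y : R)).
Lemma residM a b : residue_mul (resid a) (resid b) = resid (a * b).
Proof.
rewrite /residue_mul; set a' := repr _; set b' := repr _.
have aa : (a' : R) - a \in W by apply/residE; apply: reprK.
have bb : (b' : R) - b \in W by apply/residE; apply: reprK.
apply/residE; have sW := submod_of_closed hW.
have -> : (a' : R) * b' - a * b = ((a' : R) - a) * b' + a * (b' - b).
  by rewrite mulrBl mulrBr addrA subrK.
by apply: (submodD sW); [apply: Wr|apply: (submodZ sW a)].
Qed.

Fact residue_mulA : associative residue_mul.
Proof.
move=> x y z; have [a ->] := resid_repr x; have [b ->] := resid_repr y.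
by have [c ->] := resid_repr z; rewrite !residM mulrA.
Qed.
Fact residue_mul1l : left_id (resid 1) residue_mul.
Proof. by move=> x; have [a ->] := resid_repr x; rewrite residM mul1r. Qed.
Fact residue_mul1r : right_id (resid 1) residue_mul.
Proof. by move=> x; have [a ->] := resid_repr x; rewrite residM mulr1. Qed.
Fact residue_mulDl : left_distributive residue_mul +%R.
Proof.
move=> x y z; have [a ->] := resid_repr x; have [b ->] := resid_repr y.
by have [c ->] := resid_repr z; rewrite -residD !residM mulrDl residD.
Qed.
Fact residue_mulDr : right_distributive residue_mul +%R.
Proof.
move=> x y z; have [a ->] := resid_repr x; have [b ->] := resid_repr y.
by have [c ->] := resid_repr z; rewrite -residD !residM mulrDr residD.
Qed.
Fact residue_neq0 : resid 1 != 0.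
Proof. by apply/eqP; rewrite -resid0 => /residE; rewrite subr0; apply/negP. Qed.
HB.instance Definition _ := GRing.Zmodule_isNzRing.Build residue
  residue_mulA residue_mul1l residue_mul1r residue_mulDl residue_mulDr residue_neq0.

Fact residue_inv_ex (x : residue) :
  exists y : residue, (x != 0 -> x * y = 1 /\ y * x = 1) /\ (x = 0 -> y = x).
Proof.
have [a ->] := resid_repr x; have [aW|naW] := boolP (a \in W).
  have a0 : resid a = 0 by rewrite -resid0; apply/residE; rewrite subr0.
  by exists 0; rewrite a0 eqxx.
have [b [b1 b2]] := Wu naW; exists (resid b); split=> [_|a0].
  by split; rewrite -[_ * _]/(residue_mul _ _) residM ?b1 ?b2.
by move: naW; rewrite -[a]subr0 (proj1 (residE a 0)) // resid0.
Qed.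
Definition residue_unit : pred residue := fun x => x != 0.
Definition residue_inv (x : residue) : residue := sval (cid (residue_inv_ex x)).
Fact residue_mulVr : {in residue_unit, left_inverse 1 residue_inv *%R}.
Proof.
move=> x; rewrite unfold_in /residue_inv => x0.
by case: cid => y /= [h _]; have [_] := h x0.
Qed.
Fact residue_mulrV : {in residue_unit, right_inverse 1 residue_inv *%R}.
Proof.
move=> x; rewrite unfold_in /residue_inv => x0.
by case: cid => y /= [h _]; have [] := h x0.
Qed.
Fact residue_unitP x y : y * x = 1 /\ x * y = 1 -> x \in residue_unit.
Proof.
move=> [h _]; rewrite unfold_in /residue_unit; apply: contra_eq_neq h => ->.
by rewrite mulr0 eq_sym oner_neq0.
Qed.
Fact residue_inv_out : {in [predC residue_unit], residue_inv =1 id}.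
Proof.
move=> x; rewrite inE unfold_in /residue_inv negbK => /eqP x0.
by case: cid => y /= [_]; apply.
Qed.
HB.instance Definition _ := GRing.NzRing_hasMulInverse.Build residue
  residue_mulVr residue_mulrV residue_unitP residue_inv_out.

Lemma residue_division : division (residue : unitRingType).
Proof. by []. Qed.

Fact resid1 : resid 1 = 1. Proof. by []. Qed.
Fact residM' a b : resid (a * b) = resid a * resid b. Proof. by rewrite -residM. Qed.
Definition residue_map : {rmorphism R -> residue} := rmorph_of residD resid1 residM'.
End ResidueRing.

Lemma division_quotient (R : pzRingType) (W : R -> Prop) :
  submod (W : R^o -> Prop) -> (forall a b, W a -> W (a * b)) -> ~ W 1 ->
  (forall a, ~ W a -> two_sided_unit a) ->
  exists (D : unitRingType) (psi : {rmorphism R -> D}),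
    [/\ division D, forall d, exists x, psi x = d & forall x, psi x = 0 <-> W x].
Proof.
move=> sW Wr W1 Wu; pose P : {pred R^o} := fun x : R^o => `[< W x >].
have hP : GRing.submod_closed P := submod_closed_pred sW.
have Pr a b : a \in P -> a * b \in P by move=> /asboolP Wa; apply/asboolP; apply: Wr.
have P1 : (1 : R) \notin P by apply/asboolP.
have Pu a : a \notin P -> two_sided_unit a by move=> /asboolP; apply: Wu.
exists (residue_of hP Pr P1 Pu : unitRingType), (residue_map hP Pr P1 Pu).
split=> [|d|x]; first exact: residue_division.
  by have [a ->] := resid_repr d; exists a.
by rewrite -[residue_map _ _ _ _ x]/(resid hP Pr P1 Pu x) -(resid0 hP Pr P1 Pu) residE subr0; split=> /asboolP.
Qed.

(** * Endomorphism rings *)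

Section HomModule.
Variables (A : pzRingType) (X T : lmodType A).

Record hom_type := Hm { hm_fun :> X -> T; hm_linear : linear hm_fun }.

Lemma hm_eq (f g : hom_type) : f =1 g -> f = g.
Proof.
case: f g => f hf [g hg] /= fg; have E : f = g by apply/funext.
by subst g; congr Hm; apply: Prop_irrelevance.
Qed.

HB.instance Definition _ := gen_eqMixin hom_type.
HB.instance Definition _ := gen_choiceMixin hom_type.

Definition hm_of (f : {linear X -> T}) : hom_type := @Hm f (linearP f).
Definition hm_lin (f : hom_type) : {linear X -> T} := lin_of (hm_linear f).
Lemma hm_linE f x : hm_lin f x = f x. Proof. by []. Qed.

Definition hm_zero := hm_of (lzero X T).
Definition hm_add f g := hm_of (ladd (hm_lin f) (hm_lin g)).
Definition hm_opp f := hm_of (lsub (lzero X T) (hm_lin f)).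
Fact hm_addA : associative hm_add.
Proof. by move=> f g h; apply: hm_eq => x; apply: addrA. Qed.
Fact hm_addC : commutative hm_add.
Proof. by move=> f g; apply: hm_eq => x; apply: addrC. Qed.
Fact hm_add0 : left_id hm_zero hm_add.
Proof. by move=> f; apply: hm_eq => x; apply: add0r. Qed.
Fact hm_addN : left_inverse hm_zero hm_opp hm_add.
Proof. by move=> f; apply: hm_eq => x /=; rewrite sub0r addNr. Qed.
HB.instance Definition _ := GRing.isZmodule.Build hom_type hm_addA hm_addC hm_add0 hm_addN.

Lemma hmD (f g : hom_type) x : (f + g) x = f x + g x. Proof. by []. Qed.
Lemma hm0 x : (0 : hom_type) x = 0. Proof. by []. Qed.
Lemma hmB (f g : hom_type) x : (f - g) x = f x - g x.
Proof. by rewrite hmD; congr (_ + _); apply: sub0r. Qed.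
Lemma hm_sum (I : finType) (F : I -> hom_type) x : (\sum_i F i) x = \sum_i F i x.
Proof. exact: (big_morph (fun f : hom_type => f x) (fun f g => hmD f g x) (hm0 x)). Qed.
End HomModule.

Section EndRing.
Variables (A : pzRingType) (T : lmodType A).
Definition endr := hom_type T T.
HB.instance Definition _ := GRing.Zmodule.on endr.
Definition endr_one : endr := hm_of (lid T).
Definition endr_mul (f g : endr) : endr := hm_of (lcomp (hm_lin f) (hm_lin g)).
Fact endr_mulA : associative endr_mul.
Proof. by move=> f g h; apply: hm_eq. Qed.
Fact endr_mul1l : left_id endr_one endr_mul.
Proof. by move=> f; apply: hm_eq. Qed.
Fact endr_mul1r : right_id endr_one endr_mul.
Proof. by move=> f; apply: hm_eq. Qed.
Fact endr_mulDl : left_distributive endr_mul +%R.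
Proof. by move=> f g h; apply: hm_eq. Qed.
Fact endr_mulDr : right_distributive endr_mul +%R.
Proof. by move=> f g h; apply: hm_eq => x; exact: (linearD (hm_lin f)). Qed.
HB.instance Definition _ := GRing.Zmodule_isPzRing.Build endr
  endr_mulA endr_mul1l endr_mul1r endr_mulDl endr_mulDr.

Lemma endrM (f g : endr) x : (f * g) x = f (g x). Proof. by []. Qed.

Lemma endr_ring_iso : ring_iso_End endr T.
Proof.
exists (fun f => hm_lin f); split=> // [f g|g]; first exact: hm_eq.
by exists (hm_of g).
Qed.

Lemma endr_ring_iso_conv : ring_iso_End (endr^c)^c T.
Proof.
exists (fun f : endr => hm_lin f); split=> // [f g|g]; first exact: hm_eq.
by exists (hm_of g).
Qed.
End EndRing.

Section RingIsoEnd.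
Variables (A R : pzRingType) (T : lmodType A).
Hypothesis hRT : ring_iso_End R T.

(** If [X * X] is a summand of [T], the projections [P] and [Q] onto the two copies are [a b] and
    [b a], with [P Q = 0]. In a division ring this forces [P] to become zero, so the idempotent
    [1 - P] is a unit and [P = 0]. *)
Lemma basic_sep_module : basic_sep R -> basic_module T.
Proof.
move=> [I [D [psi [hD psiS psiU]]]] X [nX _] [s [p sK]]; apply: nX.
have [act [actD actM act1 actI actS]] := hRT.
pose s1 := lcomp s (linl X X); pose s2 := lcomp s (linr X X).
pose p1 := lcomp (lfst X X) p; pose p2 := lcomp (lsnd X X) p.
have [P PE] := actS (lcomp s1 p1); have [Q QE] := actS (lcomp s2 p2).
have [a aE] := actS (lcomp s1 p2); have [b bE] := actS (lcomp s2 p1).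
have ab : a * b = P.
  by apply: actI => t; rewrite actM aE bE PE /= sK.
have ba : b * a = Q.
  by apply: actI => t; rewrite actM aE bE QE /= sK.
have act0 t : act 0 t = 0 by apply: (addrI (act 0 t)); rewrite -actD !addr0.
have PQ : P * Q = 0.
  by apply: actI => t; rewrite actM PE QE /= sK /= linear0 act0.
have PP : P * P = P.
  by apply: actI => t; rewrite actM !PE /= sK.
have psiP i : psi i P = 0.
  have [//|P1] := division_idem (x := psi i P) (hD i) (etrans (esym (rmorphM _ _ _)) (congr1 _ PP)).
  have Q0 : psi i Q = 0.
    by rewrite -[LHS]mul1r -P1 -rmorphM PQ rmorph0.
  have := congr1 (psi i) ba; rewrite Q0 rmorphM => /(division_mul0 (hD i)) h.
  by rewrite -ab rmorphM; case: h => ->; rewrite ?mulr0 ?mul0r.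
have [|y [_ y2]] := psiU (1 - P).
  by move=> i; rewrite rmorphB rmorph1 psiP subr0 oner_neq0.
have P0 : P = 0 by rewrite -[LHS]mul1r -y2 -mulrA mulrBl mul1r PP subrr mulr0.
move=> x; have := PE (s1 x); rewrite P0 act0 /= sK /=.
move=> /(congr1 p); rewrite linear0 sK => /(congr1 fst) /= <- //.
Qed.
End RingIsoEnd.

Section EndArtin.
Variables (k : comPzRingType) (A : pzRingType) (phi : {rmorphism k -> A}).
Hypotheses (hk : artinian k) (hA : artin_over phi).
Implicit Types T X Y Z : lmodType A.

Lemma endr_artin T : finitely_generated T -> artin_algebra (endr T).
Proof.
move=> fT; have [_ hc _] := hA.
pose f c : endr T := hm_of (lscale hA T c).
have fD x y : f (x + y) = f x + f y.
  by apply: hm_eq => t; rewrite hmD /= rmorphD scalerDl.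
have f1 : f 1 = 1 by apply: hm_eq => t; rewrite /= rmorph1 scale1r.
have fM x y : f (x * y) = f x * f y.
  by apply: hm_eq => t; rewrite /= rmorphM scalerA.
exists k, (rmorph_of fD f1 fM); split=> //.
  by move=> c a; apply: hm_eq => t; exact: (esym (linearZZ (hm_lin a) (phi c) t)).
have [m [h hE]] := hom_kfg hA fT fT.
exists m, (fun i => hm_of (h i)) => a; have [c cE] := hE (hm_lin a).
by exists c; apply: hm_eq => t; rewrite hm_sum; apply: (etrans (cE t)).
Qed.

Lemma endr_two_sided T (a : endr T) : two_sided_unit a <-> bijective (hm_lin a).
Proof.
split=> [[b [ab ba]]|/bij_linear[b [aK Ka]]].
  exists b => x; first by rewrite -[LHS]/((b * a) x) ba.
  by rewrite -[LHS]/((a * b) x) ab.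
by exists (hm_of b); split; apply: hm_eq => x; rewrite endrM; [apply: Ka|apply: aK].
Qed.

(** By Fitting's lemma the non-bijective endomorphisms of [Z] form a two-sided ideal, and the
    residue ring is a division ring. *)
Lemma residue_division_ring Z n : indecomposable Z -> len_le phi Z n ->
  exists (D : unitRingType) (psi : {rmorphism endr Z -> D}),
    [/\ division D, forall d, exists x, psi x = d
      & forall x, psi x != 0 <-> bijective (hm_lin x)].
Proof.
move=> iZ hZ; pose W (a : (endr Z)^o) := ~ bijective (hm_lin (a : endr Z)).
have comp_nonbij (a b : endr Z) : bijective (hm_lin (a * b)) -> bijective (hm_lin a) /\ bijective (hm_lin b).
  move=> bab; have [bb|nb] := pselect (bijective (hm_lin b)).
    split=> //; have [c [cK Kc]] := bij_linear bb.
    apply: (@eq_bij _ _ (lcomp (hm_lin (a * b)) c)); first by apply: bij_comp => //; exists (hm_lin b).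
    by move=> x; rewrite lcompE -[LHS]/(a (hm_lin b (c x))) Kc.
  have [c [cK Kc]] := bij_linear bab.
  have nba : ~ bijective (lcomp (lcomp (hm_lin b) c) (hm_lin a)).
    move=> bba; apply: nb; apply/bijectiveP; split.
      by apply: lker0_inj => x bx; rewrite -[x]cK -[hm_lin (a * b) x]/(hm_lin a (hm_lin b x)) bx !linear0.
    by move=> y; have [g _ Kg] := bba; exists (c (a (g y))); rewrite -[RHS]Kg.
  have nil := indecomposable_endo iZ hZ nba.
  pose g := lcomp (lcomp (hm_lin b) c) (hm_lin a).
  have ag x : hm_lin a (g x) = hm_lin a x by exact: (Kc (hm_lin a x)).
  have E m x : hm_lin a (iter m g x) = hm_lin a x.
    by elim: m => [|m IH] //; rewrite iterS ag IH.
  case: iZ => -[] x; rewrite -[x]Kc -[LHS]/(hm_lin a (hm_lin b (c x))) -(E n.+1).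
  by rewrite nil linear0.
have sW : submod W.
  split.
    move=> [g _ Kg]; case: iZ => -[] x; by rewrite -[x]Kg.
  move=> c a b Wa Wb bs.
  have [|i bi] := @indecomposable_sum _ _ phi Z n 2
      (fun i => if i == ord0 then hm_lin ((c : endr Z) * (a : endr Z)) else hm_lin (b : endr Z)) iZ hZ.
    apply: (eq_bij bs) => x.
    by rewrite /= !big_ord_recl big_ord0 addr0.
  move: bi; case: ifP => _ // /comp_nonbij[_]; exact: Wa.
have [|||D [psi [hD psiS psiE]]] := @division_quotient (endr Z) W sW.
- by move=> a b Wa /comp_nonbij[]; move/Wa.
- by move=> []; exists id.
- by move=> a /contrapT ba; apply/endr_two_sided.
exists D, psi; split=> // x; split=> [/eqP nx|bx].
  by apply: contrapT => nb; apply: nx; apply/psiE.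
by apply/eqP => /psiE; apply.
Qed.

(* If Z is not a direct summand of T, every endomorphism of Z factoring through T is
   nilpotent, so End(T) and End(Z) modulo radicals are independent factors. *)
Lemma basic_sep_prod T Z n : basic_sep (endr T) -> indecomposable Z -> len_le phi Z n ->
  ~ direct_summand Z T -> basic_sep (endr (T * Z)%type).
Proof.
move=> [I [D [psi [hD psiS psiU]]]] iZ hZ nZT.
have [D0 [psi0 [hD0 psi0S psi0E]]] := residue_division_ring iZ hZ.
have nb (u : {linear T -> Z}) (v : {linear Z -> T}) : ~ bijective (lcomp u v).
  by move=> /bij_linear[c [cK _]]; apply: nZT; exists v, (lcomp c u).
have nil (u : {linear T -> Z}) (v : {linear Z -> T}) := indecomposable_endo iZ hZ (nb u v).
pose tt (b : endr (T * Z)%type) : endr T := hm_of (lcomp (lfst T Z) (lcomp (hm_lin b) (linl T Z))).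
pose tz (b : endr (T * Z)%type) : {linear Z -> T} := lcomp (lfst T Z) (lcomp (hm_lin b) (linr T Z)).
pose zt (b : endr (T * Z)%type) : {linear T -> Z} := lcomp (lsnd T Z) (lcomp (hm_lin b) (linl T Z)).
pose zz (b : endr (T * Z)%type) : endr Z := hm_of (lcomp (lsnd T Z) (lcomp (hm_lin b) (linr T Z))).
have bE (b : endr (T * Z)%type) t z : b (t, z) = (tt b t + tz b z, zt b t + zz b z).
  have -> : (t, z) = linl T Z t + linr T Z z by congr pair; rewrite /= ?addr0 ?add0r.
  rewrite -[LHS]/(hm_lin b (linl T Z t + linr T Z z)) linearD [LHS]surjective_pairing //.
have nil_psi (R : pzRingType) (E : unitRingType) (th : {rmorphism R -> E}) (x : R) m :
    division E -> x ^+ m = 0 -> th x = 0.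
  move=> hE xm; apply/eqP; apply: contrapT => /negP /hE ux.
  by have := unitrX m ux; rewrite -rmorphXn xm rmorph0 unitr0.
(* Since [u v] is nilpotent on [Z], so is [v u] on [T], and nilpotents vanish in a division ring.
   This makes [b |-> psi i (tt b)] multiplicative. *)
have psi_tz i (v : {linear Z -> T}) (u : {linear T -> Z}) : psi i (hm_of (lcomp v u)) = 0.
  apply: (@nil_psi _ _ _ _ n.+2) => //; apply: hm_eq => t.
  have E m : (hm_of (lcomp v u) : endr T) ^+ m.+1 = hm_of (lcomp v (lcomp (lpow (lcomp u v) m) u)).
    elim: m => [|m IH]; first by apply: hm_eq.
    rewrite exprSr IH; apply: hm_eq => x; rewrite /= !lpowE.
    by congr (v _); rewrite -iterSr.
  by rewrite E -[LHS]/(v (lpow (lcomp u v) n.+1 (u t))) lpowE nil linear0.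
have psi0_zt (u : {linear T -> Z}) (v : {linear Z -> T}) : psi0 (hm_of (lcomp u v)) = 0.
  apply/eqP; apply: contrapT => /negP /psi0E h; apply: (nb u v).
  by apply: (eq_bij h).
pose F := option I.
pose DF (i : F) : unitRingType := if i is Some j then D j else D0.
pose th (i : F) : endr (T * Z)%type -> DF i :=
  match i with Some j => fun b => psi j (tt b) | None => fun b => psi0 (zz b) end.
have thD i a b : th i (a + b) = th i a + th i b.
  case: i => [j|] /=; rewrite -rmorphD; congr (_ _); exact: hm_eq.
have th1 i : th i 1 = 1.
  by case: i => [j|] /=; [rewrite -[RHS](rmorph1 (psi j)); congr (psi j _)
    | rewrite -[RHS](rmorph1 psi0); congr (psi0 _)]; apply: hm_eq.
have thM i a b : th i (a * b) = th i a * th i b.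
  case: i => [j|] /=; rewrite -rmorphM.
    rewrite -[RHS]addr0 -(psi_tz j (tz a) (zt b)) -rmorphD; congr (_ _).
    apply: hm_eq => t; rewrite hmD -[LHS]/((a (b (t, 0))).1) bE (linear0 (tz b)).
    by rewrite (linear0 (hm_lin (zz b)) : zz b 0 = 0) !addr0 bE.
  rewrite -[RHS]addr0 -(psi0_zt (zt a) (tz b)) -rmorphD; congr (_ _).
  apply: hm_eq => t; rewrite hmD -[LHS]/((a (b (0, t))).2) bE (linear0 (zt b)).
  by rewrite (linear0 (hm_lin (tt b)) : tt b 0 = 0) !add0r bE; apply: addrC.
exists F, DF, (fun i => rmorph_of (@thD i) (th1 i) (@thM i)); split.
- by case=> [j|]; [exact: hD|exact: hD0].
- case=> [i|] d /=.
    have [x [xE x0]] := psiS i d.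
    exists (hm_of (lpair (lcomp (hm_lin x) (lfst T Z)) (lzero _ Z))); split.
      by rewrite -[RHS]xE; congr (psi i _); apply: hm_eq.
    case=> [j|] /= ji; first by rewrite -[RHS](x0 j) //; congr (psi j _); apply: hm_eq.
    by rewrite -[RHS](rmorph0 psi0); congr (psi0 _); apply: hm_eq.
  have [x xE] := psi0S d.
  exists (hm_of (lpair (lzero _ T) (lcomp (hm_lin x) (lsnd T Z)))); split.
    by rewrite -[RHS]xE; congr (psi0 _); apply: hm_eq.
  case=> [j|] //= _.
  by rewrite -[RHS](rmorph0 (psi j)); congr (psi j _); apply: hm_eq.
move=> b hb; apply/endr_two_sided.
have [al [al1 al2]] := psiU (tt b) (fun i => hb (Some i)).
have alK t : al (tt b t) = t by rewrite -[LHS]/((al * tt b) t) al2.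
have Kal t : tt b (al t) = t by rewrite -[LHS]/((tt b * al) t) al1.
(* The Schur complement of the invertible block [tt b]. It differs from [zz b] by a map through [T],
   so it is bijective. *)
pose w : {linear Z -> Z} := lsub (hm_lin (zz b)) (lcomp (zt b) (lcomp (hm_lin al) (tz b))).
have bw : bijective w.
  have : psi0 (hm_of w) != 0.
    have -> : hm_of w = zz b - hm_of (lcomp (zt b) (lcomp (hm_lin al) (tz b))).
      by apply: hm_eq => x; rewrite hmB.
    by rewrite rmorphB psi0_zt subr0; apply: (hb None).
  by move=> /psi0E h; apply: (eq_bij h).
have [w' [wK Kw]] := bij_linear bw.
apply/bijectiveP; split.
  apply: lker0_inj => -[t z] E.
  have E' := etrans (esym (bE b t z)) E.
  have E1 : tt b t + tz b z = 0 := congr1 fst E'.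
  have E2 : zt b t + zz b z = 0 := congr1 snd E'.
  have tE : t = - al (tz b z).
    rewrite -[LHS]alK (_ : tt b t = - tz b z); first exact: (linearN (hm_lin al)).
    by apply/eqP; rewrite -addr_eq0; apply/eqP.
  have z0 : z = 0.
    apply: (can_inj wK); rewrite linear0 -E2 tE linearN; exact: addrC.
  by rewrite tE z0 linear0 (linear0 (hm_lin al) : al 0 = 0) oppr0.
move=> [t' z']; pose z := w' (z' - zt b (al t')); pose t := al (t' - tz b z).
exists (t, z); rewrite hm_linE bE; congr pair; first by rewrite /t Kal subrK.
have wz : w z = z' - zt b (al t') by rewrite /z Kw.
have alB x y : al (x - y) = al x - al y := linearB (hm_lin al) x y.
rewrite /t alB linearB -addrA [X in _ + X]addrC.
by rewrite -[LHS]/(zt b (al t') + w z) wz addrC subrK.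
Qed.

End EndArtin.

(** * Corners of endomorphism rings of strong tilting modules *)

Definition end_action (A R : pzRingType) (T : lmodType A) (act : R -> {linear T -> T}) :=
  [/\ forall x y t, act (x + y) t = act x t + act y t,
      forall x y t, act (x * y) t = act x (act y t),
      forall t, act 1 t = t,
      forall x y, act x =1 act y -> x = y
    & forall g : {linear T -> T}, exists x, act x =1 g].

Section HomFunctor.
Variables (A R : pzRingType) (T : lmodType A) (act : R -> {linear T -> T}).
Hypothesis hact : end_action act.
Implicit Types X Y Z : lmodType A.

Lemma actD x y t : act (x + y) t = act x t + act y t. Proof. by case: hact. Qed.
Lemma actM x y t : act (x * y) t = act x (act y t). Proof. by case: hact. Qed.
Lemma act1 t : act 1 t = t. Proof. by case: hact. Qed.
Lemma act_inj x y : act x =1 act y -> x = y. Proof. by case: hact => _ _ _ h _; apply: h. Qed.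
Lemma act_full (g : {linear T -> T}) : exists x, act x =1 g. Proof. by case: hact. Qed.
Lemma act0 t : act 0 t = 0.
Proof. by apply: (addrI (act 0 t)); rewrite -actD !addr0. Qed.
Lemma act_sum (I : finType) (F : I -> R) t : act (\sum_i F i) t = \sum_i act (F i) t.
Proof. exact: (big_morph (fun r => act r t) (fun x y => actD x y t) (act0 t)). Qed.

Definition hmod_of (_ : end_action act) X := hom_type X T.
Section HmodInst.
Variable X : lmodType A.
Local Notation H := (hmod_of hact X).
HB.instance Definition _ := GRing.Zmodule.on H.
Definition hm_scale (r : R) (f : H) : H := hm_of (lcomp (act r) (hm_lin f)).
Fact hm_scaleA a b f : hm_scale a (hm_scale b f) = hm_scale (a * b) f.
Proof. by apply: hm_eq => x; rewrite /= actM. Qed.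
Fact hm_scale1 : left_id 1 hm_scale.
Proof. by move=> f; apply: hm_eq => x; rewrite /= act1. Qed.
Fact hm_scaleDr : right_distributive hm_scale +%R.
Proof. by move=> a f g; apply: hm_eq => x; rewrite /= linearD. Qed.
Fact hm_scaleDl f : {morph hm_scale^~ f : a b / a + b}.
Proof. by move=> a b; apply: hm_eq => x; rewrite /= actD. Qed.
HB.instance Definition _ := GRing.Zmodule_isLmodule.Build R H
  hm_scaleA hm_scale1 hm_scaleDr hm_scaleDl.
End HmodInst.
Definition hmod X : lmodType R := hmod_of hact X.
Definition hmv X (f : hmod X) : {linear X -> T} := hm_lin f.
Definition hmc X (f : {linear X -> T}) : hmod X := hm_of f.

Lemma hmcE X (f : {linear X -> T}) x : hmv (hmc f) x = f x. Proof. by []. Qed.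
Lemma hmv_eq X (f g : hmod X) : hmv f =1 hmv g -> f = g. Proof. exact: hm_eq. Qed.
Lemma hmvD X (f g : hmod X) x : hmv (f + g) x = hmv f x + hmv g x. Proof. by []. Qed.
Lemma hmvZ X r (f : hmod X) x : hmv (r *: f) x = act r (hmv f x). Proof. by []. Qed.
Lemma hmv0 X x : hmv (0 : hmod X) x = 0. Proof. by []. Qed.

Fact hmap_linear X Y (g : {linear X -> Y}) : linear (fun f : hmod Y => hmc (lcomp (hmv f) g)).
Proof. by move=> r f h; apply: hmv_eq. Qed.
Definition hmap X Y (g : {linear X -> Y}) : {linear hmod Y -> hmod X} := lin_of (hmap_linear g).
Lemma hmapE X Y (g : {linear X -> Y}) f x : hmv (hmap g f) x = hmv f (g x). Proof. by []. Qed.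

Lemma hmap_ses X Y Z (i : {linear X -> Y}) (p : {linear Y -> Z}) :
  ses i p -> ext1_eq0 Z T -> ses (hmap p) (hmap i).
Proof.
move=> hs h; have [iI pS ex] := hs; split=> [f g fg|f|f].
- apply: hmv_eq => z; have [y <-] := pS z; by rewrite -!hmapE fg.
- have [g gE] := h _ _ _ _ hs (hmv f); exists (hmc g).
  by apply: hmv_eq => x; rewrite hmapE hmcE gE.
split=> [f0|[g <-]].
  have [|g gE] := factor_surj (f := hmv f) pS.
    by move=> y /ex[x <-]; rewrite -hmapE f0.
  by exists (hmc g); apply: hmv_eq => y; rewrite hmapE hmcE gE.
by apply: hmv_eq => x; rewrite !hmapE (exact_comp0 _ ex) hmv0 linear0.
Qed.

Lemma hmap_summand X Y : direct_summand X Y -> direct_summand (hmod X) (hmod Y).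
Proof.
by move=> [s [p sK]]; exists (hmap p), (hmap s) => f; apply: hmv_eq => x; rewrite !hmapE sK.
Qed.

Lemma hmap_prod X Y : direct_summand (hmod (X * Y)%type) (hmod X * hmod Y)%type.
Proof.
exists (lpair (hmap (linl X Y)) (hmap (linr X Y))).
exists (lcopair (hmap (lfst X Y)) (hmap (lsnd X Y))) => f; apply: hmv_eq => -[x y].
change (hmv f (linl X Y x) + hmv f (linr X Y y) = hmv f (x, y)).
rewrite -linearD; congr (hmv f _).
by congr pair; rewrite /= ?addr0 ?add0r.
Qed.

Lemma hmod_T_proj : projective (hmod T).
Proof.
have lin : linear (fun r : R^o => hmc (act r)).
  by move=> a x y; apply: hmv_eq => t; rewrite hmvD hmvZ !hmcE actD actM.
have fI : injective (lin_of lin).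
  by move=> x y E; apply: act_inj => t; exact: (congr1 (fun f => hmv f t) E).
have fS : surjective (lin_of lin).
  move=> f; have [x xE] := act_full (hmv f); exists x; apply: hmv_eq => t; exact: xE.
have [_ h] := iso_summand fI fS.
apply: (proj_summand (@proj_free R 1)); apply: summand_trans h _.
by exists (lcol (fun=> lid R^o)), (lproj _ ord0) => x; rewrite /= ffunE.
Qed.

Lemma hmod_add_proj X : add_of T X -> projective (hmod X).
Proof.
move=> [n hn]; apply: (@proj_summand _ (hmod {ffun 'I_n -> T})); last exact: hmap_summand.
exact: (@ffun_closed A (fun X => projective (hmod X))
  (fun X Y hX hY => proj_summand (proj_prod hX hY) (hmap_prod X Y))
  (fun X Y h hY => proj_summand hY (hmap_summand h)) T hmod_T_proj n).
Qed.

(** The bound is the length [d] of the coresolution of [X]; the sequences stay exact because the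
    cosyzygies are in P^{<oo} and [T] is relatively injective. *)
Lemma hmod_pdl d X : noetherian_ring A -> strong_tilt T ->
  (forall Y, fp Y -> pdl d Y) -> fp X -> pdl d (hmod X).
Proof.
move=> noeth hT hd /(strong_tilt_cor noeth hT hd); have [fT iT _ _] := hT.
elim: d X {hd} => [|d IH] X /=; first exact: hmod_add_proj.
move=> [C [X' [i [p [hC hs hX']]]]].
exists (hmod X'); last exact: IH.
exists (hmod C), (hmap p), (hmap i); split; first exact: hmod_add_proj.
by apply: hmap_ses hs _; apply: iT; apply: cor_fp hX'.
Qed.

Lemma act_row n (g : {linear {ffun 'I_n -> T} -> T}) :
  exists r : 'I_n -> R, forall x, g x = \sum_j act (r j) (x j).
Proof.
pose d (j : 'I_n) : {linear T -> {ffun 'I_n -> T}} :=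
  lcol (fun l => if l == j then lid T else lzero T T).
have /choice[r rE] : forall j, exists r, act r =1 lcomp g (d j).
  by move=> j; apply: act_full.
exists r => x; rewrite [in LHS](_ : x = \sum_j d j (x j)).
  by rewrite linear_sum; apply: eq_bigr => j _; rewrite rE.
apply/ffunP=> l; rewrite sum_ffunE (bigD1 l) //= big1 => [|j /negPf jl].
  by rewrite ffunE eqxx addr0.
by rewrite ffunE eq_sym jl.
Qed.

Lemma act_row_inj n (r r' : 'I_n -> R) :
  (forall x : {ffun 'I_n -> T}, \sum_j act (r j) (x j) = \sum_j act (r' j) (x j)) ->
  forall j, r j = r' j.
Proof.
move=> E j; apply: act_inj => t.
have key (q : 'I_n -> R) : \sum_i act (q i) ([ffun i => if i == j then t else 0] i) = act (q j) t.
  rewrite (bigD1 j) //= big1 => [|i /negPf ij]; first by rewrite ffunE eqxx addr0.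
  by rewrite ffunE ij linear0.
by rewrite -(key r) E key.
Qed.
End HomFunctor.

(** * Goodness of the corner End(T') of End(T) *)

Section GoodEnd.
Variables (k : comPzRingType) (A S : pzRingType) (phi : {rmorphism k -> A}) (iota : S -> A).
Hypotheses (hA : artin_over phi) (hi : corner_embedding iota) (good : good_corner hi).
Local Notation e := (iota 1).
Local Notation ep := (epart hi).
Local Notation G := (gmod hi).
Variables (T : lmodType A) (T' : lmodType S).
Hypotheses (hT : strong_tilt T) (hT' : strong_tilt T').
Variables (R R' : pzRingType) (act : R -> {linear T -> T}) (act' : R' -> {linear T' -> T'}).
Hypotheses (hact : end_action act) (hact' : end_action act').
Hypothesis noethR : noetherian_ring R.
Variables (s : {linear G T' -> T}) (p : {linear T -> G T'}).
Hypothesis sK : cancel s p.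
Let noeth : noetherian_ring A := artin_noetherian hA.
Let noethS : noetherian_ring S := corner_noetherian hA hi.

(** [G] is fully faithful because the counit is an isomorphism. *)
Lemma gmap_full (M N : lmodType S) (g : {linear G M -> G N}) :
  exists g' : {linear M -> N}, forall h, gmap hi g' h = g h.
Proof.
have [c [cK Kc]] := bij_inv (@counit_inj _ _ _ hi M) (@counit_surj _ _ _ hi M).
exists (lcomp (lcomp (counit hi N) (emap hi g)) c).
apply: (gm_ext (hi := hi)) => x.
by rewrite gmapE !lcompE -counitE cK counitE emapE.
Qed.

Lemma gmap_eq (M N : lmodType S) (g g' : {linear M -> N}) :
  (forall h, gmap hi g h = gmap hi g' h) -> g =1 g'.
Proof.
move=> E m; have [x <-] := counit_surj hi m.
by rewrite counitE -!gmapE E.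
Qed.

Variable iota' : R' -> R.
Hypothesis iotaE : forall x t, act (iota' x) t = s (gmap hi (act' x) (p t)).

Lemma iota'1 t : act (iota' 1) t = s (p t).
Proof. by rewrite iotaE; congr (s _); apply: gmv_inj => a; rewrite gmapE (act1 hact'). Qed.

Lemma end_corner : corner_embedding iota'.
Proof.
split.
- move=> x y; apply: (act_inj hact) => t; rewrite (actD hact) !iotaE -linearD.
  by congr (s _); apply: gmv_inj => a; rewrite gmvD !gmapE (actD hact').
- move=> x y; apply: (act_inj hact) => t; rewrite (actM hact) !iotaE sK.
  by congr (s _); apply: gmv_inj => a; rewrite !gmapE (actM hact').
- move=> x y E; apply: (act_inj hact'); apply: gmap_eq => h.
  by apply: (can_inj sK); rewrite -[h]sK -!iotaE E.
move=> a aE; have [g gE] := gmap_full (lcomp (lcomp p (act a)) s).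
have [x xE] := act_full hact' g; exists x; apply: (act_inj hact) => t.
rewrite -[in RHS]aE !(actM hact) !iota'1 iotaE; congr (s _).
rewrite -[RHS]/(lcomp (lcomp p (act a)) s (p t)) -gE.
by apply: gmv_inj => b; rewrite !gmapE xE.
Qed.

(** Write f for the idempotent [s p]. The module [f R] is [Hom_A(T, G T') = Hom_S(e T, T')], of
    dimension at most [d'] over [R']. A presentation of an [R]-module [N] killed by f is a matrix,
    that is, a map [al] between powers of [T]; its kernel [X] is killed by [e], and [N = Hom(X, T)]
    has dimension at most [d]. *)
Lemma end_good (hi' : corner_embedding iota') : good_corner hi'.
Proof.
have [fT iT cT [d hd]] := hT; have [fT' iT' cT' [d' hd']] := hT'.
exists (maxn d d'); split.
  apply: (pdl_leq (leq_maxr _ _)).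
  have hE : pdl d' (hmod hact' (ep T)).
    by apply: hmod_pdl => //; apply/(fp_epart hA good) => //; case: fT.
  have lin : linear (fun w : epart hi' R^o => hmc hact' (coadj (lcomp p (act (epv w : R))))).
    move=> x v w; apply: hmv_eq => t; rewrite hmvD hmvZ !hmcE !coadjE !lcompE.
    rewrite epvD epvZ (actD hact) linearD gmvD; congr (_ + _).
    by rewrite (actM hact) iotaE sK gmapE.
  have fI : injective (lin_of lin).
    apply: lker0_inj => w w0; apply: epv_inj; apply: (act_inj hact) => t.
    have ew : (epv w : R) = iota' 1 * (epv w : R) := esym (epvP w).
    rewrite ew (actM hact) iota'1 (act0 hact).
    rewrite (_ : p (act _ t) = 0) ?linear0 //.
    apply: (@gm_ext _ _ _ hi T T' (lcomp p (act (epv w : R))) (lzero _ _)) => x.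
    exact: (congr1 (fun f => hmv f x) w0).
  have fS : surjective (lin_of lin).
    move=> f; have [r rE] := act_full hact (lcomp s (adj (hmv f))).
    exists (epc hi' (r : R^o)); apply: hmv_eq => t.
    rewrite hmcE coadjE lcompE epcE -[_ *: _]/(iota' 1 * r) (actM hact) iota'1 sK rE lcompE sK.
    by rewrite adj_epv.
  have [h _] := iso_summand fI fS; exact: pdl_summand h hE.
move=> N fN tN; apply: (pdl_leq (leq_maxl _ _)).
have [b [q qS]] := fg_cover fN.
have [K [iK hs]] := ker_ses qS; have [iKI _ exK] := hs.
have [a [g gK]] := noethR (fg_free R b) iKI.
pose kap i j : R := (iK (g i) : free R b) j.
pose al : {linear {ffun 'I_b -> T} -> {ffun 'I_a -> T}} :=
  lcol (fun i => lsum (fun j => lcomp (act (kap i j)) (lproj T j))).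
have alE x i : al x i = \sum_j act (kap i j) (x j) by rewrite ffunE.
have kerq (r : free R b) : q r = 0 -> exists c : 'I_a -> R, forall j, r j = \sum_i c i * kap i j.
  move=> /exK[y <-]; have [c ->] := gK y; exists c => j.
  by rewrite linear_sum sum_ffunE; apply: eq_bigr => i _; rewrite linearZZ ffunE.
have rowE c (x : {ffun 'I_b -> T}) (r : free R b) : (forall j, r j = \sum_i c i * kap i j) ->
    \sum_j act (r j) (x j) = \sum_i act (c i) (al x i).
  move=> rE; under eq_bigr => j _ do rewrite rE (act_sum hact).
  rewrite exchange_big /=; apply: eq_bigr => i _; rewrite alE linear_sum.
  by apply: eq_bigr => j _; rewrite (actM hact).
have [I [u [v [uS vI vu]]]] := im_factor al.
have [X [iX hsX]] := ker_ses uS; have [iXI _ exX] := hsX.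
have alX x : al (iX x) = 0 by rewrite -vu (exact_comp0 _ exX) linear0.
have fpTn n : fp ({ffun 'I_n -> T} : lmodType A).
  by apply: fp_add fT; apply: add_of_ffun; apply: add_of_refl.
(* The [e]-part of [T^b] embeds in a power of [T']. The transpose of each component, followed by
   [s], is a row [rr] fixed by the idempotent; its class in [N] is killed by it, hence zero, so the
   row factors through [al] and vanishes on [X]. *)
have tX x : e *: x = 0 :> X.
  apply: iXI; rewrite linear0 linearZZ.
  have hepb : fp (ep {ffun 'I_b -> T}).
    by apply/(fp_epart hA good); [case: (fpTn b)|].
  have [n [w wI]] := cT' _ hepb.
  rewrite -(epcE hi) (_ : epc hi (iX x) = 0) //; apply: (linj0 wI); apply/ffunP=> l.
  have [r rE] := act_row hact (lcomp s (adj (lcomp (lproj T' l) w))).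
  pose rr : free R b := [ffun j => r j].
  have fr j : iota' 1 * r j = r j.
    apply: (act_row_inj hact (r := fun j => iota' 1 * r j)) => y.
    under eq_bigr => i _ do rewrite (actM hact).
    by rewrite -linear_sum -rE lcompE iota'1 sK.
  have q0 : q rr = 0.
    have -> : rr = iota' 1 *: rr.
      by apply/ffunP=> j; rewrite !ffunE -[LHS]fr.
    by rewrite linearZZ tN.
  have [c cE] := kerq rr q0.
  have z0 : s (adj (lcomp (lproj T' l) w) (iX x)) = 0.
    rewrite -[LHS]/(lcomp s (adj (lcomp (lproj T' l) w)) (iX x)) rE.
    transitivity (\sum_j act (rr j) (iX x j)); first by apply: eq_bigr => j _; rewrite ffunE.
    by rewrite (rowE c) // alX big1 // => i _; rewrite ffunE linear0.
  have := congr1 (fun h : G T' => gmv h 1) (linj0 (can_inj sK) z0).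
  by rewrite adjE scale1r => z1; rewrite [RHS]ffunE; apply: z1.
(* [X] is killed by [e], so it is in P^{<oo}; hence so are the image [I] and the cokernel [C] of
   [al]. Extending maps to [T] along [I -> T^a] gives injectivity of [psi], and along [X -> T^b]
   surjectivity. *)
have [cg [_ ht]] := good.
have fX : fp X.
  have fgX : finitely_generated X := noeth (proj1 (fpTn b)) iXI.
  by split=> //; exists cg; apply: ht.
have fI : fp I by apply: fp_coker hsX fX (fpTn b).
have [C [pC hsC]] := coker_ses vI.
have fC : fp C by apply: fp_coker hsC fI (fpTn a).
have lin : linear (fun r : free R b => hmc hact (lsum (fun j => lcomp (lcomp (act (r j)) (lproj T j)) iX))).
  move=> c x y; apply: hmv_eq => t; rewrite hmvD hmvZ !hmcE /= linear_sum -big_split /=.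
  by apply: eq_bigr => j _; rewrite !ffunE (actD hact) (actM hact).
have linE r x : hmv (lin_of lin r) x = \sum_j act (r j) (iX x j) by [].
have [psi psiE] : exists psi : {linear N -> hmod hact X}, forall r, psi (q r) = lin_of lin r.
  apply: factor_surj => // r /kerq[c cE]; apply: hmv_eq => x; rewrite linE (rowE c) // alX.
  by rewrite big1 // => i _; rewrite ffunE linear0.
have psiI : injective psi.
  apply: lker0_inj => y; have [r <-] := qS y; rewrite psiE => r0.
  have [h hE] : exists h : {linear I -> T}, forall x, h (u x) = lsum (fun j => lcomp (act (r j)) (lproj T j)) x.
    apply: factor_surj => // x /exX[z <-].
    by rewrite -[LHS]/(hmv (lin_of lin r) z) r0.
  have [h' h'E] := iT _ fC _ _ _ _ hsC h.
  have [c cE] := act_row hact h'.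
  have rE j : r j = \sum_i c i * kap i j.
    apply: (act_row_inj hact (r := r) (r' := fun j => \sum_i c i * kap i j)) => x.
    transitivity (h (u x)); first by rewrite hE.
    rewrite -h'E vu cE.
    by rewrite -(rowE c x [ffun j => \sum_i c i * kap i j]) => [|l]; rewrite ?ffunE //;
      apply: eq_bigr => l _; rewrite ffunE.
  apply/exK; exists (\sum_i c i *: g i); apply/ffunP=> j.
  rewrite rE linear_sum sum_ffunE; apply: eq_bigr => i _; by rewrite linearZZ ffunE.
have psiS : surjective psi.
  move=> f; have [h hE] := iT _ fI _ _ _ _ hsX (hmv f).
  have [r rE] := act_row hact h.
  exists (q [ffun j => r j]); rewrite psiE; apply: hmv_eq => x; rewrite linE -hE rE.
  by apply: eq_bigr => j _; rewrite ffunE.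
have [h _] := iso_summand psiI psiS; apply: pdl_summand h _.
exact: hmod_pdl.
Qed.

End GoodEnd.

(** * Tilting steps *)

Section TiltingSteps.
Variables (k : comPzRingType) (A S : pzRingType) (phi : {rmorphism k -> A}) (iota : S -> A).
Hypotheses (hA : artin_over phi) (hi : corner_embedding iota) (good : good_corner hi).
Local Notation ep := (epart hi).
Local Notation G := (gmod hi).
Let noeth : noetherian_ring A := artin_noetherian hA.
Implicit Types X Y Z T : lmodType A.
Implicit Types M N : lmodType S.

Lemma strong_tilt_of_add (Q : pzRingType) (U V : lmodType Q) :
  strong_tilt U -> add_of U V -> add_of V U -> strong_tilt V.
Proof.
move=> [fU iU cU hd] hV hU; split=> //.
- exact: fp_add hV fU.
- exact: rel_injective_add iU hV.
move=> X hX; have [n [u uI]] := cU X hX.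
have [m [s [r sK]]] := add_of_ffun n hU.
by exists m, (lcomp s u) => x y /= /(can_inj sK) /uI.
Qed.

Lemma strong_tilt_corner T : strong_tilt T -> exists N, strong_tilt N.
Proof.
move=> hT; have [phiS hphiS] := corner_scalars hA hi.
have [_ _ _ hd] := hT; have [d hd'] := proj1 (corner_pd_bound hA good) hd.
apply: (ctf_strong_tilt (corner_artin_over hA hi hphiS) _ hd').
apply: (proj1 (ctf_corner hA good)) => X fX; exact: (strong_tilt_approx hA hT fX).
Qed.

Lemma corner_strong_tilt N : strong_tilt N -> exists T, strong_tilt T.
Proof.
move=> hN; have [phiS hphiS] := corner_scalars hA hi.
have [_ _ _ hd] := hN; have [d hd'] := proj2 (corner_pd_bound hA good) hd.
apply: (ctf_strong_tilt hA _ hd').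
apply: (proj2 (ctf_corner hA good)) => M fM.
exact: (strong_tilt_approx (corner_artin_over hA hi hphiS) hN fM).
Qed.

Lemma gmod_add T N : strong_tilt T -> fp N -> rel_injective N -> add_of T (G N).
Proof.
move=> hT fN iN; apply: strong_tilt_add => //; first exact: (fp_gmod hA good).
exact: (rel_injective_gmod hA good).
Qed.

Lemma add_of_zero_module (Q : pzRingType) (U X : lmodType Q) : zero_module X -> add_of U X.
Proof.
by move=> z; exists 0%N, (lzero _ _), (lzero _ _) => x; rewrite (z x) (z (lzero _ _ _)).
Qed.

Lemma add_of_iso_prod (Q : pzRingType) (U X Y Z : lmodType Q) : isomorphic X (Y * Z)%type ->
  (add_of U X <-> add_of U Y /\ add_of U Z).
Proof.
move=> [f /bijectiveP[fI fS]]; have [h h'] := iso_summand fI fS; split.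
  move=> hX; split; apply: add_of_summand hX; apply: summand_trans h'.
    exact: summandl.
  exact: summandr.
by move=> [hY hZ]; exact: (add_of_summand h (add_of_prod hY hZ)).
Qed.

Definition gunit X : {linear X -> G (ep X)} := adj (lid (ep X)).

Lemma gunitE X x a : gmv (gunit X x) a = epc hi (a *: x).
Proof. by rewrite adjE. Qed.

Lemma gunit_natural X Y (f : {linear X -> Y}) x : gmap hi (emap hi f) (gunit X x) = gunit Y (f x).
Proof.
apply: gmv_inj => a; rewrite gmapE !gunitE; apply: epv_inj.
by rewrite emapE !epcE -!linearZZ.
Qed.

Lemma gunit_gmod N h : gunit (G N) (gmap hi (counit hi N) h) = h.
Proof.
apply: (@gm_ext _ _ _ hi _ _ (lcomp (gunit (G N)) (gmap hi (counit hi N))) (lid _)) => x.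
apply: (@counit_inj _ _ _ hi N); rewrite lcompE gunitE scale1r counitE epcE gmvZ mul1r.
by rewrite gmv_e1 gmapE.
Qed.

(** The unit is bijective on [G N], and this passes to summands by naturality; so a summand [Z] of
    [G N] is again of the form [G (e Z)]. *)
Lemma gunit_bij Z N : direct_summand Z (G N) -> bijective (gunit Z).
Proof.
move=> [s [p sK]]; apply/bijectiveP; split.
  apply: lker0_inj => z z0; apply: (can_inj sK); rewrite linear0; apply: gmv_inj => a.
  have : gmap hi (emap hi s) (gunit Z z) = 0 by rewrite z0 linear0.
  rewrite gunit_natural => /(congr1 (fun h : G _ => gmv h a)); rewrite gunitE => /(congr1 (counit hi N)).
  by rewrite counitE epcE gmvZ mul1r gmv_e1 gmvZ mul1r !linear0.
move=> h; exists (p (gmap hi (counit hi N) (gmap hi (emap hi s) h))).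
rewrite -gunit_natural gunit_gmod; apply: gmv_inj => a; rewrite !gmapE.
by apply: epv_inj; rewrite !emapE sK.
Qed.

Lemma gmod_prod_iso M Z N : direct_summand Z (G N) ->
  exists f : {linear G (M * ep Z)%type -> (G M * Z)%type}, bijective f.
Proof.
move=> /gunit_bij /bij_linear[u [uK Ku]].
exists (lpair (gmap hi (lfst M (ep Z))) (lcomp u (gmap hi (lsnd M (ep Z))))).
apply/bijectiveP; split.
  apply: lker0_inj => h [h1 /(linj0 (can_inj Ku)) h2]; apply: gmv_inj => a.
  have := congr1 (fun h : G _ => gmv h a) h1.
  have := congr1 (fun h : G _ => gmv h a) h2; rewrite !gmapE !gmv0 /=.
  by case: (gmv h a) => x y /= -> ->.
move=> [x z]; exists (gmap hi (linl M (ep Z)) x + gmap hi (linr M (ep Z)) (gunit Z z)).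
congr pair; last rewrite lcompE; last rewrite -[RHS]uK; last congr (u _).
  by apply: gmv_inj => a; rewrite gmapE gmvD !gmapE /= addr0.
by apply: gmv_inj => a; rewrite gmapE gmvD !gmapE /= add0r.
Qed.

(* M is chosen with the image of G M in T as large as possible. *)
Lemma corner_summand T N : strong_tilt T -> strong_tilt N ->
  exists M (s : {linear G M -> T}) (p : {linear T -> G M}), cancel s p /\ add_of (G M) (G N).
Proof.
move=> hT hN; have [fT iT _ _] := hT; have [fN iN _ _] := hN.
have [n hn] := fg_len hA (proj1 fT).
have [||W [[M [s [p [sK WE]]]] Wmax]] := len_max hn (W0 := fun x => x = 0)
  (P := fun W => exists M (s : {linear G M -> T}) (p : {linear T -> G M}),
     cancel s p /\ forall x, W x <-> exists y, s y = x).
- move=> W [M [s [p [_ WE]]]].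
  rewrite (_ : W = fun x => exists y, s y = x); last by apply/funext => x; apply/propext.
  exact/submod_kclosed/im_submod.
- have z (h : G (free S 0)) : h = 0 by apply: gmv_inj => a; apply/ffunP=> -[].
  exists (free S 0), (lzero _ _), (lzero _ _); split=> [h|x]; first by rewrite (z h).
  by split=> [->|[h <-]] //; exists 0.
exists M, s, p; split=> //.
have hGN : add_of T (G N) := gmod_add hT fN iN.
have fGN : fp (G N) := fp_add hGN fT.
have [m hm] := fg_len hA (proj1 fGN).
(* If [Z] is not a summand of [G M], it is one of the complement [T2]. Then [G (M * e Z)], which is
   [G M * Z], splits off [T] with a larger image, contrary to the choice of [M]. *)
have key Z : indecomposable Z -> direct_summand Z (G N) -> direct_summand Z (G M).
  move=> iZ hZ; apply: contrapT => nZ.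
  have [l hl] := fg_len hA (proj1 (fp_summand hZ fGN)).
  have [T2 [s2 [p2 [s2K ps ps2 dec]]]] := summand_compl sK.
  have ZT := indecomposable_add iZ hl (add_of_summand hZ hGN).
  have hT2 : direct_summand T (G M * T2)%type.
    exists (lpair p p2), (lcopair s s2) => x; exact: dec.
  have [//|[sz [pz szK]]] := indecomposable_prod iZ hl (summand_trans ZT hT2).
  have [th bth] := gmod_prod_iso M hZ; have [th' [thK Kth]] := bij_linear bth.
  pose s' := lcomp (lcopair s (lcomp s2 sz)) th.
  pose p' := lcomp th' (lpair p (lcomp pz p2)).
  have s'K : cancel s' p'.
    move=> h; rewrite -[RHS]thK; congr (th' _); rewrite /s' lcompE.
    case: (th h) => x z; rewrite lcopairE lcompE; congr pair; rewrite ?lcompE linearD.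
      by rewrite sK ps2 addr0.
    by rewrite ps s2K add0r szK.
  have /= Wle := Wmax (fun x => exists h, s' h = x) (ex_intro _ _ (ex_intro _ s'
    (ex_intro _ p' (conj s'K (fun x => iff_refl _))))).
  have s'E x z : s' (th' (x, z)) = s x + s2 (sz z) by rewrite /s' lcompE Kth lcopairE.
  case: iZ => -[] z.
  have /WE[y yE] : W (s2 (sz z)).
    apply: Wle; last by exists (th' (0, z)); apply: (etrans (s'E 0 z)); rewrite linear0 add0r.
    by move=> x /WE[y <-]; exists (th' (y, 0)); apply: (etrans (s'E y 0)); rewrite !linear0 addr0.
  by rewrite -[z]szK -[sz z]s2K -yE ps linear0.
have := @indec_ind _ _ phi (fun X => direct_summand X (G N) -> add_of (G M) X).
apply=> [X zX _|X iX hX|X Y Z iso PY PZ hX||].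
- exact: add_of_zero_module.
- by apply: add_of_summand (key _ iX hX) (add_of_refl _).
- apply/(add_of_iso_prod _ iso); have [f /bijectiveP[fI fS]] := iso.
  have [_ h] := iso_summand fI fS.
  split; [apply: PY|apply: PZ]; apply: summand_trans hX; apply: summand_trans h.
    exact: summandl.
  exact: summandr.
- exact: hm.
exact: summand_refl.
Qed.

(** Applying [e] to [G N] in [add (G M)] puts [N] in [add M], so [M] inherits the cogenerating
    property from [N]. *)
Lemma strong_tilt_epart M N : strong_tilt N -> fp (G M) -> rel_injective (G M) ->
  add_of (G M) (G N) -> strong_tilt M.
Proof.
move=> hN fGM iGM hGN; have [fN iN cN [d hd]] := hN.
have [hM hM'] := ep_gmod_iso hi M; have [hN1 _] := ep_gmod_iso hi N.
have fM : fp M.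
  apply: fp_summand hM _; apply/(fp_epart hA good) => //; by case: fGM.
have hepM : add_of M (ep (G M)) := add_of_summand hM' (add_of_refl M).
have aN : add_of M N.
  apply: (add_of_summand hN1); have [n hn] := hGN.
  apply: add_of_summand (emap_summand hi hn) _; apply: add_of_summand (emap_ffun hi _ n) _.
  exact: add_of_ffun.
split=> //.
- by move=> X fX; apply: (rel_injective_of_gmod hA good iGM).
- move=> X fX; have [n [u uI]] := cN X fX; have [m [s [r sK]]] := add_of_ffun n aN.
  by exists m, (lcomp s u) => x y /= /(can_inj sK) /uI.
by exists d.
Qed.

End TiltingSteps.

(** * One tilting step, down to the corner and up from it *)

Section CornerSteps.
Variables (k : comPzRingType) (A S : pzRingType) (phi : {rmorphism k -> A}) (iota : S -> A).
Hypotheses (hA : artin_over phi) (hi : corner_embedding iota) (good : good_corner hi).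
Local Notation G := (gmod hi).

(** The conclusion concerns every realisation [S2] of the corner [f R f], so that it also applies to
    converses of literal corners. *)
Lemma strong_tilt_down (T : lmodType A) (R : pzRingType) (act : R -> {linear T -> T}) :
  strong_tilt T -> end_action act -> noetherian_ring R ->
  exists f : R, f * f = f /\ exists T' : lmodType S, strong_tilt T' /\
    forall (S2 : pzRingType) (iota2 : S2 -> R) (h2 : corner_embedding iota2), iota2 1 = f ->
    ring_iso_End S2 T' /\ good_corner h2.
Proof.
move=> hT hact noethR; have [N hN] := strong_tilt_corner hA good hT.
have [M [s [p [sK hGN]]]] := corner_summand hA good hT hN.
have [fT iT _ _] := hT.
have hM : strong_tilt M.
  have hsum : direct_summand (G M) T by exists s, p.
  apply: (strong_tilt_epart hA good hN (fp_summand hsum fT) _ hGN).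
  exact: rel_injective_add iT (add_of_summand hsum (add_of_refl T)).
have [f fE] := act_full hact (lcomp s p).
have fsE t : act f (s t) = s t by rewrite fE lcompE sK.
exists f; split.
  by apply: (act_inj hact) => t; rewrite (actM hact) !fE !lcompE sK.
exists M; split=> // S2 iota2 h2 f1; have [i2D i2M i2I i2f] := h2.
have /choice[act' act'E] : forall x, exists g : {linear M -> M},
    forall h, gmap hi g h = lcomp (lcomp p (act (iota2 x))) s h.
  by move=> x; apply: gmap_full.
have ev x h : act' x (gmv h 1) = gmv (p (act (iota2 x) (s h))) 1 by rewrite -gmapE act'E.
have lift m : exists h : G M, m = gmv h 1.
  by have [h <-] := counit_surj hi m; exists (epv h); rewrite counitE.
have iE x t : act (iota2 x) t = s (gmap hi (act' x) (p t)).
  rewrite act'E !lcompE -[s (p (act _ _))]/(lcomp s p _) -[s (p t)]/(lcomp s p t) -!fE -!(actM hact).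
  by rewrite -f1 (iota1l h2) (iota1r h2).
have hact' : end_action act'.
  split=> [x y t|x y t|t|x y E|g].
  - by have [h ->] := lift t; rewrite !ev i2D (actD hact) linearD gmvD.
  - have [h ->] := lift t; rewrite !ev i2M (actM hact) -[s (p _)]/(lcomp s p _) -fE.
    by rewrite -(actM hact f) -f1 (iota1l h2).
  - by have [h ->] := lift t; rewrite ev f1 fsE sK.
  - apply: i2I; apply: (act_inj hact) => t; rewrite !iE; congr (s _).
    by apply: gmv_inj => a; rewrite !gmapE E.
  have [r rE] := act_full hact (lcomp (lcomp s (gmap hi g)) p).
  have [|x xE] := i2f r.
    rewrite f1; apply: (act_inj hact) => t; rewrite !(actM hact) !fE !rE !lcompE.
    by rewrite ?fE ?lcompE !sK.
  exists x => t; have [h ->] := lift t.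
  by rewrite ev xE rE !lcompE !sK gmapE.
split; first by exists act'.
exact: (end_good hA good hT hM hact hact' noethR sK iE).
Qed.

Lemma strong_tilt_up (T' : lmodType S) (R' : pzRingType) (act' : R' -> {linear T' -> T'}) :
  strong_tilt T' -> end_action act' -> basic_sep R' ->
  exists T : lmodType A, [/\ strong_tilt T, basic_sep (endr T) &
    forall (R : pzRingType) (act : R -> {linear T -> T}), end_action act -> noetherian_ring R ->
    exists (iota' : R' -> R) (h' : corner_embedding iota'), good_corner h'].
Proof.
move=> hT' hact' bR'; have [T1 hT1] := corner_strong_tilt hA good hT'.
have [fT1 iT1 _ _] := hT1; have [fT' iT' _ _] := hT'.
(* [End(G T')] is isomorphic to [R']; the isomorphism serves as a corner embedding with idempotent
   one, and basicness is inherited. *)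
have bG : basic_sep (endr (G T')).
  have /choice[j jE] : forall a : endr (G T'), exists r,
      forall h, gmap hi (act' r) h = hm_lin a h.
    move=> a; have [g gE] := gmap_full (hi := hi) (hm_lin a); have [r rE] := act_full hact' g.
    by exists r => h; rewrite -gE; apply: gmv_inj => x; rewrite !gmapE rE.
  have hj : corner_embedding j; last exact: (basic_sep_corner hj bR').
  split.
  - move=> a b; apply: (act_inj hact'); apply: (gmap_eq (hi := hi)) => h; rewrite jE.
    rewrite -[LHS]/(hm_lin a h + hm_lin b h) -!jE; apply: gmv_inj => x; by rewrite gmvD !gmapE (actD hact').
  - move=> a b; apply: (act_inj hact'); apply: (gmap_eq (hi := hi)) => h; rewrite jE.
    rewrite -[LHS]/(hm_lin a (hm_lin b h)) -!jE; apply: gmv_inj => x; by rewrite !gmapE (actM hact').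
  - by move=> a b E; apply: hm_eq => h; apply: etrans (jE b h); rewrite -E; exact: esym (jE a h).
  move=> r _; exists (hm_of (gmap hi (act' r))).
  by apply: (act_inj hact'); apply: (gmap_eq (hi := hi)) => h; rewrite jE.
have [n hn] := fg_len hA (proj1 fT1).
(* Starting from [G T'], the indecomposable summands of [T1] are added one at a time when not yet
   present, so that the endomorphism ring stays basic. *)
have [T [bT hGT aT1T aTT1]] : exists T, [/\ basic_sep (endr T), direct_summand (G T') T,
    add_of T1 T & add_of T T1].
  have := @indec_ind _ _ phi (fun X => add_of T1 X -> forall T0, basic_sep (endr T0) ->
    add_of T1 T0 -> exists T, [/\ basic_sep (endr T), direct_summand T0 T,
    add_of T1 T & add_of T X]).
  move=> /(_ _ _ _ n T1 hn (add_of_refl T1)); apply=> //; last exact: (gmod_add hA good hT1 fT' iT').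
  - move=> X zX _ T0 b0 a0; exists T0; split=> //; first exact: summand_refl.
    exact: add_of_zero_module.
  - move=> Z iZ aZ T0 b0 a0; have [h|h] := pselect (direct_summand Z T0).
      exists T0; split=> //; first exact: summand_refl.
      exact: add_of_summand h (add_of_refl T0).
    have [l hl] := fg_len hA (proj1 (fp_add aZ fT1)).
    exists (T0 * Z)%type; split; first exact: (basic_sep_prod b0 iZ hl h).
    - exact: summandl.
    - exact: add_of_prod.
    exact: add_of_summand (summandr _ _) (add_of_refl _).
  move=> X Y Z iso PY PZ /(add_of_iso_prod _ iso)[aY aZ] T0 b0 a0.
  have [T2 [b2 s2 a2 c2]] := PY aY T0 b0 a0.
  have [T3 [b3 s3 a3 c3]] := PZ aZ T2 b2 a2.
  exists T3; split=> //; first exact: summand_trans s2 s3.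
  apply/(add_of_iso_prod _ iso); split=> //.
  exact: add_of_trans (add_of_summand s3 (add_of_refl T3)) c2.
have hT : strong_tilt T := strong_tilt_of_add hT1 aT1T aTT1.
exists T; split=> // R act hact noethR; have [s [p sK]] := hGT.
have /choice[iota' iE] : forall x, exists r, forall t, act r t = s (gmap hi (act' x) (p t)).
  by move=> x; have [r rE] := act_full hact (lcomp (lcomp s (gmap hi (act' x))) p); exists r.
exists iota', (end_corner hact hact' sK iE).
exact: (end_good hA good hT hT' hact hact' noethR sK iE).
Qed.

End CornerSteps.

(** * Change of sides and the infinite iteration *)

Lemma corner_embedding_conv (S A : pzRingType) (iota : S -> A) :
  corner_embedding iota -> @corner_embedding S^c A^c iota.
Proof.
move=> [iD iM iI iF]; split=> // [x y|a aE]; first exact: iM.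
by apply: iF; rewrite -[RHS]aE; apply: esym; apply: mulrA.
Qed.

Lemma corner_val_embedding (A : pzRingType) (e : idempotent_elt A) :
  corner_embedding (@corner_val A e).
Proof.
split=> // [x y E|a aE]; first exact: val_inj.
have a_in : idem_val e * a * idem_val e == a by apply/eqP.
by exists (Corner a_in).
Qed.

Lemma artin_conv (A : pzRingType) : artin_algebra A -> artin_algebra A^c.
Proof.
move=> [k [phi [hk hc [n [g hg]]]]].
have fD x y : phi (x + y) = phi x + phi y :> A^c by rewrite rmorphD.
have f1 : phi 1 = 1 :> A^c by rewrite rmorph1.
have fM x y : phi (x * y) = (phi x : A^c) * phi y by rewrite mulrC rmorphM.
exists k, (rmorph_of fD f1 fM); split=> // [c a|]; first exact: esym (hc c a).
exists n, g => a; have [c cE] := hg a; exists c; rewrite [LHS]cE.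
by apply: eq_bigr => i _; apply: hc.
Qed.

Lemma corner_artin (S A : pzRingType) (iota : S -> A) :
  corner_embedding iota -> artin_algebra A -> artin_algebra S.
Proof.
move=> hi /artin_algebra_over[k [phi [hk hA]]].
have [phiS hphiS] := corner_scalars hA hi.
have [_ hcS hkS] := corner_artin_over hA hi hphiS.
by exists k, phiS.
Qed.

Lemma artin_algebra_noetherian (A : pzRingType) : artin_algebra A -> noetherian_ring A.
Proof. move=> /artin_algebra_over[k [phi [_ hA]]]; exact: (artin_noetherian hA). Qed.

Lemma basic_artin_sep (A : pzRingType) : basic_artin_algebra A -> basic_sep A.
Proof. move=> [/artin_algebra_over[k [phi [_ hA]]]]; exact: (basic_ring_sep hA). Qed.

Lemma basic_artin_corner (S A : pzRingType) (iota : S -> A) :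
  corner_embedding iota -> basic_artin_algebra A -> basic_artin_algebra S.
Proof.
move=> hi hA; split; first exact: corner_artin hi (proj1 hA).
exact: basic_sep_ring (basic_sep_corner hi (basic_artin_sep hA)).
Qed.

(** The type varies with the index so that an idempotent can be chosen in the [i]-th ring at stage
    [i]. *)
Lemma dependent_choice (T : nat -> Type) (P : forall i, T i -> Prop)
    (E : forall i, T i -> T i.+1 -> Prop) (x0 : T 0) :
  P 0 x0 -> (forall i x, P i x -> exists y, P i.+1 y /\ E i x y) ->
  exists f : forall i, T i, f 0 = x0 /\ forall i, P i (f i) /\ E i (f i) (f i.+1).
Proof.
move=> P0 PS.
have next i (x : {x | P i x}) : {y | P i.+1 y /\ E i (projT1 x) y}.
  exact/cid/PS/(projT2 x).
pose f i : {x | P i x} := nat_rect (fun i => {x | P i x}) (exist _ x0 P0)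
  (fun i x => exist _ (projT1 (next i x)) (proj1 (projT2 (next i x)))) i.
exists (fun i => projT1 (f i)); split=> // i; split; first exact: projT2 (f i).
exact: (proj2 (projT2 (next i (f i)))).
Qed.

Section Steps.
Variables (A S : pzRingType) (iota : S -> A) (hi : corner_embedding iota).
Hypotheses (good : good_corner hi) (artA : artin_algebra A).

(** [R] is left free because, when left modules are tilted, [End(T)] occurs as its double
    converse. *)
Lemma tilting_up (R' : pzRingType) (T' : lmodType S) :
  strong_tilting T' -> ring_iso_End R' T' -> basic_sep R' ->
  exists T : lmodType A, [/\ strong_tilting T, basic_module T, artin_algebra (endr T),
    basic_sep (endr T) & forall R : pzRingType, ring_iso_End R T -> artin_algebra R ->
      exists (iota' : R' -> R) (h' : corner_embedding iota'), good_corner h'].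
Proof.
move=> tT' [act' hact'] bR'.
have [k [phi [hk hA]]] := artin_algebra_over artA.
have hT' := proj1 (strong_tiltingP (corner_noetherian hA hi) T') tT'.
have [T [hT bT up]] := strong_tilt_up hA good hT' hact' bR'.
exists T; split=> //.
- exact/(strong_tiltingP (artin_noetherian hA)).
- exact: basic_sep_module (endr_ring_iso T) bT.
- by apply: (endr_artin hk hA); case: hT => -[].
move=> R [act hact] aR; exact: up hact (artin_algebra_noetherian aR).
Qed.

Lemma tilting_down (R : pzRingType) (T : lmodType A) :
  strong_tilting T -> ring_iso_End R T -> artin_algebra R -> basic_sep R ->
  exists f : R, f * f = f /\ exists T' : lmodType S, strong_tilting T' /\
    forall (S2 : pzRingType) (iota2 : S2 -> R) (h2 : corner_embedding iota2), iota2 1 = f ->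
    [/\ basic_module T', ring_iso_End S2 T' & good_corner h2].
Proof.
move=> tT [act hact] aR bR; have [k [phi [_ hA]]] := artin_algebra_over artA.
have hT := proj1 (strong_tiltingP (artin_noetherian hA) T) tT.
have [f [ff [T' [hT' down]]]] := strong_tilt_down hA good hT hact (artin_algebra_noetherian aR).
exists f; split=> //; exists T'; split.
  exact/(strong_tiltingP (corner_noetherian hA hi)).
move=> S2 iota2 h2 f1; have [iS2 g2] := down S2 iota2 h2 f1; split=> //.
exact: basic_sep_module iS2 (basic_sep_corner h2 bR).
Qed.

End Steps.

(* Ring carrying the left modules that are tilted at the steps of the given parity. *)
Definition side (b : bool) (A : pzRingType) : pzRingType := if b then (A^c : pzRingType) else A.

Lemma unlimited_up (A S : pzRingType) (iota : S -> A) (hi : corner_embedding iota) :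
  good_corner hi -> basic_artin_algebra A ->
  unlimited_strong_tilting S -> unlimited_strong_tilting A.
Proof.
move=> good hA [S_ [S0 bS even_step odd_step]].
(* The invariant: the given [S_ i] is a good corner of the ring [B] built at stage [i], both read on
   the side that is tilted at this stage. *)
pose P i B := basic_artin_algebra B /\
  exists (j : side (odd i) (S_ i) -> side (odd i) B) (hj : corner_embedding j), good_corner hj.
pose E i B C := if odd i then left_from_right B C else right_from_left B C.
have P0 : P 0%N A by split=> //; rewrite /= S0; exists iota, hi.
have [|A_ [A0 hA_]] := dependent_choice (T := fun=> pzRingType) (E := E) P0.
  move=> i B; rewrite /P /E /side; case oi: (odd i) => /= -[hB [j [hj gj]]].
    have [T' [tT' _ eT']] := odd_step i oi.
    have [T [tT bT aE sE up]] := tilting_up gj (artin_conv (proj1 hB)) tT' eT' (basic_artin_sep (bS i.+1)).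
    exists (endr T); rewrite oi /=; split; last by exists T; split=> //; apply: endr_ring_iso.
    split; first by split=> //; apply: basic_sep_ring.
    exact: up (endr_ring_iso T) aE.
  have [T' [tT' _ eT']] := even_step i (negbT oi).
  have [T [tT bT aE sE up]] := tilting_up gj (proj1 hB) tT' eT'
    (basic_sep_conv (basic_artin_sep (bS i.+1))).
  exists (endr T)^c; rewrite oi /=; split; last by exists T; split=> //; apply: endr_ring_iso_conv.
  split; first by split; [apply: artin_conv|apply: basic_sep_ring; apply: basic_sep_conv].
  exact: up (endr_ring_iso_conv T) (artin_conv (artin_conv aE)).
exists A_; split=> // i; first by have [[]] := hA_ i.
- by move=> /negPf oi; have [_] := hA_ i; rewrite /E oi.
by move=> oi; have [_] := hA_ i; rewrite /E oi.
Qed.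

Lemma unlimited_down (A : pzRingType) (e : idempotent_elt A) :
  good_corner (corner_val_embedding e) ->
  unlimited_strong_tilting A -> unlimited_strong_tilting (corner e).
Proof.
move=> good [A_ [A0 bA even_step odd_step]]; subst A.
(* The rings [A_ i] are given, and an idempotent is chosen in each. Goodness of the corner it cuts
   out is read on the side that is tilted at stage [i]. *)
pose P i (f : idempotent_elt (A_ i)) := if odd i then
    good_corner (corner_embedding_conv (corner_val_embedding f))
  else good_corner (corner_val_embedding f).
pose E i (f : idempotent_elt (A_ i)) (g : idempotent_elt (A_ i.+1)) := if odd i then
    left_from_right (corner f) (corner g)
  else right_from_left (corner f) (corner g).
have [|f [f0 hf]] := dependent_choice (P := P) (E := E) (x0 := e) good.
  move=> i f; rewrite /P /E /=; case oi: (odd i) => /= gf.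
    have [T [tT _ eT]] := odd_step i oi.
    have [g [gg [T' [tT' down]]]] := tilting_down gf (artin_conv (proj1 (bA i))) tT eT
      (proj1 (bA i.+1)) (basic_artin_sep (bA i.+1)).
    exists (Idempotent gg); have [//|bT' eT' gg'] := down _ _ (corner_val_embedding (Idempotent gg)).
    by split=> //; exists T'.
  have [T [tT _ eT]] := even_step i (negbT oi).
  have [g [gg [T' [tT' down]]]] := tilting_down gf (proj1 (bA i)) tT eT
    (artin_conv (proj1 (bA i.+1))) (basic_sep_conv (basic_artin_sep (bA i.+1))).
  have gg2 : Defs.idempotent (g : A_ i.+1) := gg.
  exists (Idempotent gg2).
  have [//|bT' eT' gg'] := down _ _ (corner_embedding_conv (corner_val_embedding (Idempotent gg2))).
  by split=> //; exists T'.
exists (fun i => corner (f i)); split=> [|i|i /negPf oi|i oi]; first by rewrite f0.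
- exact: basic_artin_corner (corner_val_embedding (f i)) (bA i).
- by have [_] := hf i; rewrite /E oi.
by have [_] := hf i; rewrite /E oi.
Qed.

Theorem proposition5p7 (Lambda : pzRingType) (n r : nat) (eps : 'I_n -> Lambda)
  (e : idempotent_elt Lambda)
  (hLambda : basic_artin_algebra Lambda)
  (heps : complete_primitive_idempotents eps)
  (hrn : (r <= n)%N)
  (hpdim : forall i : 'I_n, (r <= i)%N -> pdim_le (top_module (eps i)) 1)
  (he : idem_val e = \sum_(i < n | (i < r)%N) eps i) :
  (fin_pdim_contravariantly_finite Lambda <->
     fin_pdim_contravariantly_finite (corner e)) /\
  (unlimited_strong_tilting Lambda <-> unlimited_strong_tilting (corner e)).
Proof.
have [artA bA] := hLambda; have [k [phi [_ hA]]] := artin_algebra_over artA.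
pose hi := corner_val_embedding e.
have good : good_corner hi := good_corner_low_pdim hA bA heps hpdim _ he.
split; last by split; [apply: unlimited_down|apply: (unlimited_up good)].
by split=> /ctfP h; apply/ctfP; apply/(ctf_corner hA good).
Qed.
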